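(* Let $n\ge 2$. Let $K\subset\{x_{n+1}=0\}\subset\mathbb{R}^{n+1}$ be any compact set. Then, for any $\varepsilon>0$ there exists a global solution $u=u_\varepsilon$ to the thin obstacle problem in $\mathbb{R}^{n+1}$ with polynomial growth such that $$K\subset\Lambda(u_\varepsilon)\quad\text{and}\quad \mathrm{dist}_{\mathcal{H}}(\Lambda(u_\varepsilon),K)\le\varepsilon,$$ and $$\mathrm{dist}_{\mathcal{H}}(\Gamma(u_\varepsilon),\partial_{\mathbb{R}^n}K)\le\varepsilon.$$
   Context: Write $x=(x',x_{n+1})\in\mathbb{R}^n\times\mathbb{R}$. A global solution to the thin obstacle problem in $\mathbb{R}^{n+1}$ is a continuous function $u:\mathbb{R}^{n+1}\to\mathbb{R}$ such that: $u\ge 0$ on $\{x_{n+1}=0\}$; $\Delta u=0$ in $\mathbb{R}^{n+1}\setminus\{x_{n+1}=0,\ u=0\}$; $\Delta u\le 0$ in $\mathbb{R}^{n+1}$ (in the weak, i.e. distributional or viscosity, sense); and $u(x',x_{n+1})=u(x',-x_{n+1})$ in $\mathbb{R}^{n+1}$. The contact set is $\Lambda(u)=\{(x',0): x'\in\mathbb{R}^n,\ u(x',0)=0\}$, and the free boundary is $\Gamma(u)=\partial_{\mathbb{R}^n}\{x'\in\mathbb{R}^n: u(x',0)>0\}\times\{0\}$. Here $\partial_{\mathbb{R}^n}$ denotes the boundary in the relative topology of the thin space $\{x_{n+1}=0\}\cong\mathbb{R}^n$, and $\mathrm{dist}_{\mathcal{H}}$ denotes the Hausdorff distance between sets. A function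 $u:\mathbb{R}^{n+1}\to\mathbb{R}$ has polynomial growth if there is some $m\in\mathbb{N}$ such that $\left\|\frac{u(x)}{1+|x|^m}\right\|_{L^\infty(\mathbb{R}^{n+1})}<+\infty$. *)

(* Defs.v *)
(* R^(n+1) is 'rV[R]_(n + 1), seen as R^n x R by lsubmx and
   rsubmx.  The library norm on row vectors is the sup norm (it only serves to
   give the topology), hence the separate Euclidean norm [enorm]. *)
From HB Require Import structures.
From mathcomp Require Import all_boot all_order all_algebra.
From mathcomp Require Import all_classical all_reals all_analysis.
Set Implicit Arguments.
Unset Strict Implicit.
Unset Printing Implicit Defensive.
Import Order.TTheory GRing.Theory Num.Theory.
Import numFieldNormedType.Exports.
Local Open Scope classical_set_scope.
Local Open Scope ring_scope.

Section Euclidean.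
Context {R : realType} {d : nat}.
Implicit Types (x y : 'rV[R]_d) (A B U : set 'rV[R]_d) (f : 'rV[R]_d -> R).

Definition enorm x : R := Num.sqrt (\sum_(i < d) x ord0 i ^+ 2).

Definition edist_set x A : \bar R :=
  ereal_inf [set (enorm (x - y))%:E | y in A].

(* The [maxe 0] only matters when A or B is empty, as the supremum of the empty
   set is -oo: the distance is 0 between two empty sets, and +oo between an
   empty set and a nonempty one. *)
Definition hausdorff_dist A B : \bar R :=
  maxe 0%E (maxe (ereal_sup [set edist_set x B | x in A])
                 (ereal_sup [set edist_set y A | y in B])).

Definition boundary A : set 'rV[R]_d := closure A `\` interior A.

Definition partial (i : 'I_d) f : 'rV[R]_d -> R :=
  fun x => 'D_(delta_mx ord0 i) f x.

Definition laplacian f : 'rV[R]_d -> R :=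
  fun x => \sum_(i < d) partial i (partial i f) x.

(* Meant for open sets U.  The derivability clauses are needed since 'D_v is
   total, with an arbitrary value where the limit does not exist. *)
Definition C2_on U f : Prop :=
  forall x, U x -> forall i j : 'I_d,
    [/\ derivable f x (delta_mx ord0 i),
        {for x, continuous (partial i f)},
        derivable (partial i f) x (delta_mx ord0 j) &
        {for x, continuous (partial j (partial i f))}].

Definition harmonic_on U f : Prop :=
  C2_on U f /\ forall x, U x -> laplacian f x = 0.

(* Laplacian f <= 0 on the whole space in the viscosity sense: every C^2
   function touching f from below at x has nonpositive Laplacian at x. *)
Definition viscosity_superharmonic f : Prop :=
  forall (x : 'rV[R]_d) (V : set 'rV[R]_d) (phi : 'rV[R]_d -> R),
    open V -> V x -> C2_on V phi -> phi x = f x ->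
    (forall y, V y -> phi y <= f y) ->
    laplacian phi x <= 0.

(* The supremum is the L^oo norm for continuous f, the only use made of it. *)
Definition polynomial_growth f : Prop :=
  exists m : nat,
    (ereal_sup [set (`|f x / (1 + enorm x ^+ m)|)%:E | x in [set: 'rV[R]_d]]
       < +oo)%E.

End Euclidean.

Section ThinObstacle.
Context {R : realType} {n : nat}.
Implicit Types (u : 'rV[R]_(n + 1) -> R) (A : set 'rV[R]_(n + 1)).

Definition join_point (x' : 'rV[R]_n) (t : R) : 'rV[R]_(n + 1) :=
  row_mx x' (const_mx t).

Definition thin_embed (x' : 'rV[R]_n) : 'rV[R]_(n + 1) := join_point x' 0.

Definition thin_space : set 'rV[R]_(n + 1) :=
  [set x | rsubmx x ord0 ord0 = 0].

(* Boundary relative to the thin space, for A contained in it. *)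
Definition thin_boundary A : set 'rV[R]_(n + 1) :=
  thin_embed @` boundary (thin_embed @^-1` A).

Definition contact_set u : set 'rV[R]_(n + 1) :=
  thin_embed @` [set x' | u (thin_embed x') = 0].

Definition free_boundary u : set 'rV[R]_(n + 1) :=
  thin_embed @` boundary [set x' | 0 < u (thin_embed x')].

Record global_solution u : Prop := GlobalSolution {
  gs_continuous : continuous u;
  gs_ge0 : forall x', 0 <= u (thin_embed x');
  gs_harmonic : harmonic_on (~` (thin_space `&` [set x | u x = 0])) u;
  gs_superharmonic : viscosity_superharmonic u;
  gs_even : forall x' t, u (join_point x' t) = u (join_point x' (- t)) }.

End ThinObstacle.

(* Main.v *)
Require Import Defs.
From HB Require Import structures.
From mathcomp Require Import all_boot all_order all_algebra.
From mathcomp Require Import all_classical all_reals all_analysis.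
From mathcomp Require Import ring lra zify.
Set Implicit Arguments.
Unset Strict Implicit.
Unset Printing Implicit Defensive.
Import Order.TTheory GRing.Theory Num.Theory.
Import numFieldNormedType.Exports.
Local Open Scope classical_set_scope.
Local Open Scope ring_scope.

(* Take an obstacle phi = c0 - |x'|^2 - sum_y p_y(x')^(2N) on the thin space,
   where each p_y = 1 + tau (eta / 2 - |x' - y|^2) is quadratic, smaller than 1 on
   K and larger than 1 near y, and y ranges over a finite net of points away from
   K: for N large, phi is negative away from K.  Let v be the least nonnegative
   superharmonic function above phi on the thin space, and P the even harmonic
   extension of the polynomial -phi; then u = P + v is a global solution, and
   u = 0 on the thin space only where phi >= 0, that is, near K.  Conversely, at
   x0 in K convexity of t^(2N) puts phi below a concave paraboloid touching it at
   x0, and a positive multiple of (|x' - x1|^2 + (|t| + 1)^2)^(-1/4), plus a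
   nonnegative constant, is superharmonic and lies above that paraboloid on the
   thin space, with equality at x0; hence v = phi at x0, and K is in the contact set.
   Once Lambda(u) lies between K and a small neighborhood of K, the free boundary
   is close to the boundary of K by connectedness of segments.

   The function v is obtained without integration, as the limit along an
   ultrafilter of the solutions of the obstacle problem for the lattice Laplacian
   with mesh 1/(k+1).  Translation invariance gives uniform tangential Lipschitz
   and semiconvexity bounds; superharmonicity then gives vertical semiconcavity,
   hence a Lipschitz bound.  Off the contact set, a reflection and a quadratic
   barrier bound the differences of discrete harmonic functions, and three
   iterations of this estimate make the limit C^2. *)

(** * Interior estimates for discrete harmonic functions *)

(** The hypothesis n >= 2 enters through the barrier: a nonnegative superharmonic function on the
    plane is constant, whereas |X|^(-1/2) is strictly superharmonic from dimension 3 on. Touching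
    needs phi to be large on K, not merely nonnegative: a multiple of s^(-1/4) with slope -A at s0
    has the value 4 A s0 there, and the constant phi(x0) - 4 A s0 that completes the barrier must be
    nonnegative. Since s0 is bounded in terms of the size of K and the dimension alone, c0 can be
    fixed before the net, tau and N.

    On the lattice the infimum of supersolutions is again a supersolution, by monotonicity of finite
    averages, and lowering a single value shows that it is harmonic off the contact set. The price
    is that every estimate must be uniform in the mesh. Along an ultrafilter each bounded sequence
    converges, so the limit function and the limits of its difference quotients are defined at all
    points at once, without extracting subsequences. *)

Section Lattice.
Context {R : realType} {d : nat}.
Implicit Types (w g : 'rV[int]_d -> R) (z c : 'rV[int]_d) (i j : 'I_d).

Definition unit_vec i : 'rV[int]_d := delta_mx ord0 i.

Definition diff2 i w z : R := w (z + unit_vec i) + w (z - unit_vec i) - 2 * w z.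

Definition dlap w z : R := \sum_(i < d) diff2 i w z.

Definition fdiff i w : 'rV[int]_d -> R := fun z => w (z + unit_vec i) - w z.

Lemma unit_vecE i j : unit_vec i ord0 j = (j == i)%:R.
Proof. by rewrite mxE eqxx. Qed.

(** The box is the image of the finite type of functions from ['I_d] to ['I_(2 * N).+1], on which a
    maximum over any nonempty predicate exists. *)
Lemma box_argmax (B : set 'rV[int]_d) c (N : nat) w :
  B !=set0 -> (forall z, B z -> forall i, `|z ord0 i - c ord0 i| <= N%:Z) ->
  exists2 z, B z & forall z', B z' -> w z' <= w z.
Proof.
move=> [z0 Bz0] Bbox.
pose tau (t : {ffun 'I_d -> 'I_(2 * N).+1}) : 'rV[int]_d :=
  \row_i (c ord0 i - N%:Z + (t i)%:Z).
have tauP z : B z -> exists t, tau t = z.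
  move=> /Bbox zc.
  exists [ffun i => inord (absz (z ord0 i - c ord0 i + N%:Z))].
  apply/rowP => i; rewrite !mxE ffunE.
  have := zc i => zci.
  rewrite inordK; last by lia.
  rewrite gez0_abs; first ring; move: zci; rewrite ler_norml; lia.
have [t0 t0E] := tauP _ Bz0.
have P0 : [pred t | `[< B (tau t) >]] t0 by rewrite /= t0E; apply/asboolP.
case: (@Order.TotalTheory.arg_maxP _ _ _ t0 [pred t | `[< B (tau t) >]] (w \o tau) P0) => t /asboolP Bt tmax.
exists (tau t) => // z' Bz'; have [t' t'E] := tauP _ Bz'.
rewrite -t'E; apply: tmax => /=; apply/asboolP; by rewrite t'E.
Qed.

Lemma dlapD w g z : dlap (w \+ g) z = dlap w z + dlap g z.
Proof. rewrite /dlap -big_split; apply: eq_bigr => i _; rewrite /diff2 /=; ring. Qed.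

Lemma dlapN w z : dlap (\- w) z = - dlap w z.
Proof. rewrite /dlap -sumrN; apply: eq_bigr => i _; rewrite /diff2 /=; ring. Qed.

Lemma dlap_shift w c z : dlap (fun z => w (z + c)) z = dlap w (z + c).
Proof.
apply: eq_bigr => i _; rewrite /diff2.
by rewrite (addrAC z (unit_vec i)) (addrAC z (- unit_vec i)).
Qed.

Lemma dlap_fdiff w i z : dlap (fdiff i w) z = dlap w (z + unit_vec i) - dlap w z.
Proof.
rewrite /fdiff -(dlap_shift w (unit_vec i)) -dlapN -dlapD.
by [].
Qed.

Lemma dlap_max_neg w z :
  (forall i, w (z + unit_vec i) <= w z /\ w (z - unit_vec i) <= w z) -> dlap w z <= 0.
Proof.
move=> H; apply: sumr_le0 => i _; have [] := H i; rewrite /diff2; lra.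
Qed.

(* [w - w \o layer_swap i] is odd about the hyperplane z_i = 1/2, and its value
   at a unit vector is a difference of w. *)
Definition layer_swap i z : 'rV[int]_d := \row_j (if j == i then 1 - z ord0 j else z ord0 j).

Lemma layer_swap_shift i j z s : layer_swap i (z + s *: unit_vec j) =
  layer_swap i z + (if j == i then - s else s) *: unit_vec j.
Proof.
apply/rowP => k; rewrite !mxE eqxx /=.
case: (eqVneq j i) => [->|ji]; case: (eqVneq k i) => [->|ki] //=; rewrite ?eqxx.
- rewrite !mulr1; ring.
- by rewrite !mulr0.
- by rewrite (eq_sym i) (negbTE ji) !mulr0 !addr0.
Qed.

Lemma layer_swap_shiftD i j z : layer_swap i (z + unit_vec j) =
  layer_swap i z + (if j == i then - 1 else 1) *: unit_vec j.
Proof. by rewrite -[X in z + X]scale1r layer_swap_shift. Qed.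

Lemma layer_swap_shiftB i j z : layer_swap i (z - unit_vec j) =
  layer_swap i z - (if j == i then - 1 else 1) *: unit_vec j.
Proof. by rewrite -scaleN1r layer_swap_shift; case: eqP; rewrite ?opprK ?scaleN1r ?opprK ?scale1r. Qed.

Lemma dlap_layer_swap i w z : dlap (w \o layer_swap i) z = dlap w (layer_swap i z).
Proof.
apply: eq_bigr => j _; rewrite /diff2 /= layer_swap_shiftD layer_swap_shiftB.
case: eqP => _; rewrite ?scaleN1r ?scale1r ?opprK //.
by rewrite [X in X - _]addrC.
Qed.

Lemma layer_swapK i z : layer_swap i (layer_swap i z) = z.
Proof. by apply/rowP => j; rewrite !mxE; case: eqP => // _; rewrite subKr. Qed.


Definition sumsq_but i z : R := \sum_(j < d | j != i) (z ord0 j)%:~R ^+ 2.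

Lemma sumsq_but_shift i z (s : int) : sumsq_but i (z + s *: unit_vec i) = sumsq_but i z.
Proof.
apply: eq_bigr => j ji; rewrite !mxE (negbTE ji) andbF /=; congr (_%:~R ^+ 2); ring.
Qed.

Lemma sumsq_but_shift_neq i j z (s : int) : j != i ->
  sumsq_but i (z + s *: unit_vec j) =
  sumsq_but i z + 2 * s%:~R * (z ord0 j)%:~R + s%:~R ^+ 2.
Proof.
move=> ji; rewrite /sumsq_but !(bigD1 j ji) /= !mxE !eqxx /= mulr1 intrD.
rewrite (eq_bigr (fun k => (z ord0 k)%:~R ^+ 2)); first by ring.
by move=> k /andP[_ kj]; rewrite !mxE (negbTE kj) andbF /= mulr0 addr0.
Qed.

(* Strictly superharmonic, at least N^2 on the faces of the half cube
   1 <= z_i, |z_j| <= N away from the hyperplane z_i = 1/2, and only d N next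
   to that hyperplane. *)
Definition barrier i (N : R) z : R :=
  sumsq_but i z
  + 2 * d%:R * N * ((z ord0 i)%:~R - 2^-1)
  - d%:R * ((z ord0 i)%:~R * ((z ord0 i)%:~R - 1)).

(** Each of the d - 1 directions j != i contributes 2 and direction i contributes -2 d; the factor d
    in [barrier] is there to make the total negative. *)
Lemma dlap_barrier i N z : dlap (barrier i N) z = - 2.
Proof.
have E j : diff2 j (barrier i N) z = if j == i then - 2 * d%:R else 2.
  rewrite /diff2 /barrier -(scaleN1r (unit_vec j)) -[X in sumsq_but i (z + X) + _]scale1r.
  case: eqVneq => [->|ji].
    rewrite !sumsq_but_shift !mxE !eqxx /= !mulr1 !intrD !intrN.
    by rewrite mulr1z; ring.
  rewrite !sumsq_but_shift_neq // !mxE !(eq_sym i) (negbTE ji) /= !mulr0 !addr0.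
  by rewrite !intrN mulr1z; ring.
rewrite /dlap (bigD1 i) //= E eqxx.
rewrite (eq_bigr (fun=> 2)); last by move=> j ji; rewrite E (negbTE ji).
rewrite sumr_const cardC1 card_ord.
have: (0 < d)%N by case: (i) => m; case: d.
by case: (d) => // m _ /=; rewrite -natr1 -[in 2 *+ m]mulr_natr; ring.
Qed.

(** At z_i = 1 the point [z - unit_vec i] is the mirror image of z under [layer_swap i]; the jump of
    the barrier across the fold is needed to compare the two points in [grad_est]. *)
Lemma barrier_layer_swap i N z : z ord0 i = 1 ->
  barrier i N z - barrier i N (z - unit_vec i) = 2 * d%:R * N.
Proof.
move=> zi; rewrite /barrier -(scaleN1r (unit_vec i)) sumsq_but_shift !mxE !eqxx zi /= mulr1 subrr.
by rewrite mulr0z mulr1z; ring.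
Qed.

(** Maximum principle on the half cube for the odd function g minus K times the barrier. K is scaled
    so that K N^2 = 2 M dominates g on the faces, and the bound is the value K d N of the scaled
    barrier at [unit_vec i]. *)
Lemma grad_est w c i (N : nat) (M : R) : (0 < N)%N -> 0 <= M ->
  (forall z, (forall j, `|z ord0 j - c ord0 j| <= N%:Z) -> `|w z| <= M) ->
  (forall z, (forall j, `|z ord0 j - c ord0 j| <= N%:Z) -> dlap w z = 0) ->
  w (c + unit_vec i) - w c <= 2 * d%:R * M / N%:R.
Proof.
move=> N0 M0 wM w0.
have d0 : (0 < d)%N by case: (i) => m; case: d.
have N1 : 1 <= N%:R :> R by rewrite ler1n.
have d1 : 1 <= d%:R :> R by rewrite ler1n.
pose w' z := w (z + c).
pose g z := w' z - w' (layer_swap i z).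
pose K := 2 * M / N%:R ^+ 2.
have K0 : 0 <= K by rewrite /K divr_ge0 // ?mulr_ge0 // exprn_ge0.
pose f z := g z - K * barrier i N%:R z.
pose B z := (1 <= z ord0 i) /\ forall j, `|z ord0 j| <= N%:Z.
have gN z : g (layer_swap i z) = - g z by rewrite /g layer_swapK opprB.
have Brefl z : B z -> forall j, `|layer_swap i z ord0 j| <= N%:Z.
  by move=> [z1 zN] j; have := zN j; rewrite mxE; case: eqP => [->|//]; lia.
have Bz0 : B (unit_vec i).
  by split => [|j]; rewrite unit_vecE ?eqxx //; case: eqP => _ /=; lia.
have gE : g (unit_vec i) = w (c + unit_vec i) - w c.
  rewrite /g /w' (addrC (unit_vec i)); congr (_ - w _).
  apply/rowP => j; rewrite !mxE eqxx /=; case: eqVneq => //= _; rewrite ?subrr add0r //.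
have w'M z : (forall j, `|z ord0 j| <= N%:Z) -> `|w' z| <= M.
  by move=> zN; apply: wM => j; rewrite mxE addrK.
have w'0 z : (forall j, `|z ord0 j| <= N%:Z) -> dlap w' z = 0.
  by move=> zN; rewrite dlap_shift; apply: w0 => j; rewrite mxE addrK.
have gM z : B z -> g z <= 2 * M.
  move=> Bz; have := w'M _ (Brefl _ Bz); have := w'M _ Bz.2.
  by rewrite !ler_norml /g => /andP[_ ?] /andP[? _]; lra.
have g0 z : B z -> dlap g z = 0.
  move=> Bz; have -> : g = w' \+ (\- (w' \o layer_swap i)) by [].
  by rewrite dlapD dlapN dlap_layer_swap !w'0 ?subrr //; [exact: Brefl|case: Bz].
have barr0 : barrier i N%:R (unit_vec i) = d%:R * N%:R.
  rewrite /barrier /sumsq_but big1 => [|j ji]; first by rewrite unit_vecE eqxx /=; lra.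
  by rewrite unit_vecE (negbTE ji) /= expr2 mulr0.
suff fle : f (unit_vec i) <= 0.
  move: fle; rewrite /f gE barr0 subr_le0 => /le_trans; apply.
  rewrite /K le_eqVlt; apply/orP; left; apply/eqP; field.
  by rewrite pnatr_eq0 -lt0n.
have [z Bz zmax] : exists2 z, B z & forall z', B z' -> f z' <= f z.
  apply: (@box_argmax _ 0 N); first by exists (unit_vec i).
  by move=> z [_ zN] j; rewrite mxE subr0.
apply: (le_trans (zmax _ Bz0)); rewrite leNgt; apply/negP => fz0.
have barr_ge0 y : B y -> 0 <= barrier i N%:R y - sumsq_but i y.
  move=> [y1 yN]; rewrite /barrier.
  have y1' : 1 <= (y ord0 i)%:~R :> R by rewrite ler1z.
  have y2' : (y ord0 i)%:~R <= N%:R :> R.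
    by rewrite -[N%:R]/(N%:Z%:~R) ler_int; have := yN i; lia.
  set t := (y ord0 i)%:~R in y1' y2' *.
  have : 0 <= d%:R * (t * (N%:R - t) + (t - 1) * N%:R + t) by apply: mulr_ge0; nra.
  by nra.
have sq0 y : 0 <= sumsq_but i y by apply: sumr_ge0 => j _; exact: sqr_ge0.
have bd y : B y -> (N%:Z <= y ord0 i \/ exists2 j, j != i & N%:Z <= `|y ord0 j|) -> f y <= 0.
  move=> By bdy; rewrite /f subr_le0; apply: (le_trans (gM _ By)).
  suff bN : N%:R ^+ 2 <= barrier i N%:R y.
    rewrite -(@ler_pM2l _ (N%:R ^+ 2)^-1) in bN; last by rewrite invr_gt0 exprn_gt0 //; lra.
    have N2 : N%:R ^+ 2 != 0 :> R by rewrite expf_neq0 // pnatr_eq0 -lt0n.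
    rewrite mulVf // in bN.
    by rewrite /K -mulrA -[leLHS]mulr1 ler_wpM2l // mulr_ge0.
  case: bdy => [yi|[j ji yj]].
    have -> : barrier i N%:R y = sumsq_but i y + (barrier i N%:R y - sumsq_but i y).
      by rewrite addrC subrK.
    rewrite -[leLHS]add0r lerD // /barrier.
    have yiE : y ord0 i = N%:Z by have := By.2 i; lia.
    rewrite yiE -[_%:~R]/(N%:R : R).
    have : N%:R ^+ 2 <= d%:R * N%:R ^+ 2 :> R by rewrite ler_peMl // exprn_ge0.
    by nra.
  have : (y ord0 j)%:~R ^+ 2 <= sumsq_but i y.
    by rewrite /sumsq_but (bigD1 j ji) /= lerDl; apply: sumr_ge0 => k _; exact: sqr_ge0.
  have : N%:R ^+ 2 <= (y ord0 j)%:~R ^+ 2 :> R.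
    rewrite -[leRHS]real_normK ?num_real // ler_pXn2r ?nnegrE //.
    by rewrite -intr_norm -[N%:R]/(N%:Z%:~R) ler_int.
  have := barr_ge0 _ By; lra.
have inner : z ord0 i < N%:Z /\ forall j, j != i -> `|z ord0 j| < N%:Z.
  split; [rewrite ltNge; apply/negP => h|move=> j ji; rewrite ltNge; apply/negP => h].
    by have := bd _ Bz (or_introl h); lra.
  by have := bd _ Bz (or_intror (ex_intro2 (fun j => is_true (j != i)) _ j ji h)); lra.
case: (Bz) => z1 zN.
have fE : f = g \+ (\- (K \*o barrier i N%:R)) by [].
have dlapK : dlap (K \*o barrier i N%:R) z = K * dlap (barrier i N%:R) z.
  by rewrite /dlap mulr_sumr; apply: eq_bigr => j _; rewrite /diff2 /=; ring.
have Kgt : 0 < K.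
  rewrite lt0r K0 andbT; apply/eqP => K00.
  have M00 : M = 0.
    have : N%:R ^+ 2 != 0 :> R by rewrite expf_neq0 // pnatr_eq0 -lt0n.
    move=> N2; move: K00; rewrite /K => /(congr1 (fun x => x * N%:R ^+ 2 / 2)).
    by rewrite mulfVK // mul0r mul0r mulrC mulKf.
  by have := gM _ Bz; move: fz0; rewrite /f K00 M00; lra.
have : 0 < dlap f z.
  by rewrite fE dlapD dlapN dlapK dlap_barrier (g0 _ Bz); lra.
apply/negP; rewrite -leNgt.
apply: dlap_max_neg => j; split.
  apply: zmax; split => [|k]; rewrite mxE unit_vecE.
    by case: eqP => _ /=; lia.
  case: eqP => [->|_] /=; last by have := zN k; lia.
  case: (eqVneq j i) => [->|ji]; first by have := inner.1; lia.
  by have := inner.2 j ji; lia.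
(* The only neighbour of z that can leave B is [z - unit_vec i] when z_i = 1. There g changes sign
   and the barrier drops by 2 d N, so f does not exceed f z as soon as K d N <= g z, which follows
   from 0 < f z. *)
have [zi1|zi1] : (j = i /\ z ord0 i = 1) \/ (j != i \/ z ord0 i != 1).
    case: (eqVneq j i) => ji; case: (eqVneq (z ord0 i) 1) => zi; auto.
  case: zi1 => -> zi.
  have rE : z - unit_vec i = layer_swap i z.
    apply/rowP => k; rewrite !mxE eqxx /=; case: eqVneq => [->|_]; last by rewrite subr0.
    by rewrite zi.
  have := barrier_layer_swap N%:R zi; rewrite /f.
  rewrite {2}rE gN => bE.
  have bz : d%:R * N%:R <= barrier i N%:R z.
    by rewrite /barrier zi; have := sq0 z; nra.
  have := ler_wpM2l K0 bz; move/(congr1 ( *%R K)): bE; move: fz0; rewrite /f; nra.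
apply: zmax; split => [|k]; rewrite !mxE eqxx /=.
  case: (eqVneq i j) => [ij|_] /=; last by lia.
  by case: zi1 => [|/eqP]; [rewrite -ij eqxx | lia].
case: eqP => [->|_] /=; last by have := zN k; lia.
have := zN j; case: (eqVneq j i) zi1 => [->|ji] zi1; first by case: zi1 => // /eqP; lia.
by have := inner.2 j ji; lia.
Qed.

End Lattice.

(** * Iterated differences, and discrete first and second order expansions *)

Section Lattice2.
Context {R : realType} {d : nat}.
Implicit Types (w g : 'rV[int]_d -> R) (z c : 'rV[int]_d) (i j : 'I_d).

Definition hbox w c (N : nat) (M : R) :=
  forall z, (forall j, `|z ord0 j - c ord0 j| <= N%:Z) ->
  `|w z| <= M /\ dlap w z = 0.

Lemma hbox_fdiff w c i (N : nat) (M : R) : (0 < N)%N -> 0 <= M ->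
  hbox w c (2 * N) M -> hbox (fdiff i w) c N (2 * d%:R * M / N%:R).
Proof.
move=> N0 M0 H z zc.
have sub y : (forall j, `|y ord0 j - z ord0 j| <= N%:Z) ->
    forall j, `|y ord0 j - c ord0 j| <= (2 * N)%N%:Z.
  by move=> yz j; have := yz j; have := zc j; lia.
split.
  rewrite ler_norml; apply/andP; split; last first.
    by apply: grad_est => // y /sub/H [].
  have -> : fdiff i w z = - ((\- w) (z + unit_vec i) - (\- w) z).
    by rewrite /fdiff /=; ring.
  rewrite lerN2; apply: grad_est => // y /sub/H [w1 w2].
    by rewrite normrN.
  by rewrite dlapN w2 oppr0.
rewrite dlap_fdiff (H z _).2 ?(H (z + unit_vec i) _).2 ?subrr // => j.
  rewrite mxE unit_vecE; have := zc j; case: eqP => _ /=; lia.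
have := zc j; lia.
Qed.

(** Three uses of [hbox_fdiff] shrink the box from 8 N through 4 N and 2 N to N; the denominators 4
    N and 2 N met on the way are weakened to N. *)
Lemma hbox_diff_bounds w c (N : nat) (M : R) : (0 < N)%N -> 0 <= M ->
  hbox w c (8 * N) M ->
  forall z, (forall j, `|z ord0 j - c ord0 j| <= N%:Z) -> forall i j k,
  [/\ `|fdiff i w z| <= 2 * d%:R * M / N%:R,
      `|fdiff j (fdiff i w) z| <= (2 * d%:R) ^+ 2 * M / N%:R ^+ 2 &
      `|fdiff k (fdiff j (fdiff i w)) z| <= (2 * d%:R) ^+ 3 * M / N%:R ^+ 3].
Proof.
move=> N0 M0 H z zc i j k.
have D0 : 0 <= 2 * d%:R :> R by rewrite mulr_ge0.
have Nr0 : 0 < N%:R :> R by rewrite ltr0n.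
have scale (a : R) (m : nat) : (0 < m)%N -> 0 <= a -> a / (m * N)%:R <= a / N%:R.
  move=> m0 a0; rewrite ler_wpM2l // lef_pV2 ?posrE ?ltr0n ?muln_gt0 ?m0 //.
  by rewrite ler_nat leq_pmull.
have H1 : hbox (fdiff i w) c (4 * N) (2 * d%:R * M / N%:R).
  have := @hbox_fdiff w c i (4 * N) M; rewrite muln_gt0 N0 mulnA => /(_ isT M0 H).
  move=> h y /h [h1 h2]; split=> //; apply: (le_trans h1); apply: scale => //.
  by rewrite mulr_ge0.
have H2 : hbox (fdiff j (fdiff i w)) c (2 * N) ((2 * d%:R) ^+ 2 * M / N%:R ^+ 2).
  have H1' : hbox (fdiff i w) c (2 * (2 * N)) (2 * d%:R * M / N%:R) by rewrite mulnA.
  have M1 : 0 <= 2 * d%:R * M / N%:R by rewrite divr_ge0 ?mulr_ge0.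
  have N2 : (0 < 2 * N)%N by rewrite muln_gt0.
  have h := @hbox_fdiff _ c j (2 * N) _ N2 M1 H1'.
  move=> y /h [h1 h2]; split=> //.
  apply: (le_trans h1); apply: (@le_trans _ _ (2 * d%:R * (2 * d%:R * M / N%:R) / N%:R)).
    by apply: scale => //; rewrite !mulr_ge0 // invr_ge0 ltW.
  by rewrite le_eqVlt; apply/orP; left; apply/eqP; field; rewrite gt_eqF.
have H3 := @hbox_fdiff _ c k N _ N0 _ H2.
have Nge : N%:Z <= (2 * N)%N%:Z /\ N%:Z <= (4 * N)%N%:Z by lia.
split.
- by apply: (H1 z _).1 => m; apply: (le_trans (zc m)); case: Nge.
- by apply: (H2 z _).1 => m; apply: (le_trans (zc m)); case: Nge.
- have := (H3 _ z zc).1; rewrite divr_ge0 ?mulr_ge0 ?exprn_ge0 // => /(_ isT) h3.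
  apply: (le_trans h3).
  by rewrite le_eqVlt; apply/orP; left; apply/eqP; field; rewrite gt_eqF.
Qed.

Lemma absz_step (a b s : int) : (s = 1 /\ a < b) \/ (s = -1 /\ b < a) ->
  absz (a - b)%R = (absz (a + s - b)%R).+1.
Proof. by case=> -[-> ?]; lia. Qed.

Lemma between_step (a b s x : int) : (s = 1 /\ a < b) \/ (s = -1 /\ b < a) ->
  (a + s <= x <= b) || (b <= x <= a + s) -> (a <= x <= b) || (b <= x <= a).
Proof. by case=> -[-> ?]; lia. Qed.

Lemma between_refl (a b : int) : (a <= a <= b) || (b <= a <= a).
Proof. lia. Qed.

(** Induction on the l^1 distance: each step moves one coordinate towards z', so the path stays in
    the box spanned by the two ends, the only place where differences are controlled. *)
Lemma path_lip w (C : R) z' z :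
  (forall y : 'rV[int]_d, (forall j, (z ord0 j <= y ord0 j <= z' ord0 j) ||
                        (z' ord0 j <= y ord0 j <= z ord0 j)) ->
     forall j, `|fdiff j w y| <= C) ->
  `|w z - w z'| <= C * (\sum_j absz (z ord0 j - z' ord0 j)%R)%N%:R.
Proof.
move En : (\sum_j absz (z ord0 j - z' ord0 j)%R)%N => n.
elim: n z En => [|n IH] z En H.
  suff -> : z = z' by rewrite subrr normr0 mulr0.
  apply/rowP => j; move/eqP: En; rewrite sum_nat_eq0 => /forallP /(_ j) /=.
  by rewrite absz_eq0 subr_eq0 => /eqP.
have [j zj] : exists j, z ord0 j != z' ord0 j.
  apply/existsP; rewrite -[X in is_true X]negbK; apply/negP => /existsPn h.
  move: En; rewrite big1 // => i _; have := h i; rewrite negbK => /eqP ->.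
  by rewrite subrr.
have step y (s : int) : (s = 1 /\ z ord0 j < z' ord0 j) \/ (s = -1 /\ z' ord0 j < z ord0 j) ->
    y = z + s *: unit_vec j ->
   [/\ (\sum_k absz (y ord0 k - z' ord0 k)%R)%N = n,
     (forall x : 'rV[int]_d, (forall j, (y ord0 j <= x ord0 j <= z' ord0 j) ||
                        (z' ord0 j <= x ord0 j <= y ord0 j)) ->
      (forall j, (z ord0 j <= x ord0 j <= z' ord0 j) ||
                        (z' ord0 j <= x ord0 j <= z ord0 j))) &
     (forall j, (z ord0 j <= y ord0 j <= z' ord0 j) ||
                        (z' ord0 j <= y ord0 j <= z ord0 j)) ].
  move=> hs yE.
  have yk k : y ord0 k = z ord0 k + s * (k == j)%:R by rewrite yE mxE mxE unit_vecE.
  split.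
  - move: En; rewrite (bigD1 j isT) /= => En; rewrite (bigD1 j isT) /=; apply: succn_inj; rewrite -En -addSn.
    rewrite (absz_step hs) yk eqxx mulr1; congr (_ + _)%N.
    by apply: eq_bigr => k kj; rewrite yk (negbTE kj) mulr0 addr0.
  - move=> x hx k; have := hx k; rewrite yk.
    case: (eqVneq k j) => [->|_]; last by rewrite mulr0 addr0.
    by rewrite mulr1; exact: between_step.
  - move=> k; rewrite yk; case: (eqVneq k j) => [->|_]; last first.
      by rewrite mulr0 addr0; exact: between_refl.
    by rewrite mulr1; apply: (between_step hs); exact: between_refl.
have zz k : (z ord0 k <= z ord0 k <= z' ord0 k) || (z' ord0 k <= z ord0 k <= z ord0 k).
  exact: between_refl.
rewrite -natr1 mulrDr mulr1 [leRHS]addrC.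
case: (ltgtP (z ord0 j) (z' ord0 j)) => [lt|gt|eq]; last by rewrite eq eqxx in zj.
  have [] := step _ 1 (or_introl (conj erefl lt)) erefl.
  rewrite scale1r => sn sx _.
  apply: (le_trans (ler_distD (w (z + unit_vec j)) (w z) (w z'))); apply: lerD.
    by rewrite distrC; apply: H.
  by apply: IH => // y /sx; exact: H.
have [] := step _ (- 1) (or_intror (conj erefl gt)) erefl.
rewrite scaleN1r => sn sx yz.
apply: (le_trans (ler_distD (w (z - unit_vec j)) (w z) (w z'))); apply: lerD.
  by have := H _ yz j; rewrite /fdiff subrK.
by apply: IH => // y /sx; exact: H.
Qed.

(** Discrete Taylor formula. With forward differences, n steps to the right leave a remainder C n (n
    - 1) / 2 and n steps to the left C n (n + 1) / 2; the bound C m^2 covers both. *)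
Lemma second_order w (C : R) z j (m : int) : 
  (forall k : int, `|k| <= `|m| -> `|fdiff j (fdiff j w) (z + k *: unit_vec j)| <= C) ->
  `|w (z + m *: unit_vec j) - w z - m%:~R * fdiff j w z| <= C * m%:~R ^+ 2.
Proof.
move=> H.
have C0 : 0 <= C by apply: le_trans (H 0 _); rewrite ?normr0.
have fE (g : 'rV[int]_d -> R) y : fdiff j g y = g (y + unit_vec j) - g y by [].
have pos (n : nat) : (n%:Z <= `|m|) ->
    `|w (z + n%:Z *: unit_vec j) - w z - n%:R * fdiff j w z| <= C * n%:R ^+ 2 /\
    `|fdiff j w (z + n%:Z *: unit_vec j) - fdiff j w z| <= C * n%:R.
  elim: n => [|n IH] nm.
    by rewrite scale0r addr0 mul0r !subrr !normr0 mulr0 expr2 !mulr0.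
  have [|IH1 IH2] := IH; first by lia.
  have E : z + n.+1%:Z *: unit_vec j = z + n%:Z *: unit_vec j + unit_vec j.
    by rewrite -addrA -[X in _ + (_ + X)]scale1r -scalerDl; congr (_ + _ *: _); lia.
  have h : `|fdiff j (fdiff j w) (z + n%:Z *: unit_vec j)| <= C by apply: H; lia.
  split; last first.
    rewrite E -natr1 mulrDr mulr1 [X in `|X|]addrC.
    have -> : - fdiff j w z + fdiff j w (z + n%:Z *: unit_vec j + unit_vec j) =
      fdiff j (fdiff j w) (z + n%:Z *: unit_vec j) +
      (fdiff j w (z + n%:Z *: unit_vec j) - fdiff j w z).
      by rewrite (fE (fdiff j w)); ring.
    by apply: (le_trans (ler_normD _ _)); rewrite addrC lerD.
  have -> : w (z + n.+1%:Z *: unit_vec j) - w z - n.+1%:R * fdiff j w z =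
     (w (z + n%:Z *: unit_vec j) - w z - n%:R * fdiff j w z) +
     (fdiff j w (z + n%:Z *: unit_vec j) - fdiff j w z).
    by rewrite E (fE w (_ + _)) -natr1; ring.
  apply: (le_trans (ler_normD _ _)).
  apply: (le_trans (lerD IH1 IH2)); rewrite -natr1.
  have : 0 <= C * n%:R by rewrite mulr_ge0.
  nra.
have neg (n : nat) : (n%:Z <= `|m|) ->
    `|w (z - n%:Z *: unit_vec j) - w z + n%:R * fdiff j w z| <= C * n%:R ^+ 2 /\
    `|fdiff j w (z - n%:Z *: unit_vec j) - fdiff j w z| <= C * n%:R.
  elim: n => [|n IH] nm.
    by rewrite scale0r subr0 mul0r addr0 !subrr !normr0 mulr0 expr2 !mulr0.
  have [|IH1 IH2] := IH; first by lia.
  have E : z - n%:Z *: unit_vec j = z - n.+1%:Z *: unit_vec j + unit_vec j.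
    apply/rowP => k; rewrite !mxE; case: (_ && _) => /=; lia.
  have h : `|fdiff j (fdiff j w) (z - n.+1%:Z *: unit_vec j)| <= C.
    by rewrite -scaleNr; apply: H; lia.
  have IH3 : `|fdiff j w (z - n.+1%:Z *: unit_vec j) - fdiff j w z| <= C * n.+1%:R.
    rewrite -natr1 mulrDr mulr1.
    have -> : fdiff j w (z - n.+1%:Z *: unit_vec j) - fdiff j w z =
      (fdiff j w (z - n%:Z *: unit_vec j) - fdiff j w z) -
      fdiff j (fdiff j w) (z - n.+1%:Z *: unit_vec j).
      by rewrite E (fE (fdiff j w)); ring.
    by apply: (le_trans (ler_normB _ _)); rewrite lerD.
  split=> //.
  have -> : w (z - n.+1%:Z *: unit_vec j) - w z + n.+1%:R * fdiff j w z =
     (w (z - n%:Z *: unit_vec j) - w z + n%:R * fdiff j w z) -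
     (fdiff j w (z - n.+1%:Z *: unit_vec j) - fdiff j w z).
    by rewrite E (fE w (_ - _)) -natr1; ring.
  apply: (le_trans (ler_normB _ _)).
  apply: (le_trans (lerD IH1 IH3)); rewrite -natr1.
  have : 0 <= C * n%:R by rewrite mulr_ge0.
  nra.
have [m0|m0] := leP 0 m.
  have := pos (absz m); rewrite gez0_abs // => /(_ (ler_norm _)) [].
  have -> : m%:~R = (absz m)%:R :> R by rewrite -{1}[m]gez0_abs.
  by [].
have [n mE] : exists n : nat, m = - n%:Z.
  by exists (absz m); rewrite ltz0_abs // opprK.
have [|h _] := neg n; first by rewrite mE normrN.
by rewrite mE scaleNr intrN mulNr opprK sqrrN; exact: h.
Qed.

End Lattice2.

(** * The discrete thin obstacle problem *)

Section LatticeObstacle.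
Context {R : realType} {d : nat}.
Variable l : 'I_d.
Implicit Types (w g phi : 'rV[int]_d -> R) (z c : 'rV[int]_d) (i j : 'I_d).

Definition supersol phi w :=
  [/\ forall z, 0 <= w z, forall z, dlap w z <= 0 &
      forall z, z ord0 l = 0 -> phi z <= w z].

Definition least_supersol phi z : R := inf [set w z | w in supersol phi].

Lemma dlap_cst (M : R) z : dlap (fun=> M) z = 0.
Proof. by rewrite /dlap big1 // => i _; rewrite /diff2; ring. Qed.

Lemma dlap_mono w g z : w z = g z ->
  (forall y, w y <= g y) -> dlap w z <= dlap g z.
Proof.
move=> E H; apply: ler_sum => i _; rewrite /diff2 E.
have := H (z + unit_vec i); have := H (z - unit_vec i); lra.
Qed.

Lemma dlapE w z : dlap w z =
  \sum_(i < d) (w (z + unit_vec i) + w (z - unit_vec i)) - 2 * d%:R * w z.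
Proof.
rewrite /dlap /diff2 sumrB sumr_const card_ord -[_ *+ d]mulr_natr; ring.
Qed.

Variable phi : 'rV[int]_d -> R.
Variable M : R.
Hypothesis M0 : 0 <= M.
Hypothesis phiM : forall z, z ord0 l = 0 -> phi z <= M.
Local Notation v := (least_supersol phi).

Lemma supersol_cst : supersol phi (fun=> M).
Proof. by split => // z; rewrite dlap_cst. Qed.

Lemma least_supersol_le w z : supersol phi w -> v z <= w z.
Proof.
move=> H; apply: ge_inf; last by exists w.
by exists 0 => _ [g [g0 _ _] <-].
Qed.

Lemma least_supersol_ge (x : R) z :
  (forall w, supersol phi w -> x <= w z) -> x <= v z.
Proof.
move=> H; apply: lb_le_inf; first by exists M; exists (fun=> M) => //; exact: supersol_cst.
by move=> _ [w hw <-]; exact: H.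
Qed.

(** Superharmonicity says that the value at z is at least the average over the neighbours; the
    average is monotone, so the condition passes to the infimum. *)
Lemma least_supersolP : supersol phi v.
Proof.
split=> z.
- by apply: least_supersol_ge => w [].
- have d0 : 0 < 2 * d%:R :> R.
    by rewrite mulr_gt0 // ltr0n; case: (l) => m; case: d.
  rewrite dlapE subr_le0 mulrC -ler_pdivrMr //; apply: least_supersol_ge => w hw.
  rewrite ler_pdivrMr // mulrC; have [_ /(_ z) + _] := hw; rewrite dlapE subr_le0.
  by apply: le_trans; apply: ler_sum => i _; apply: lerD; exact: least_supersol_le.
- by move=> zl; apply: least_supersol_ge => w [_ _]; exact.
Qed.

Lemma least_supersol_leM z : v z <= M.
Proof. exact: (least_supersol_le _ supersol_cst). Qed.

(** Were v strictly superharmonic at z, its value there could be lowered to b, the average over the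
    neighbours or the obstacle if that is larger. The result is still a supersolution: at z by the
    choice of b, elsewhere because averages only decrease. *)
Lemma least_supersol_harm z : (z ord0 l != 0) \/ phi z < v z -> dlap v z = 0.
Proof.
move=> H; have [v0 vs vphi] := least_supersolP.
apply/eqP; rewrite eq_le vs /= leNgt; apply/negP => neg.
have d0 : 0 < 2 * d%:R :> R.
  by rewrite mulr_gt0 // ltr0n; case: (l) => m; case: d.
pose a := (\sum_(i < d) (v (z + unit_vec i) + v (z - unit_vec i))) / (2 * d%:R).
have av : a < v z.
  by rewrite /a ltr_pdivrMr // mulrC -subr_lt0 -dlapE.
have a0 : 0 <= a by rewrite divr_ge0 ?sumr_ge0 ?ltW // => i _; rewrite addr_ge0.
pose b := if z ord0 l == 0 then Order.max a (phi z) else a.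
have bv : b < v z.
  by rewrite /b; case: eqP H => // _ [//|H]; rewrite gt_max av.
have ab : a <= b by rewrite /b; case: eqP => // _; rewrite le_max lexx.
pose w y := if y == z then b else v y.
suff : supersol phi w by move=> /(least_supersol_le z); rewrite /w eqxx; lra.
have wv y : w y <= v y by rewrite /w; case: eqP => // ->; exact: ltW.
split=> y.
- by rewrite /w; case: eqP => // _; exact: le_trans ab.
- case: (eqVneq y z) => [->|yz]; last first.
    by apply: le_trans (vs y); apply: dlap_mono => //; rewrite /w (negbTE yz).
  rewrite dlapE (_ : w z = b); last by rewrite /w eqxx.
  have : 2 * d%:R * a = \sum_(i < d) (v (z + unit_vec i) + v (z - unit_vec i)).
    by rewrite /a mulrC mulfVK // gt_eqF.
  have : \sum_(i < d) (w (z + unit_vec i) + w (z - unit_vec i)) <=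
         \sum_(i < d) (v (z + unit_vec i) + v (z - unit_vec i)).
    by apply: ler_sum => i _; exact: lerD.
  have : 2 * d%:R * a <= 2 * d%:R * b by rewrite ler_wpM2l // ltW.
  lra.
- move=> yl; rewrite /w; case: eqP => [yz|_]; last exact: vphi.
  by rewrite /b -yz yl eqxx le_max lexx orbT.
Qed.

Definition vert_flip z : 'rV[int]_d := \row_j (if j == l then - z ord0 j else z ord0 j).

Lemma vert_flipD i z (s : int) : vert_flip (z + s *: unit_vec i) =
  vert_flip z + (if i == l then - s else s) *: unit_vec i.
Proof.
apply/rowP => k; rewrite !mxE eqxx /=.
case: (eqVneq i l) => [->|il]; case: (eqVneq k l) => [->|kl] //=; rewrite ?eqxx.
- rewrite !mulr1; ring.
- by rewrite !mulr0.
- by rewrite (eq_sym l) (negbTE il) !mulr0 !addr0.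
Qed.

Lemma dlap_vert_flip w z : dlap (w \o vert_flip) z = dlap w (vert_flip z).
Proof.
apply: eq_bigr => j _; rewrite /diff2 /=.
rewrite -(scaleN1r (unit_vec j)) -[X in vert_flip (z + X)]scale1r !vert_flipD.
case: eqP => _; rewrite ?opprK ?scaleN1r ?scale1r //.
by rewrite [X in X - _]addrC.
Qed.

Lemma vert_flipK z : vert_flip (vert_flip z) = z.
Proof. by apply/rowP => j; rewrite !mxE; case: eqP => // _; rewrite opprK. Qed.

Lemma vert_flip_thin z : z ord0 l = 0 -> vert_flip z = z.
Proof. by move=> zl; apply/rowP => j; rewrite !mxE; case: eqP => // ->; rewrite zl oppr0. Qed.

Lemma least_supersol_vert_flip z : v (vert_flip z) = v z.
Proof.
suff H y : v y <= v (vert_flip y) by apply/eqP; rewrite eq_le H andbT -{2}[z]vert_flipK H.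
have [v0 vs vphi] := least_supersolP.
apply: (@least_supersol_le (v \o vert_flip)); split => x; rewrite ?dlap_vert_flip //=.
by move=> xl; rewrite vert_flip_thin //; exact: vphi.
Qed.

Lemma thin_shift z i (s : int) : i != l -> z ord0 l = 0 ->
  (z + s *: unit_vec i) ord0 l = 0.
Proof. by move=> il zl; rewrite !mxE zl (eq_sym l) (negbTE il) andbF mulr0 addr0. Qed.

Section Regularity.
Variables C1 C2 : R.
Hypothesis C10 : 0 <= C1.
Hypothesis C20 : 0 <= C2.
Hypothesis phi_lip : forall z i (s : int), z ord0 l = 0 -> 0 < phi z ->
  (s = 1 \/ s = -1) -> phi z - C1 <= phi (z + s *: unit_vec i).
Hypothesis phi_diff2 : forall z i, z ord0 l = 0 -> 0 < phi z ->
  - C2 <= diff2 i phi z.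

(** A tangential translate of v raised by C1 is again a supersolution. Where phi <= 0 its
    nonnegativity already suffices, which is why [phi_lip] is assumed only where phi is positive. *)
Lemma least_supersol_shift i (s : int) z : i != l -> (s = 1 \/ s = -1) ->
  v z <= v (z + s *: unit_vec i) + C1.
Proof.
move=> il hs; have [v0 vs vphi] := least_supersolP.
apply: (@least_supersol_le (fun z => v (z + s *: unit_vec i) + C1)); split => y.
- by rewrite addr_ge0.
- rewrite -[X in dlap X]/((fun z => v (z + s *: unit_vec i)) \+ (fun=> C1)).
  by rewrite dlapD dlap_cst addr0 dlap_shift.
- move=> yl; have [p0|p0] := leP (phi y) 0.
    by apply: (le_trans p0); rewrite addr_ge0.
  rewrite -lerBlDr; apply: le_trans (vphi _ (thin_shift _ il yl)).
  exact: phi_lip.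
Qed.

Lemma least_supersol_lip i z : i != l -> `|fdiff i v z| <= C1.
Proof.
move=> il; rewrite /fdiff ler_norml.
have := @least_supersol_shift i 1 z il (or_introl erefl).
have := @least_supersol_shift i (-1) (z + unit_vec i) il (or_intror erefl).
by rewrite scale1r scaleN1r addrK => h1 h2; apply/andP; split; lra.
Qed.

(** The mean of the two translates of v, raised by C2 / 2, is a supersolution and hence lies above
    v. *)
Lemma least_supersol_semiconvex i z : i != l -> - C2 <= diff2 i v z.
Proof.
move=> il; have [v0 vs vphi] := least_supersolP.
pose w y := 2^-1 * (v (y + unit_vec i) + v (y + - unit_vec i)) + C2 / 2.
suff /(least_supersol_le z) : supersol phi w by rewrite /w /diff2; lra.
split => y.
- by rewrite /w addr_ge0 ?divr_ge0 // mulr_ge0 // addr_ge0.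
- have -> : dlap w y = 2^-1 * (dlap v (y + unit_vec i) + dlap v (y + - unit_vec i)).
    rewrite -!dlap_shift -dlapD /dlap mulr_sumr; apply: eq_bigr => j _.
    by rewrite /w /diff2 /=; ring.
  rewrite pmulr_rle0 ?invr_gt0 //; have := vs (y + unit_vec i); have := vs (y + - unit_vec i); lra.
- move=> yl; have [p0|p0] := leP (phi y) 0.
    by apply: (le_trans p0); rewrite /w addr_ge0 ?divr_ge0 // mulr_ge0 // addr_ge0.
  have := phi_diff2 i yl p0; rewrite /w /diff2.
  have := vphi _ (thin_shift 1 il yl); have := vphi _ (thin_shift (-1) il yl).
  by rewrite scale1r scaleN1r; lra.
Qed.

(* Superharmonicity turns tangential semiconvexity into vertical semiconcavity,
   also across the thin space. *)
Lemma least_supersol_semiconcave z : diff2 l v z <= d%:R * C2.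
Proof.
have [v0 vs vphi] := least_supersolP.
have := vs z; rewrite /dlap (bigD1 l) //= => h.
have : \sum_(i < d | i != l) - C2 <= \sum_(i < d | i != l) diff2 i v z.
  by apply: ler_sum => i; exact: least_supersol_semiconvex.
rewrite sumr_const cardC1 card_ord mulNrn -[X in - X <= _]mulr_natl => h2.
have h3 : d.-1%:R * C2 <= d%:R * C2 by rewrite ler_wpM2r // ler_nat leq_pred.
move: h h2 h3; move: (\sum_(i < d | i != l) _) (diff2 l v z) (d.-1%:R * C2) (d%:R * C2).
move=> x1 x2 x3 x4; lra.
Qed.

(** For values in [0, M] and second differences at most a = d C2, a slope above M / m + a m would
    make v negative m steps back, and a slope below the opposite bound would make it negative m
    steps ahead. *)
Lemma least_supersol_lip_vert (m : nat) z : (0 < m)%N ->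
  `|fdiff l v z| <= M / m%:R + d%:R * C2 * m%:R.
Proof.
move=> m0; have [v0 _ _] := least_supersolP.
have mr0 : 0 < m%:R :> R by rewrite ltr0n.
pose a := d%:R * C2.
have C30 : 0 <= d%:R * C2 by rewrite mulr_ge0.
have step y : fdiff l v (y + unit_vec l) <= fdiff l v y + d%:R * C2.
  have := least_supersol_semiconcave (y + unit_vec l); rewrite /diff2 /fdiff addrK; lra.
have up y (k : nat) : v (y + k%:Z *: unit_vec l) - v y <= k%:R * fdiff l v y + d%:R * C2 * k%:R ^+ 2 /\
    fdiff l v (y + k%:Z *: unit_vec l) <= fdiff l v y + d%:R * C2 * k%:R.
  elim: k => [|k [IH1 IH2]].
    by rewrite scale0r addr0 subrr mul0r mulr0 addr0 expr2 !mulr0 addr0.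
  have E : y + k.+1%:Z *: unit_vec l = y + k%:Z *: unit_vec l + unit_vec l.
    by apply/rowP => j; rewrite !mxE; case: (_ && _) => /=; lia.
  have h1 := step (y + k%:Z *: unit_vec l).
  have h2 : v (y + k.+1%:Z *: unit_vec l) = v (y + k%:Z *: unit_vec l) + fdiff l v (y + k%:Z *: unit_vec l).
    by rewrite E /fdiff; ring.
  have kC : 0 <= d%:R * C2 * k%:R by rewrite mulr_ge0.
  rewrite h2 E -natr1; split; lra.
have low y : - M / m%:R - d%:R * C2 * m%:R <= fdiff l v y.
  have := (up y m).1; have := v0 (y + m%:Z *: unit_vec l); have := least_supersol_leM y.
  move=> a1 a2 a3.
  rewrite -(@ler_pM2r _ m%:R) // mulrBl mulfVK ?gt_eqF //.
  by lra.
have hi : fdiff l v z <= M / m%:R + d%:R * C2 * m%:R.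
  have down (k : nat) : k%:R * fdiff l v z - d%:R * C2 * k%:R ^+ 2 <= v z - v (z - k%:Z *: unit_vec l) /\
     fdiff l v z - d%:R * C2 * k%:R <= fdiff l v (z - k%:Z *: unit_vec l).
    elim: k => [|k [IH1 IH2]].
      by rewrite scale0r !subr0 subrr mul0r mulr0 subr0 expr2 !mulr0 subr0.
    have E : z - k%:Z *: unit_vec l = z - k.+1%:Z *: unit_vec l + unit_vec l.
      by apply/rowP => j; rewrite !mxE; case: (_ && _) => /=; lia.
    have h1 := step (z - k.+1%:Z *: unit_vec l).
    rewrite -E in h1.
    have h2 : v (z - k%:Z *: unit_vec l) = v (z - k.+1%:Z *: unit_vec l) + fdiff l v (z - k.+1%:Z *: unit_vec l).
      by rewrite E /fdiff; ring.
    have kC : 0 <= d%:R * C2 * k%:R by rewrite mulr_ge0.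
    rewrite -natr1; split; lra.
  have := (down m).1; have := v0 (z - m%:Z *: unit_vec l); have := least_supersol_leM z.
  move=> a1 a2 a3.
  rewrite -(@ler_pM2r _ m%:R) // [leRHS]mulrDl mulfVK ?gt_eqF //.
  by lra.
by rewrite ler_norml hi andbT; have := low z; rewrite mulNr opprD.
Qed.

End Regularity.
End LatticeObstacle.

(** * Ultralimits of lattice functions *)

Lemma ultra_image_filter (T S : Type) (U : set_system T) (f : T -> S) :
  UltraFilter U -> UltraFilter (f @ U).
Proof.
move=> FU; have PU : ProperFilter U by exact: ultra_proper.
split; first exact: fmap_proper_filter.
move=> G PG sub; apply/seteqP; split => A GA; last exact: sub.
rewrite /fmap /=; have [//|UnA] := in_ultra_setVsetC (f @^-1` A) FU.
exfalso; have GnA : G (~` A) by apply: sub.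
have FG : Filter G by exact: filter_filter.
have := @filterI _ G FG _ _ GA GnA; rewrite setICr => h; exact: (@filter_not_empty _ G PG h).
Qed.

Lemma ultra_cvg_bounded (R : realType) (T : Type) (U : set_system T) (s : T -> R) (C : R) :
  UltraFilter U -> (\forall k \near U, `|s k| <= C) -> cvg (s @ U).
Proof.
move=> FU H; have PU : ProperFilter U by exact: ultra_proper.
have := @segment_compact R (- C) C; rewrite compact_ultra => /(_ (s @ U)).
case; first exact: ultra_image_filter.
  by apply: filterS H => k; rewrite ler_norml /= in_itv.
by move=> p [_ sp]; apply/cvg_ex; exists p.
Qed.

(** A quadratic remainder is the form in which [second_order] survives the passage to the limit. *)
Lemma is_derive_quadratic (R : realType) (V : normedModType R) (f : V -> R) (x v : V) (a C r : R) :
  0 < r -> (forall s, `|s| <= r -> `|f (s *: v + x) - f x - s * a| <= C * s ^+ 2) ->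
  is_derive x v f a.
Proof.
move=> r0 H.
suff cv : (fun h => h^-1 *: (f (h *: v + x) - f x)) @ 0^' --> a.
  split; first by apply/cvg_ex; exists a; exact: cv.
  by apply: cvg_lim => //; exact: cv.
apply/cvgrPdist_le => e e0.
have C0 : 0 <= `|C| + 1 by rewrite addr_ge0.
near=> s.
have s0 : s != 0 by near: s; exact: nbhs_dnbhs_neq.
have sr : `|s| <= r.
  near: s; apply: dnbhs0_le => //.
have se : `|s| <= e / (`|C| + 1).
  near: s; apply: dnbhs0_le; rewrite divr_gt0 // ltr_wpDl //.
have -> : a - s^-1 *: (f (s *: v + x) - f x) = - (s^-1 * (f (s *: v + x) - f x - s * a)).
  by rewrite /GRing.scale /=; field.
rewrite normrN normrM normfV ler_pdivrMl ?normr_gt0 //.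
apply: (le_trans (H _ sr)); rewrite -[s ^+ 2]real_normK ?num_real // expr2 mulrCA.
rewrite ler_wpM2l //; rewrite ler_pdivlMr ?ltr_wpDl // in se.
have : C * `|s| <= `|C| * `|s| by rewrite ler_wpM2r // ler_norm.
by have := normr_ge0 s; lra.
Unshelve. all: by end_near.
Qed.

Lemma nbhs_cubeP (R : realType) (d : nat) (x : 'rV[R]_d) (A : set 'rV[R]_d) :
  nbhs x A <-> exists2 e : R, 0 < e & forall y : 'rV[R]_d, (forall i, `|y ord0 i - x ord0 i| < e) -> A y.
Proof.
split=> [/nbhs_ballP[e e0 H]|[e e0 H]]; [exists e|apply/nbhs_ballP; exists e] => // y yx.
  by apply: H; split=> // i j; rewrite (ord1 i) /ball /= distrC; exact: yx.
by apply: H => i; case: yx => _ /(_ ord0 i); rewrite /ball /= distrC.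
Qed.

Lemma dist_trans_le (R : realDomainType) (a b c e f g : R) :
  `|a - b| <= e -> `|b - c| <= f -> e + f <= g -> `|a - c| <= g.
Proof.
move=> ab bc; apply: le_trans; apply: le_trans (ler_distD b _ _) _; exact: lerD.
Qed.

Section Mesh.
Context {R : realType} {d : nat}.
Implicit Types (x y : 'rV[R]_d) (z c : 'rV[int]_d).

Definition mesh (k : nat) : R := k.+1%:R^-1.

Definition mesh_pt k z : 'rV[R]_d := \row_i (mesh k * (z ord0 i)%:~R).

(** Rounding down fixes 0, so points of the thin space are rounded to lattice points of the thin
    space. *)
Definition mesh_floor (k : nat) x : 'rV[int]_d := \row_i Num.floor (x ord0 i * k.+1%:R).

Definition cube k x (r : R) z := forall i, `|mesh_pt k z ord0 i - x ord0 i| <= r.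

Lemma mesh_gt0 k : 0 < mesh k. Proof. by rewrite invr_gt0 ltr0n. Qed.

Lemma mesh_le1 k : mesh k <= 1.
Proof. by rewrite invf_le1 ?ltr0n // ler1n. Qed.

Lemma meshV k : mesh k * k.+1%:R = 1.
Proof. by rewrite mulVf // pnatr_eq0. Qed.

Lemma mesh_floor_close k x i : `|mesh_pt k (mesh_floor k x) ord0 i - x ord0 i| <= mesh k.
Proof.
rewrite !mxE; set t := x ord0 i.
have xE : t = mesh k * (t * k.+1%:R) by rewrite mulrCA meshV mulr1.
rewrite [X in _ - X]xE -mulrBr normrM (gtr0_norm (mesh_gt0 k)) -[leRHS]mulr1.
rewrite ler_wpM2l ?(ltW (mesh_gt0 k)) //.
have /andP[h1 h2] := floor_itv (t * k.+1%:R); rewrite intrD in h2.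
by rewrite ler_norml; apply/andP; split; lra.
Qed.

Lemma mesh_ptB k z z' i : mesh k * (absz (z ord0 i - z' ord0 i)%R)%:R = `|mesh_pt k z ord0 i - mesh_pt k z' ord0 i|.
Proof.
rewrite !mxE -mulrBr normrM (gtr0_norm (mesh_gt0 k)) -intrB -intr_norm; congr (_ * _).
Qed.

Lemma mesh_ptD k z i (m : int) : mesh_pt k (z + m *: unit_vec i) = mesh_pt k z + (mesh k * m%:~R) *: delta_mx ord0 i.
Proof. by apply/rowP => j; rewrite !mxE eqxx /= intrD intrM mulrDr mulrA; case: eqP => _; rewrite ?mulr1z. Qed.

Lemma mesh_floor_shift k x i s : mesh_floor k (s *: delta_mx ord0 i + x) =
  mesh_floor k x + (Num.floor ((x ord0 i + s) * k.+1%:R) - Num.floor (x ord0 i * k.+1%:R)) *: unit_vec i.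
Proof.
apply/rowP => j; rewrite !mxE eqxx /=; case: eqP => [->|_].
  by rewrite !mulr1 addrCA subrr addr0 addrC.
by rewrite !mulr0 add0r addr0.
Qed.

Lemma mesh_floor_shift_close k x i s :
  `|mesh k * (Num.floor ((x ord0 i + s) * k.+1%:R) - Num.floor (x ord0 i * k.+1%:R))%:~R - s| <= mesh k.
Proof.
set t := x ord0 i.
have sE : s = mesh k * (s * k.+1%:R) by rewrite mulrCA meshV mulr1.
rewrite [X in _ - X]sE -mulrBr normrM (gtr0_norm (mesh_gt0 k)) -[leRHS]mulr1.
rewrite ler_wpM2l ?(ltW (mesh_gt0 k)) // intrB.
have /andP[h1 h2] := floor_itv (t * k.+1%:R); rewrite intrD in h2.
have /andP[h3 h4] := floor_itv ((t + s) * k.+1%:R); rewrite intrD in h4.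
by rewrite mulrDl in h3 h4 *; rewrite ler_norml; apply/andP; split; lra.
Qed.

Lemma mesh_cvg0 : mesh k @[k --> \oo] --> 0.
Proof. exact: cvg_harmonic. Qed.

Section Ultralimit.
Variable U : set_system nat.
Hypothesis FU : UltraFilter U.
Hypothesis HU : \oo `<=` U.
Let PU : ProperFilter U := ultra_proper.
#[local] Existing Instance PU.

Lemma mesh_near e : 0 < e -> \forall k \near U, mesh k <= e.
Proof.
move=> e0; apply: HU; have /cvgrPdist_le/(_ e e0) := mesh_cvg0.
by apply: filterS => k; rewrite sub0r normrN gtr0_norm // mesh_gt0.
Qed.

Lemma mesh_ucvg0 : mesh k @[k --> U] --> 0.
Proof. by move=> A /mesh_cvg0; exact: HU. Qed.

(* Meaningful for sequences bounded along [U]. *)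
Definition ulim (s : nat -> R) : R := lim (s @ U).

Lemma ulim_cvg s C : (\forall k \near U, `|s k| <= C) -> s @ U --> ulim s.
Proof. by move=> /(ultra_cvg_bounded FU). Qed.

Definition ulift (F : nat -> 'rV[int]_d -> R) x : R := ulim (fun k => F k (mesh_floor k x)).

Lemma mesh_floor_cube k x x0 r : mesh k <= r / 2 -> (forall i, `|x ord0 i - x0 ord0 i| <= r / 2) ->
  cube k x0 r (mesh_floor k x).
Proof.
move=> kr xr i; have := mesh_floor_close k x i; have := xr i.
rewrite !ler_norml => /andP[? ?] /andP[? ?]; apply/andP; split; lra.
Qed.

Lemma cube_between k x r z z' (y : 'rV[int]_d) : cube k x r z -> cube k x r z' ->
  (forall j, (z ord0 j <= y ord0 j <= z' ord0 j) || (z' ord0 j <= y ord0 j <= z ord0 j)) ->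
  cube k x r y.
Proof.
move=> cz cz' H i; have := cz i; have := cz' i; rewrite !mxE !ler_norml.
have m0 := ltW (mesh_gt0 k).
move=> /andP[h1 h2] /andP[h3 h4]; case/orP: (H i) => /andP[yl yr].
  have := ler_wpM2l m0 (_ : (z ord0 i)%:~R <= (y ord0 i)%:~R :> R); rewrite ler_int => /(_ yl).
  have := ler_wpM2l m0 (_ : (y ord0 i)%:~R <= (z' ord0 i)%:~R :> R); rewrite ler_int => /(_ yr).
  by move=> ? ?; apply/andP; split; lra.
have := ler_wpM2l m0 (_ : (z' ord0 i)%:~R <= (y ord0 i)%:~R :> R); rewrite ler_int => /(_ yl).
have := ler_wpM2l m0 (_ : (y ord0 i)%:~R <= (z ord0 i)%:~R :> R); rewrite ler_int => /(_ yr).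
by move=> ? ?; apply/andP; split; lra.
Qed.

Lemma mesh_lip k (F : 'rV[int]_d -> R) C x0 r z z' : 0 <= C ->
  (forall z, cube k x0 r z -> forall j, `|fdiff j F z| <= C * mesh k) ->
  cube k x0 r z -> cube k x0 r z' ->
  `|F z - F z'| <= C * \sum_i `|mesh_pt k z ord0 i - mesh_pt k z' ord0 i|.
Proof.
move=> C0 H cz cz'.
have := @path_lip _ _ F (C * mesh k) z' z; rewrite natr_sum mulr_sumr => h.
apply: le_trans (h _) _.
  by move=> y hy j; apply: H; exact: cube_between hy.
rewrite mulr_sumr; apply: ler_sum => i _.
by rewrite -mulrA mesh_ptB.
Qed.

Section Local.
Variables (F : nat -> 'rV[int]_d -> R) (C r : R) (x0 : 'rV[R]_d).
Hypothesis C0 : 0 <= C.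
Hypothesis r0 : 0 < r.
Hypothesis F0 : \forall k \near U, forall z, cube k x0 r z -> `|F k z| <= C.
Hypothesis F1 : \forall k \near U, forall z, cube k x0 r z ->
  forall j, `|fdiff j (F k) z| <= C * mesh k.

Lemma ulift_cvg x : (forall i, `|x ord0 i - x0 ord0 i| <= r / 2) ->
  F k (mesh_floor k x) @[k --> U] --> ulift F x.
Proof.
move=> xr; apply: (@ulim_cvg _ C); near=> k.
have kr : mesh k <= r / 2 by near: k; apply: mesh_near; rewrite divr_gt0.
have H : forall z, cube k x0 r z -> `|F k z| <= C by near: k.
by apply: H; exact: mesh_floor_cube.
Unshelve. all: by end_near. Qed.

Lemma ulift_lip x y : (forall i, `|x ord0 i - x0 ord0 i| <= r / 2) ->
  (forall i, `|y ord0 i - x0 ord0 i| <= r / 2) ->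
  `|ulift F x - ulift F y| <= C * \sum_i `|x ord0 i - y ord0 i|.
Proof.
move=> xr yr.
have c1 : `|F k (mesh_floor k x) - F k (mesh_floor k y)| @[k --> U] --> `|ulift F x - ulift F y|.
  by apply: cvg_norm; apply: cvgB; exact: ulift_cvg.
have c2 : C * (\sum_i `|x ord0 i - y ord0 i| + 2 * d%:R * mesh k) @[k --> U]
    --> C * (\sum_i `|x ord0 i - y ord0 i| + 2 * d%:R * 0).
  by apply: cvgMr; apply: cvgD; [exact: cvg_cst|apply: cvgMr; exact: mesh_ucvg0].
rewrite mulr0 addr0 in c2.
apply: (ler_cvg_to c1 c2); near=> k.
have kr : mesh k <= r / 2 by near: k; apply: mesh_near; rewrite divr_gt0.
have H : forall z, cube k x0 r z -> forall j, `|fdiff j (F k) z| <= C * mesh k by near: k.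
apply: (le_trans (mesh_lip C0 H (mesh_floor_cube kr xr) (mesh_floor_cube kr yr))).
apply: ler_wpM2l => //.
have -> : 2 * d%:R * mesh k = \sum_(i < d) (2 * mesh k).
  by rewrite sumr_const card_ord -[RHS]mulr_natl; ring.
rewrite -big_split /=; apply: ler_sum => i _.
have := mesh_floor_close k x i; have := mesh_floor_close k y i.
set a := mesh_pt k (mesh_floor k y) ord0 i; set b := mesh_pt k (mesh_floor k x) ord0 i.
have -> : b - a = (b - x ord0 i) + (x ord0 i - y ord0 i) - (a - y ord0 i) by ring.
move=> h1 h2; apply: (le_trans (ler_normB _ _)).
have := ler_normD (b - x ord0 i) (x ord0 i - y ord0 i); lra.
Unshelve. all: by end_near. Qed.

Lemma ulift_continuous : {for x0, continuous (ulift F)}.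
Proof.
suff H : ulift F x @[x --> x0] --> ulift F x0 by exact: H.
apply/(@cvgrPdist_le _ _ _ (nbhs x0) _) => e e0.
have D0 : 0 < C * d%:R + 1 by rewrite ltr_wpDl // mulr_ge0.
pose t := Order.min (r / 2) (e / (C * d%:R + 1)).
have t0 : 0 < t by rewrite lt_min !divr_gt0.
near=> x.
have xt : forall i, `|x ord0 i - x0 ord0 i| <= t.
  by near: x; apply/nbhs_cubeP; exists t => // y yb i; apply: ltW.
apply: (@le_trans _ _ (C * \sum_(i < d) t)).
  apply: le_trans (ulift_lip _ _) _.
  - by move=> i; rewrite subrr normr0 divr_ge0 // ltW.
  - by move=> i; apply: (le_trans (xt i)); rewrite ge_min lexx.
  by apply: ler_wpM2l => //; apply: ler_sum => i _; rewrite distrC.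
rewrite sumr_const card_ord -mulr_natl mulrA.
apply: (@le_trans _ _ ((C * d%:R + 1) * t)).
  by rewrite ler_wpM2r ?(ltW t0) // lerDl.
by rewrite mulrC -ler_pdivlMr // ge_min lexx orbT.
Unshelve. all: by end_near. Qed.

(** The estimate of [second_order], divided by the right powers of the mesh, passes to the
    ultralimit and leaves a quadratic remainder. *)
Lemma ulift_is_derive j :
  (\forall k \near U, forall z, cube k x0 r z ->
     `|fdiff j (fdiff j (F k)) z| <= C * mesh k ^+ 2) ->
  is_derive x0 (delta_mx ord0 j) (ulift F) (ulift (fun k z => fdiff j (F k) z / mesh k) x0).
Proof.
move=> F2; apply: (@is_derive_quadratic _ _ _ _ _ _ C (r / 4)); first by rewrite divr_gt0.
move=> s sr.
have x0r i : `|x0 ord0 i - x0 ord0 i| <= r / 2 by rewrite subrr normr0 divr_ge0 // ltW.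
have xsr i : `|(s *: delta_mx ord0 j + x0) ord0 i - x0 ord0 i| <= r / 2.
  rewrite !mxE eqxx /= addrK normrM.
  apply: (@le_trans _ _ `|s|); last by apply: (le_trans sr); have := r0; lra.
  by rewrite ler_piMr // normr_nat; case: (i == j).
(* The number of lattice steps between the roundings of x0 and of its translate by s; multiplied by
   the mesh it tends to s. *)
pose m k := Num.floor ((x0 ord0 j + s) * k.+1%:R) - Num.floor (x0 ord0 j * k.+1%:R).
have cm : mesh k * (m k)%:~R @[k --> U] --> s.
  apply/cvgrPdist_le => e e0; near=> k.
  rewrite distrC; apply: (le_trans (mesh_floor_shift_close k x0 j s)).
  by near: k; exact: mesh_near.
have c1 := ulift_cvg xsr; have c2 := ulift_cvg x0r.
have c3 : fdiff j (F k) (mesh_floor k x0) / mesh k @[k --> U] --> ulift (fun k z => fdiff j (F k) z / mesh k) x0.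
  apply: (@ulim_cvg _ C); near=> k.
  rewrite normrM normfV (gtr0_norm (mesh_gt0 k)) ler_pdivrMr ?mesh_gt0 //.
  have kr : mesh k <= r / 2 by near: k; apply: mesh_near; rewrite divr_gt0.
  have H : forall z, cube k x0 r z -> forall j, `|fdiff j (F k) z| <= C * mesh k by near: k.
  by apply: H; exact: mesh_floor_cube.
have c4 : `|F k (mesh_floor k (s *: delta_mx ord0 j + x0)) - F k (mesh_floor k x0) -
     mesh k * (m k)%:~R * (fdiff j (F k) (mesh_floor k x0) / mesh k)| @[k --> U] -->
   `|ulift F (s *: delta_mx ord0 j + x0) - ulift F x0 - s * ulift (fun k z => fdiff j (F k) z / mesh k) x0|.
  by apply: cvg_norm; apply: cvgB; [exact: cvgB|exact: cvgM].
have c5 : C * (mesh k * (m k)%:~R) ^+ 2 @[k --> U] --> C * s ^+ 2.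
  by apply: cvgMr; rewrite !expr2; exact: cvgM.
apply: (ler_cvg_to c4 c5); near=> k.
have kr : mesh k <= r / 2 by near: k; apply: mesh_near; rewrite divr_gt0.
have H : forall z, cube k x0 r z ->
     `|fdiff j (fdiff j (F k)) z| <= C * mesh k ^+ 2 by near: k.
have SO := @second_order _ _ (F k) (C * mesh k ^+ 2) (mesh_floor k x0) j (m k).
rewrite mesh_floor_shift -/(m k).
have -> : mesh k * (m k)%:~R * (fdiff j (F k) (mesh_floor k x0) / mesh k) =
   (m k)%:~R * fdiff j (F k) (mesh_floor k x0).
  by field; rewrite gt_eqF // mesh_gt0.
rewrite exprMn mulrA; apply: SO => p pm; apply: H => i.
rewrite mesh_ptD !mxE eqxx /=.
have := mesh_floor_shift_close k x0 j s; rewrite -/(m k) => ms.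
have pms : `|mesh k * p%:~R| <= `|mesh k * (m k)%:~R|.
  rewrite !normrM ler_wpM2l // -!intr_norm ler_int //.
have km : mesh k <= r / 4 by near: k; apply: mesh_near; rewrite divr_gt0.
have := mesh_floor_close k x0 i; rewrite !mxE.
case: eqP => [->|_] /=; last by rewrite mulr0 addr0; have := r0; lra.
rewrite mulr1 => h.
have e1 : `|mesh k * (m k)%:~R| <= mesh k + `|s|.
  rewrite -[X in `|X|](subrK s); apply: (le_trans (ler_normD _ _)); lra.
rewrite addrAC; apply: (le_trans (ler_normD _ _)); have := r0; lra.
Unshelve. all: by end_near. Qed.

End Local.

(** N is about r / 16 measured in mesh units: 8 N steps stay inside the cube of radius r, while N
    times the mesh is at least r / 32, so that each factor 2 d / N is at most D times the mesh. *)
Lemma interior_bounds (F : nat -> 'rV[int]_d -> R) (M r : R) x0 : 0 <= M -> 0 < r ->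
  (\forall k \near U, forall z, cube k x0 r z -> `|F k z| <= M /\ dlap (F k) z = 0) ->
  exists C r', [/\ 0 <= C, 0 < r' & \forall k \near U, forall z, cube k x0 r' z -> forall i j l,
    [/\ `|F k z| <= C, `|fdiff i (F k) z| <= C * mesh k,
     `|fdiff j (fdiff i (F k)) z| <= C * mesh k ^+ 2 &
     `|fdiff l (fdiff j (fdiff i (F k))) z| <= C * mesh k ^+ 3]].
Proof.
move=> M0 r0 H.
pose D : R := 2 * d%:R * (32 / r).
have D0 : 0 <= D by rewrite !mulr_ge0 // invr_ge0 ltW.
pose C := M + D * M + D ^+ 2 * M + D ^+ 3 * M.
have p1 : 0 <= D * M by rewrite mulr_ge0.
have p2 : 0 <= D ^+ 2 * M by rewrite mulr_ge0 // exprn_ge0.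
have p3 : 0 <= D ^+ 3 * M by rewrite mulr_ge0 // exprn_ge0.
have [q0 q1 q2 q3] : [/\ M <= C, D * M <= C, D ^+ 2 * M <= C & D ^+ 3 * M <= C].
  by move: (D ^+ 3 * M) (D ^+ 2 * M) (D * M) p1 p2 p3 @C => x1 x2 x3 p1 p2 p3 C; rewrite /C; split; lra.
have rr : r / 64 <= r by rewrite ler_pdivrMr // ler_peMr ?ler1n // ltW.
exists C, (r / 64); split; [by rewrite /C !addr_ge0|by rewrite divr_gt0|].
near=> k => z cz i j l.
have h0 := mesh_gt0 k.
have kr : mesh k <= r / 64 by near: k; apply: mesh_near; rewrite divr_gt0.
have Hk : forall z, cube k x0 r z -> `|F k z| <= M /\ dlap (F k) z = 0 by near: k.
have t0 : 0 <= r / 16 * k.+1%:R by rewrite mulr_ge0 // divr_ge0 // ltW.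
pose N := absz (Num.floor (r / 16 * k.+1%:R)).
have NE : (N%:R : R) = (Num.floor (r / 16 * k.+1%:R))%:~R.
  by rewrite /N -[_%:R]/(_%:Z%:~R) gez0_abs // floor_ge0.
have /andP[f1 f2] := floor_itv (r / 16 * k.+1%:R); rewrite intrD -NE in f2; rewrite -NE in f1.
have hN1 : mesh k * N%:R <= r / 16.
  by have := ler_wpM2l (ltW h0) f1; rewrite mulrCA meshV mulr1.
have hN2 : r / 32 <= mesh k * N%:R.
  have := ltW f2; rewrite -(ler_pM2l h0) mulrCA meshV mulr1 mulrDr mulr1z mulr1.
  by have := r0; move: kr; clear -R d; lra.
have Npos : 0 < N%:R :> R.
  by rewrite -(pmulr_rgt0 _ h0); apply: lt_le_trans hN2; rewrite divr_gt0.
have N0 : (0 < N)%N by rewrite -(ltr0n R).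
have hb : hbox (F k) (mesh_floor k x0) (8 * N) M.
  move=> y yc; apply: Hk => n; have := mesh_floor_close k x0 n.
  have : mesh k * `|(y ord0 n - mesh_floor k x0 ord0 n)%:~R| <= mesh k * (8 * N)%N%:R.
    by rewrite ler_wpM2l ?(ltW h0) // -intr_norm -[_%:R]/(_%:Z%:~R) ler_int.
  rewrite -{1}(gtr0_norm h0) -normrM intrB mulrBr natrM mulrCA !mxE.
  by move=> h1 h2; apply: (dist_trans_le h1 h2); have := r0; move: hN1 kr; clear -R d; lra.
have zN n : `|z ord0 n - mesh_floor k x0 ord0 n| <= N%:Z.
  rewrite -(ler_int R) intr_norm -(ler_pM2l h0) -{1}(gtr0_norm h0) -normrM intrB mulrBr.
  rewrite -[_%:Z%:~R]/(N%:R : R); have := mesh_floor_close k x0 n; have := cz n.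
  rewrite !mxE [in X in _ -> X -> _]distrC => h1 h2; apply: (dist_trans_le h1 h2).
  by have := r0; move: hN2 kr; clear -R d; lra.
have [b1 b2 b3] := hbox_diff_bounds N0 M0 hb zN i j l.
have Nh : N%:R^-1 <= 32 / r * mesh k.
  have e : 1 = 32 / r * (r / 32) by field; rewrite gt_eqF.
  have : 32 / r * (r / 32) <= 32 / r * (mesh k * N%:R).
    by rewrite ler_wpM2l // divr_ge0 // ltW.
  by rewrite -e mulrA -ler_pdivrMr // mul1r.
have pw (n : nat) : (2 * d%:R) ^+ n * M / N%:R ^+ n <= D ^+ n * M * mesh k ^+ n.
  have : 0 <= 2 * d%:R :> R by rewrite mulr_ge0.
  rewrite /D; move: (2 * d%:R) => e e0.
  rewrite [(e * _) ^+ n]exprMn -!mulrA ler_wpM2l ?exprn_ge0 // mulrCA ler_wpM2l //.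
  rewrite -exprMn -exprVn lerXn2r ?nnegrE ?invr_ge0 ?(ltW Npos) //.
  by rewrite mulr_ge0 ?divr_ge0 // ltW.
split.
- apply: (@le_trans _ _ M) => //.
  by apply: (Hk z _).1 => n; exact: le_trans (cz n) rr.
- apply: (le_trans b1); have := pw 1%N; rewrite !expr1 => /le_trans; apply.
  by rewrite ler_wpM2r ?(ltW h0).
- apply: (le_trans b2); apply: (le_trans (pw 2%N)).
  by rewrite ler_wpM2r ?exprn_ge0 ?(ltW h0).
- apply: (le_trans b3); apply: (le_trans (pw 3%N)).
  by rewrite ler_wpM2r ?exprn_ge0 ?(ltW h0).
Unshelve. all: by end_near. Qed.

End Ultralimit.
End Mesh.

(** * Barriers touching the obstacle from above *)

Section QuarticRoot.
Context {R : realType}.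
Implicit Types (s e c : R).

Definition invroot4 s : R := (Num.sqrt (Num.sqrt s))^-1.

Lemma invroot4_gt0 s : 0 < s -> 0 < invroot4 s.
Proof. by move=> s0; rewrite invr_gt0 !sqrtr_gt0. Qed.

Lemma invroot4E s : 0 < s -> invroot4 s ^+ 4 * s = 1.
Proof.
move=> s0; rewrite /invroot4 exprVn (exprM _ 2 2) sqr_sqrtr ?sqrtr_ge0 //.
by rewrite sqr_sqrtr ?(ltW s0) // mulVf // gt_eqF.
Qed.

Lemma invroot4_le s s' : 0 < s -> s <= s' -> invroot4 s' <= invroot4 s.
Proof.
move=> s0 ss'; have s'0 := lt_le_trans s0 ss'.
by rewrite lef_pV2 ?posrE ?sqrtr_gt0 // ler_sqrt ?sqrtr_ge0 // ler_sqrt // ltW.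
Qed.

(* 11/64 lies strictly between the Taylor coefficient 5/32 of (1 + e)^(-1/4) and
   3/16, the largest coefficient for which [qbump] is discretely superharmonic
   in dimension 3. *)
Lemma quartic_upper e : `|e| <= 100^-1 -> 1 <= (1 + e) * (1 - e / 4 + 11 / 64 * e ^+ 2) ^+ 4.
Proof.
rewrite ler_norml => /andP[e1 e2].
set y := 1 - e / 4 + 11 / 64 * e ^+ 2.
have ee : 0 <= e ^+ 2 by exact: sqr_ge0.
have y2 : 1 - e / 2 + 2 / 5 * e ^+ 2 <= y ^+ 2.
  rewrite -subr_ge0.
  have -> : y ^+ 2 - (1 - e / 2 + 2 / 5 * e ^+ 2) =
    e ^+ 2 * (1 / 160 - 11 / 128 * e) + 121 / 4096 * (e ^+ 2) ^+ 2 by rewrite /y; field.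
  by apply: addr_ge0; apply: mulr_ge0; rewrite ?sqr_ge0; lra.
have z2 : 1 - e + 104 / 100 * e ^+ 2 <= (1 - e / 2 + 2 / 5 * e ^+ 2) ^+ 2.
  rewrite -subr_ge0.
  have -> : (1 - e / 2 + 2 / 5 * e ^+ 2) ^+ 2 - (1 - e + 104 / 100 * e ^+ 2) =
    e ^+ 2 * (1 / 100 - 2 / 5 * e) + 4 / 25 * (e ^+ 2) ^+ 2 by field.
  by apply: addr_ge0; apply: mulr_ge0; rewrite ?sqr_ge0; lra.
have y4 : 1 - e + 104 / 100 * e ^+ 2 <= y ^+ 4.
  apply: (le_trans z2); rewrite (exprM _ 2 2) lerXn2r ?nnegrE ?sqr_ge0 //; lra.
apply: (@le_trans _ _ ((1 + e) * (1 - e + 104 / 100 * e ^+ 2))); last first.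
  by apply: ler_wpM2l => //; lra.
rewrite -subr_ge0.
have -> : (1 + e) * (1 - e + 104 / 100 * e ^+ 2) - 1 = e ^+ 2 * (4 / 100 + 104 / 100 * e) by field.
by apply: mulr_ge0; [exact: ee|lra].
Qed.

Lemma invroot4_upper s e : 0 < s -> `|e| <= 100^-1 ->
  invroot4 (s * (1 + e)) <= invroot4 s * (1 - e / 4 + 11 / 64 * e ^+ 2).
Proof.
move=> s0 e0; have := quartic_upper e0; move: e0; rewrite ler_norml => /andP[e1 e2].
have p0 : 0 < 1 + e by lra.
have y0 : 0 < 1 - e / 4 + 11 / 64 * e ^+ 2 by have := sqr_ge0 e; lra.
have se0 : 0 < s * (1 + e) by rewrite mulr_gt0.
have := invroot4E s0; have := invroot4E se0.
have := invroot4_gt0 s0; have := invroot4_gt0 se0.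
move: (invroot4 s) (invroot4 (s * (1 + e))) (1 - _ + _) y0 => b a y y0 a0 b0 ha hb hy.
rewrite leNgt; apply/negP => lt.
have h : (b * y) ^+ 4 < a ^+ 4 by rewrite ltrXn2r // ltW // mulr_gt0.
have : (b * y) ^+ 4 * (s * (1 + e)) < 1 by move: h; rewrite -(ltr_pM2r se0) ha.
have -> : (b * y) ^+ 4 * (s * (1 + e)) = (b ^+ 4 * s) * ((1 + e) * y ^+ 4) by ring.
by rewrite hb mul1r ltNge hy.
Qed.

(** Convexity of s^(-1/4). With s = a^(-4) and s0 = b^(-4), the gap to the tangent is (a - b)^2
    times a polynomial with nonnegative coefficients, over 4 a^4. *)
Lemma invroot4_tangent s0 s : 0 < s0 -> 0 < s ->
  invroot4 s0 - invroot4 s0 ^+ 5 / 4 * (s - s0) <= invroot4 s.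
Proof.
move=> s00 sp.
have := invroot4E s00; have := invroot4E sp.
have := invroot4_gt0 s00; have := invroot4_gt0 sp.
move: (invroot4 s) (invroot4 s0) => a b a0 b0 ha hb.
have an : a ^+ 4 != 0 by rewrite gt_eqF // exprn_gt0.
have bn : b ^+ 4 != 0 by rewrite gt_eqF // exprn_gt0.
have -> : s = (a ^+ 4)^-1 by rewrite -[LHS]mul1r -(mulVf an) -mulrA ha mulr1.
have -> : s0 = (b ^+ 4)^-1 by rewrite -[LHS]mul1r -(mulVf bn) -mulrA hb mulr1.
rewrite -subr_ge0.
have -> : a - (b - b ^+ 5 / 4 * ((a ^+ 4)^-1 - (b ^+ 4)^-1)) =
  (a - b) ^+ 2 * (4 * a ^+ 3 + 3 * a ^+ 2 * b + 2 * a * b ^+ 2 + b ^+ 3) / (4 * a ^+ 4).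
  by field; rewrite !gt_eqF.
have a1 := ltW a0; have b1 := ltW b0.
apply: divr_ge0; last by rewrite mulr_ge0 ?exprn_ge0.
by apply: mulr_ge0; [exact: sqr_ge0 | rewrite !(addr_ge0, mulr_ge0, exprn_ge0)].
Qed.

End QuarticRoot.

Section Barrier.
Context {R : realType} {d : nat}.
Variable l : 'I_d.
Hypothesis d3 : (3 <= d)%N.
Implicit Types (x y : 'rV[R]_d) (z : 'rV[int]_d).

Definition thin_sqdist x y : R := \sum_(i < d | i != l) (x ord0 i - y ord0 i) ^+ 2.

Lemma thin_sqdist_ge0 x y : 0 <= thin_sqdist x y.
Proof. by apply: sumr_ge0 => i _; exact: sqr_ge0. Qed.

(* The squared distance to the point at depth 1 below [c] when x_l >= 0,
   reflected evenly in x_l. *)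
Definition sqdepth c x : R := thin_sqdist x c + (`|x ord0 l| + 1) ^+ 2.

Lemma sqdepth_ge1 c x : 1 <= sqdepth c x.
Proof.
have := thin_sqdist_ge0 x c; have : 1 <= (`|x ord0 l| + 1) ^+ 2.
  by rewrite expr_ge1 ?addr_ge0 // lerDr.
by rewrite /sqdepth; lra.
Qed.

(* The exponent -1/4 is larger than the one of the fundamental solution, so that
   the superharmonicity is strict and survives discretization. *)
Definition qbump c x : R := invroot4 (sqdepth c x).

Let comp (c x : 'rV[R]_d) i : R := if i == l then `|x ord0 l| + 1 else x ord0 i - c ord0 i.

Let comp_sum c x : \sum_(i < d) comp c x i ^+ 2 = sqdepth c x.
Proof.
rewrite (bigD1 l) //= /comp eqxx /sqdepth addrC; congr (_ + _).
by apply: eq_bigr => i il; rewrite (negbTE il).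
Qed.

Let comp_le c x i : comp c x i ^+ 2 <= sqdepth c x.
Proof. by rewrite -comp_sum (bigD1 i) //= lerDl; apply: sumr_ge0 => j _; exact: sqr_ge0. Qed.

Lemma qbump_gt0 c x : 0 < qbump c x.
Proof. by apply: invroot4_gt0; have := sqdepth_ge1 c x; lra. Qed.

(** A move by h or -h changes S into S (1 + ep) or S (1 + em), and [invroot4_upper] applies to both.
    In the vertical direction a move towards the thin space may be reflected; this only increases
    the squared distance and so decreases [qbump]. *)
Lemma qbump_second_diff c x i h : 0 < h -> h <= 300^-1 ->
  qbump c (x + h *: delta_mx ord0 i) + qbump c (x - h *: delta_mx ord0 i) - 2 * qbump c x <=
  qbump c x * (- (h ^+ 2 / sqdepth c x) / 2 +
    11 / 64 * ((2 * h ^+ 4 + 8 * h ^+ 2 * comp c x i ^+ 2) / sqdepth c x ^+ 2)).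
Proof.
move=> h0 h1.
set S := sqdepth c x; set y := comp c x i.
have S1 : 1 <= S by exact: sqdepth_ge1.
have S0 : 0 < S by lra.
have yS : `|y| <= S.
  have y2 : y ^+ 2 <= S ^+ 2.
    by apply: (le_trans (comp_le c x i)); rewrite expr2 ler_peMl // ltW.
  by rewrite -(@ler_pXn2r _ 2) ?nnegrE ?normr_ge0 ?(ltW S0) // real_normK ?num_real.
pose ep := (h ^+ 2 + 2 * h * y) / S; pose em := (h ^+ 2 - 2 * h * y) / S.
have hh : h ^+ 2 <= h by rewrite expr2 ler_piMl ?(ltW h0) //; lra.
(* As h^2 <= h <= h S, the numerator is at most 3 h S, hence the bound 300^-1 on h. *)
have bnd (t : R) : `|t| <= S -> `|(h ^+ 2 + 2 * h * t) / S| <= 100^-1.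
  move=> tS; rewrite normrM normfV (gtr0_norm S0) ler_pdivrMr //.
  apply: (le_trans (ler_normD _ _)).
  rewrite ger0_norm ?sqr_ge0 // normrM ger0_norm; last by lra.
  have : 2 * h * `|t| <= 2 * h * S by rewrite ler_wpM2l //; lra.
  have : h * S <= 300^-1 * S by rewrite ler_wpM2r // ltW.
  have : h <= h * S by rewrite ler_peMr // ltW.
  move: hh; clear -R d; lra.
have epb : `|ep| <= 100^-1 by apply: bnd.
have emb' : `|em| <= 100^-1 by rewrite /em -mulrN; apply: bnd; rewrite normrN.
have up1 := invroot4_upper S0 epb.
have up2 := invroot4_upper S0 emb'.
have E1 : S * (1 + ep) = S + 2 * h * y + h ^+ 2 by rewrite /ep; field; rewrite gt_eqF.
have E2 : S * (1 + em) = S - 2 * h * y + h ^+ 2 by rewrite /em; field; rewrite gt_eqF.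
have pos e : `|e| <= 100^-1 -> 0 < S * (1 + e).
  by rewrite ler_norml => /andP[? ?]; rewrite mulr_gt0 //; lra.
have key : qbump c (x + h *: delta_mx ord0 i) + qbump c (x - h *: delta_mx ord0 i) <=
   invroot4 (S * (1 + ep)) + invroot4 (S * (1 + em)).
  have := pos _ epb; have := pos _ emb'; rewrite E1 E2 /qbump.
  rewrite /y /comp; case: eqP => [->|/eqP il] p2 p1; last first.
    rewrite le_eqVlt; apply/orP; left; apply/eqP.
    have F s : sqdepth c (x + s *: delta_mx ord0 i) = S + 2 * s * (x ord0 i - c ord0 i) + s ^+ 2.
      rewrite /S /sqdepth /thin_sqdist (bigD1 i) //= [in RHS](bigD1 i) //= !mxE !eqxx /=.
      rewrite (eq_sym l) (negbTE il) /= mulr0 addr0 mulr1.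
      rewrite (eq_bigr (fun j => (x ord0 j - c ord0 j) ^+ 2)); first by ring.
      by move=> j /andP[_ ji]; rewrite !mxE (negbTE ji) andbF mulr0 addr0.
    by rewrite -scaleNr !F; congr (invroot4 _ + invroot4 _); ring.
  have F s : sqdepth c (x + s *: delta_mx ord0 l) = thin_sqdist x c + (`|x ord0 l + s| + 1) ^+ 2.
    rewrite /sqdepth !mxE !eqxx /= mulr1; congr (_ + _); apply: eq_bigr => j jl.
    by rewrite !mxE (negbTE jl) andbF mulr0 addr0.
  rewrite -scaleNr !F; set t := x ord0 l.
  have SE : S = thin_sqdist x c + (`|t| + 1) ^+ 2 by [].
  have G1 : S + 2 * h * (`|t| + 1) + h ^+ 2 = thin_sqdist x c + (`|t| + h + 1) ^+ 2.
    by rewrite SE; ring.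
  have G2 : S - 2 * h * (`|t| + 1) + h ^+ 2 = thin_sqdist x c + (`|t| - h + 1) ^+ 2.
    by rewrite SE; ring.
  rewrite G1 G2 in p1 p2 *.
  have sq (a b : R) : 0 <= a + 1 -> a <= b -> (a + 1) ^+ 2 <= (b + 1) ^+ 2.
    by move=> a0 ab; rewrite lerXn2r ?nnegrE //; lra.
  have t0 := normr_ge0 t.
  have [tp|tn] := leP 0 t.
    have tE : `|t| = t by rewrite ger0_norm.
    have te : `|t + h| = t + h by rewrite ger0_norm //; lra.
    rewrite te tE in p1 p2 *; apply: lerD => //.
    by apply: invroot4_le => //; rewrite lerD2l sq ?ler_norm //; lra.
  have tE : `|t| = - t by rewrite ltr0_norm.
  have te : `|t - h| = - t + h by rewrite ltr0_norm; [ring|lra].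
  rewrite te tE in p1 p2 *; rewrite [leLHS]addrC; apply: lerD => //.
  apply: invroot4_le => //; rewrite lerD2l sq //; first lra.
  by rewrite -normrN; apply: le_trans (ler_norm _); lra.
have -> : - (h ^+ 2 / S) / 2 + 11 / 64 * ((2 * h ^+ 4 + 8 * h ^+ 2 * y ^+ 2) / S ^+ 2) =
  (1 - ep / 4 + 11 / 64 * ep ^+ 2) + (1 - em / 4 + 11 / 64 * em ^+ 2) - 2.
  by rewrite /ep /em; field; rewrite gt_eqF.
rewrite mulrBr mulrDr [_ * 2]mulrC -/(qbump c x) lerB //.
by apply: (le_trans key); exact: lerD.
Qed.

(** After summation the coefficient of S is d / 2 - 11 / 8, at least 1 / 8 when d >= 3; as S >= 1 it
    absorbs the discretization error 11 / 32 d h^2. *)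
Lemma dlap_qbump c k z : (mesh k : R) <= 300^-1 -> dlap (fun z => qbump c (mesh_pt k z)) z <= 0.
Proof.
move=> h1; have h0 := @mesh_gt0 R k.
set x : 'rV[R]_d := mesh_pt k z; set S := sqdepth c x; set h : R := mesh k in h0 h1 *.
have S1 : 1 <= S by exact: sqdepth_ge1.
have S0 : 0 < S by lra.
have E (s : int) i : mesh_pt k (z + s *: unit_vec i) = x + (h * s%:~R) *: delta_mx ord0 i by rewrite mesh_ptD.
apply: (@le_trans _ _ (\sum_(i < d) (qbump c x * (- (h ^+ 2 / S) / 2 +
    11 / 64 * ((2 * h ^+ 4 + 8 * h ^+ 2 * comp c x i ^+ 2) / S ^+ 2))))).
  apply: ler_sum => i _; rewrite /diff2 -(scaleN1r (unit_vec i)) -[X in mesh_pt k (z + X) ]scale1r.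
  rewrite !E intrN mulr1z mulr1 mulrN1 scaleNr.
  exact: qbump_second_diff.
have sumc (t : R) : \sum_(i < d) t = d%:R * t by rewrite sumr_const card_ord mulr_natl.
rewrite -mulr_sumr pmulr_rle0 ?qbump_gt0 // big_split /= sumc.
rewrite -mulr_sumr -mulr_suml big_split /= sumc -mulr_sumr comp_sum -/S.
have dr : 3 <= d%:R :> R by rewrite ler_nat.
have -> : d%:R * (- (h ^+ 2 / S) / 2) + 11 / 64 * ((d%:R * (2 * h ^+ 4) + 8 * h ^+ 2 * S) / S ^+ 2) =
  - (h ^+ 2 / S ^+ 2) * (S * (d%:R / 2 - 11 / 8) - 11 / 32 * d%:R * h ^+ 2).
  by field; rewrite gt_eqF.
rewrite mulNr oppr_le0 mulr_ge0 // ?divr_ge0 ?exprn_ge0 ?(ltW h0) ?(ltW S0) //.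
have h2 : h ^+ 2 <= 100^-1.
  by rewrite expr2; apply: (@le_trans _ _ (1 * h)); [rewrite ler_wpM2r ?(ltW h0)|]; lra.
have : 1 * (d%:R / 2 - 11 / 8) <= S * (d%:R / 2 - 11 / 8).
  by rewrite ler_wpM2r //; lra.
have : d%:R * h ^+ 2 <= d%:R * 100^-1 by rewrite ler_wpM2l.
rewrite -[11 / 32 * d%:R * h ^+ 2]mulrA.
move: dr; move: (d%:R * h ^+ 2) (S * (d%:R / 2 - 11 / 8)) (d%:R : R) => u v D.
by clear -R d; lra.
Qed.

End Barrier.

Definition discrete_sol (R : realType) (d : nat) (l : 'I_d) (phi : 'rV[R]_d -> R) (k : nat) :=
  least_supersol l (fun z => phi (mesh_pt k z)).

Section Touching.
Context {R : realType} {d : nat}.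
Variable l : 'I_d.
Hypothesis d3 : (3 <= d)%N.
Variable U : set_system nat.
Hypothesis FU : UltraFilter U.
Hypothesis HU : \oo `<=` U.
Let PU : ProperFilter U := ultra_proper.
#[local] Existing Instance PU.
Variables (phi : 'rV[R]_d -> R) (M : R).
Hypothesis M0 : 0 <= M.
Hypothesis phiM : forall x : 'rV[R]_d, x ord0 l = 0 -> phi x <= M.

Lemma mesh_pt_thin k (z : 'rV[int]_d) : z ord0 l = 0 -> (mesh_pt k z : 'rV[R]_d) ord0 l = 0.
Proof. by move=> zl; rewrite mxE zl mulr0z mulr0. Qed.

Lemma discrete_sol_cvg (x : 'rV[R]_d) : discrete_sol l phi k (mesh_floor k x) @[k --> U] --> ulift U (discrete_sol l phi) x.
Proof.
apply: (@ulim_cvg _ _ FU _ M); near=> k.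
have pM (z : 'rV[int]_d) : z ord0 l = 0 -> phi (mesh_pt k z) <= M by move=> zl; apply: phiM; exact: mesh_pt_thin.
have [v0 _ _] := least_supersolP M0 pM.
by rewrite ger0_norm ?v0 //; exact: least_supersol_leM.
Unshelve. all: by end_near. Qed.

Lemma mesh_pt_floor_cvg_coord (x : 'rV[R]_d) i : (mesh_pt k (mesh_floor k x) : 'rV[R]_d) ord0 i @[k --> U] --> x ord0 i.
Proof.
apply/cvgrPdist_le => e e0; near=> k; rewrite distrC.
apply: (le_trans (mesh_floor_close k x i)); near: k; exact: mesh_near.
Unshelve. all: by end_near. Qed.

(** On the thin space [sqdepth] is s = |x' - x1|^2 + 1, and the barrier is a convex function of s
    tangent at s0 to the paraboloid, which is affine in s. It is thus an admissible supersolution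
    for all small meshes, and its value at x0 is phi x0. *)
Lemma ulift_le_touching (A s0 : R) (x0 x1 : 'rV[R]_d) : 0 <= A -> 4 * A * s0 <= phi x0 ->
  x0 ord0 l = 0 -> s0 = thin_sqdist l x0 x1 + 1 ->
  (forall x : 'rV[R]_d, x ord0 l = 0 -> phi x <= phi x0 - A * (thin_sqdist l x x1 + 1 - s0)) ->
  ulift U (discrete_sol l phi) x0 <= phi x0.
Proof.
move=> A0 As0 x0l s0E touch.
have s00 : 0 < s0 by rewrite s0E ltr_wpDl ?thin_sqdist_ge0.
have q0 := invroot4_gt0 s00.
(* The derivative of s^(-1/4) at s0 is - s0^(-5/4) / 4, so this coefficient gives slope -A. *)
pose a := 4 * A * s0 / invroot4 s0.
have a0 : 0 <= a by rewrite divr_ge0 ?mulr_ge0 // ltW.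
pose w k (z : 'rV[int]_d) := phi x0 - 4 * A * s0 + a * qbump l x1 (mesh_pt k z).
have wx0 : phi x0 - 4 * A * s0 + a * qbump l x1 x0 = phi x0.
  rewrite /qbump /sqdepth x0l normr0 add0r expr1n -s0E /a mulfVK ?gt_eqF // subrK //.
have cw : w k (mesh_floor k x0) @[k --> U] --> phi x0 - 4 * A * s0 + a * qbump l x1 x0.
  apply: cvgD; first exact: cvg_cst.
  apply: cvgMr; apply: cvgV.
    by rewrite !sqrtr_eq0 -ltNge sqrtr_gt0; have := sqdepth_ge1 l x1 x0; lra.
  have c1 : sqdepth l x1 (mesh_pt k (mesh_floor k x0)) @[k --> U] --> sqdepth l x1 x0.
    apply: cvgD.
      have c2 i : (i != l) -> ((mesh_pt k (mesh_floor k x0) : 'rV[R]_d) ord0 i - x1 ord0 i) ^+ 2 @[k --> U] -->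
        (x0 ord0 i - x1 ord0 i) ^+ 2.
        move=> _; rewrite expr2; under eq_fun do rewrite expr2.
        by apply: cvgM; (apply: cvgB; [exact: mesh_pt_floor_cvg_coord|exact: cvg_cst]).
      by apply: cvg_big => //; exact: add_continuous.
    rewrite expr2; under eq_fun do rewrite expr2.
    by apply: cvgM; (apply: cvgD; [apply: cvg_norm; exact: mesh_pt_floor_cvg_coord|exact: cvg_cst]).
  by apply: (continuous_cvg _ (@sqrt_continuous _ _)); apply: (continuous_cvg _ (@sqrt_continuous _ _)).
have := ler_cvg_to (@discrete_sol_cvg x0) cw; rewrite wx0; apply.
near=> k.
have k300 : (mesh k : R) <= 300^-1 by near: k; apply: (mesh_near HU); rewrite invr_gt0 ltr0n.
apply: least_supersol_le; split=> z.
- by apply: addr_ge0; [rewrite subr_ge0 | rewrite mulr_ge0 // ltW // qbump_gt0].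
- have -> : dlap (w k) z = a * dlap (fun z => qbump l x1 (mesh_pt k z)) z.
    by rewrite /dlap mulr_sumr; apply: eq_bigr => i _; rewrite /diff2 /w; ring.
  by rewrite mulr_ge0_le0 // dlap_qbump.
- move=> zl; have el := mesh_pt_thin k zl; apply: (le_trans (touch _ el)).
  set x : 'rV[R]_d := mesh_pt k z in el *; rewrite /w -/x /qbump.
  have sE : sqdepth l x1 x = thin_sqdist l x x1 + 1.
    by rewrite /sqdepth el normr0 add0r expr1n.
  have sp : 0 < thin_sqdist l x x1 + 1 by rewrite ltr_wpDl ?thin_sqdist_ge0.
  rewrite sE; have := ler_wpM2l a0 (invroot4_tangent s00 sp).
  have -> : a * (invroot4 s0 - invroot4 s0 ^+ 5 / 4 * (thin_sqdist l x x1 + 1 - s0)) =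
    4 * A * s0 - A * (invroot4 s0 ^+ 4 * s0) * (thin_sqdist l x x1 + 1 - s0).
    by rewrite /a; field; rewrite gt_eqF.
  by rewrite invroot4E // mulr1; lra.
Unshelve. all: by end_near. Qed.

End Touching.

(** * The limit of the discrete solutions *)

Section LimitSolution.
Context {R : realType} {d : nat}.
Variable l : 'I_d.
Variable U : set_system nat.
Hypothesis FU : UltraFilter U.
Hypothesis HU : \oo `<=` U.
Let PU : ProperFilter U := ultra_proper.
#[local] Existing Instance PU.
Variables (phi : 'rV[R]_d -> R) (M C : R).
Hypothesis M0 : 0 <= M.
Hypothesis C0 : 0 <= C.
Hypothesis phi_cont : continuous phi.
Hypothesis phiM : forall x : 'rV[R]_d, x ord0 l = 0 -> phi x <= M.
Hypothesis phi_lip : forall (x : 'rV[R]_d) i s, x ord0 l = 0 -> 0 < phi x -> `|s| <= 1 ->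
  phi x - C * `|s| <= phi (x + s *: delta_mx ord0 i).
Hypothesis phi_semiconvex : forall (x : 'rV[R]_d) i s, x ord0 l = 0 -> 0 < phi x -> `|s| <= 1 ->
  - (C * s ^+ 2) <= phi (x + s *: delta_mx ord0 i) + phi (x - s *: delta_mx ord0 i) - 2 * phi x.

Local Notation vk := (discrete_sol l phi).
Local Notation v := (ulift U (discrete_sol l phi)).

Let phikM k (z : 'rV[int]_d) : z ord0 l = 0 -> phi (mesh_pt k z) <= M.
Proof. by move=> zl; apply: phiM; exact: mesh_pt_thin. Qed.

Lemma discrete_sol_super k : supersol l (fun z => phi (mesh_pt k z)) (vk k).
Proof. exact: (least_supersolP M0 (@phikM k)). Qed.

Lemma discrete_sol_bound k z : 0 <= vk k z <= M.
Proof.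
have [v0 _ _] := discrete_sol_super k.
by rewrite v0; exact: (least_supersol_leM M0 (@phikM k)).
Qed.

Definition sol_lip : R := M + d%:R * C + C.

Lemma sol_lip_ge0 : 0 <= sol_lip. Proof. by rewrite /sol_lip !addr_ge0 ?mulr_ge0. Qed.

Lemma discrete_sol_lip k i z : `|fdiff i (vk k) z| <= sol_lip * mesh k.
Proof.
have h0 := @mesh_gt0 R k.
have h1 : `|mesh k : R| <= 1 by rewrite gtr0_norm // mesh_le1.
have C1 : 0 <= C * mesh k by rewrite mulr_ge0 // ltW.
have C2 : 0 <= C * mesh k ^+ 2 by rewrite mulr_ge0 // exprn_ge0 // ltW.
have lip (z' : 'rV[int]_d) j (s : int) : z' ord0 l = 0 -> 0 < phi (mesh_pt k z') -> s = 1 \/ s = -1 ->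
    phi (mesh_pt k z') - C * mesh k <= phi (mesh_pt k (z' + s *: unit_vec j)).
  move=> zl p0 hs; rewrite mesh_ptD.
  have -> : C * mesh k = C * `|mesh k * s%:~R|.
    by rewrite normrM; case: hs => ->; rewrite ?intrN ?normrN mulr1z normr1 mulr1 gtr0_norm.
  apply: phi_lip => //; first exact: mesh_pt_thin.
  by rewrite normrM; case: hs => ->; rewrite ?intrN ?normrN mulr1z normr1 mulr1.
have semi (z' : 'rV[int]_d) j : z' ord0 l = 0 -> 0 < phi (mesh_pt k z') ->
    - (C * mesh k ^+ 2) <= diff2 j (fun z => phi (mesh_pt k z)) z'.
  move=> zl p0; rewrite /diff2 -(scaleN1r (unit_vec j)) -[X in z' + X]scale1r !mesh_ptD.
  rewrite intrN mulr1z mulr1 mulrN1 scaleNr.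
  by apply: phi_semiconvex => //; exact: mesh_pt_thin.
have CL : C * mesh k <= sol_lip * mesh k.
  by rewrite ler_wpM2r ?(ltW h0) // /sol_lip lerDr addr_ge0 // mulr_ge0.
case: (eqVneq i l) => [->|il]; last first.
  by apply: le_trans CL; apply: (least_supersol_lip M0 (@phikM k) C1 lip).
(* With m = k + 1 steps, that is one unit of length, M / m and d C h^2 m are both of the order of
   the mesh h. *)
have := least_supersol_lip_vert M0 (@phikM k) C1 C2 semi z (ltn0Sn k).
move=> /le_trans; apply.
have -> : M / k.+1%:R = M * mesh k by [].
have -> : d%:R * (C * mesh k ^+ 2) * k.+1%:R = d%:R * C * mesh k * (mesh k * k.+1%:R) by ring.
by rewrite meshV mulr1 -mulrDl ler_wpM2r ?(ltW h0) // /sol_lip lerDl.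
Qed.

Lemma discrete_sol_mesh_lip k (z z' : 'rV[int]_d) :
  `|vk k z - vk k z'| <= sol_lip * \sum_i `|(mesh_pt k z : 'rV[R]_d) ord0 i - mesh_pt k z' ord0 i|.
Proof.
pose r : R := 1 + \sum_i `|(mesh_pt k z : 'rV[R]_d) ord0 i| + \sum_i `|(mesh_pt k z' : 'rV[R]_d) ord0 i|.
have s0 (y : 'rV[R]_d) : 0 <= \sum_i `|y ord0 i| by apply: sumr_ge0.
have sb (y : 'rV[R]_d) i : `|y ord0 i| <= \sum_i `|y ord0 i|.
  by rewrite (bigD1 i) //= lerDl; apply: sumr_ge0.
apply: (@mesh_lip _ _ k (vk k) sol_lip 0 r) => //.
- exact: sol_lip_ge0.
- by move=> y _ j; exact: discrete_sol_lip.
- move=> i; rewrite [X in _ - X]mxE subr0; apply: (le_trans (sb _ _)).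
  by have := s0 (mesh_pt k z'); rewrite /r; lra.
- move=> i; rewrite [X in _ - X]mxE subr0; apply: (le_trans (sb _ _)).
  by have := s0 (mesh_pt k z); rewrite /r; lra.
Qed.

Let LB : R := M + sol_lip.
Let vkB k z : `|vk k z| <= LB.
Proof.
have /andP[h1 h2] := discrete_sol_bound k z; rewrite ger0_norm // /LB.
by apply: (le_trans h2); rewrite lerDl sol_lip_ge0.
Qed.
Let vkL k z j : `|fdiff j (vk k) z| <= LB * mesh k.
Proof.
apply: (le_trans (discrete_sol_lip k j z)); rewrite ler_wpM2r ?(ltW (mesh_gt0 k)) //.
by rewrite /LB lerDr.
Qed.
Let LB0 : 0 <= LB. Proof. by rewrite addr_ge0 // sol_lip_ge0. Qed.

Lemma limit_sol_cvg (x : 'rV[R]_d) : vk k (mesh_floor k x) @[k --> U] --> v x.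
Proof. exact: (@discrete_sol_cvg _ _ l U FU phi M M0 phiM x). Qed.

Lemma limit_sol_lip (x y : 'rV[R]_d) : `|v x - v y| <= LB * \sum_i `|x ord0 i - y ord0 i|.
Proof.
pose r : R := 2 * (1 + \sum_i `|x ord0 i - y ord0 i|).
have s0 : 0 <= \sum_i `|x ord0 i - y ord0 i| by apply: sumr_ge0.
apply: (@ulift_lip _ _ U FU HU vk LB r x) => //.
- by rewrite /r; lra.
- by near=> k => z _.
- by near=> k => z _ j.
- by move=> i; rewrite subrr normr0 /r; lra.
- move=> i; rewrite distrC /r mulrC mulKf //.
  have : `|x ord0 i - y ord0 i| <= \sum_i `|x ord0 i - y ord0 i|.
    by rewrite (bigD1 i) //= lerDl; apply: sumr_ge0.
  by lra.
Unshelve. all: by end_near. Qed.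

Lemma limit_sol_continuous : continuous v.
Proof.
move=> x; apply: (@ulift_continuous _ _ U FU HU vk LB 1 x) => //.
- by near=> k => z _.
- by near=> k => z _ j.
Unshelve. all: by end_near. Qed.

Lemma limit_sol_bound x : 0 <= v x <= M.
Proof.
have c := @limit_sol_cvg x; apply/andP; split.
  apply: (ler_cvg_to (cvg_cst (0 : R)) c); near=> k; by have /andP[] := discrete_sol_bound k (mesh_floor k x).
apply: (ler_cvg_to c (cvg_cst M)); near=> k; by have /andP[] := discrete_sol_bound k (mesh_floor k x).
Unshelve. all: by end_near. Qed.

Lemma mesh_floor_thin k (x : 'rV[R]_d) : x ord0 l = 0 -> mesh_floor k x ord0 l = 0.
Proof. by move=> xl; rewrite mxE xl mul0r floor0. Qed.

Lemma mesh_pt_floor_cvg (x : 'rV[R]_d) : mesh_pt k (mesh_floor k x) @[k --> U] --> x.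
Proof.
move=> A /nbhs_cubeP[e e0 H].
suff N : \forall k \near U, A (mesh_pt k (mesh_floor k x)) by exact: N.
near=> k; apply: H => i.
have ke : (mesh k : R) <= e / 2 by near: k; apply: mesh_near => //; rewrite divr_gt0.
by apply: (le_lt_trans (mesh_floor_close k x i)); apply: (le_lt_trans ke); rewrite ltr_pdivrMr // ltr_pMr // ltr1n.
Unshelve. all: by end_near. Qed.

Lemma limit_sol_ge (x : 'rV[R]_d) : x ord0 l = 0 -> phi x <= v x.
Proof.
move=> xl.
have c1 : phi (mesh_pt k (mesh_floor k x)) @[k --> U] --> phi x.
  have h : (phi \o (fun k => mesh_pt k (mesh_floor k x))) @ U --> phi x.
    apply: cvg_comp; [exact: (@mesh_pt_floor_cvg x)|exact: phi_cont].
  exact: h.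
apply: (ler_cvg_to c1 (@limit_sol_cvg x)).
by near=> k; have [_ _] := discrete_sol_super k; apply; exact: mesh_floor_thin.
Unshelve. all: by end_near. Qed.

(** Rounding down does not commute with the reflection, but the two lattice points differ by at most
    twice the mesh in each coordinate, and the uniform Lipschitz bound makes this harmless in the
    limit. *)
Lemma limit_sol_even (x y : 'rV[R]_d) :
  (forall i, y ord0 i = if i == l then - x ord0 i else x ord0 i) -> v y = v x.
Proof.
move=> yE; apply/eqP; rewrite -subr_eq0 -normr_le0.
have c1 : `|vk k (mesh_floor k y) - vk k (mesh_floor k x)| @[k --> U] --> `|v y - v x|.
  by apply: cvg_norm; apply: cvgB; exact: limit_sol_cvg.
have c2 : sol_lip * (2 * d%:R) * mesh k @[k --> U] --> sol_lip * (2 * d%:R) * 0.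
  by apply: cvgMr; exact: mesh_ucvg0.
rewrite mulr0 in c2; apply: (ler_cvg_to c1 c2); near=> k.
have -> : vk k (mesh_floor k x) = vk k (vert_flip l (mesh_floor k x)).
  by rewrite /discrete_sol (least_supersol_vert_flip M0 (@phikM k)).
apply: (le_trans (discrete_sol_mesh_lip _ _ _)).
rewrite -mulrA ler_wpM2l ?sol_lip_ge0 //.
have -> : 2 * d%:R * mesh k = \sum_(i < d) (2 * mesh k) :> R.
  by rewrite sumr_const card_ord -[RHS]mulr_natl; ring.
apply: ler_sum => i _.
have := mesh_floor_close k y i; have := mesh_floor_close k x i.
have -> : (mesh_pt k (vert_flip l (mesh_floor k x)) : 'rV[R]_d) ord0 i =
  if i == l then - (mesh_pt k (mesh_floor k x) : 'rV[R]_d) ord0 i else (mesh_pt k (mesh_floor k x) : 'rV[R]_d) ord0 i.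
  by rewrite !mxE; case: eqP => // _; rewrite intrN mulrN.
rewrite yE; move: (mesh_pt k (mesh_floor k x) ord0 i : R) (mesh_pt k (mesh_floor k y) ord0 i : R) => a b.
case: eqP => _ h1 h2.
  apply: (dist_trans_le h2 (f := mesh k)); last by lra.
  by rewrite opprK addrC.
by apply: (dist_trans_le h2 (f := mesh k)); [rewrite distrC|lra].
Unshelve. all: by end_near. Qed.


Lemma limit_sol_harm_near (x : 'rV[R]_d) : (x ord0 l != 0) \/ phi x < v x ->
  exists2 r : R, 0 < r & \forall k \near U, forall z, cube k x r z ->
    `|vk k z| <= M + sol_lip /\ dlap (vk k) z = 0.
Proof.
have h0 k := @mesh_gt0 R k.
case=> [xl|px].
  exists (`|x ord0 l| / 2); first by rewrite divr_gt0 // normr_gt0.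
  near=> k => z cz; split; first exact: vkB.
  apply: (least_supersol_harm M0 (@phikM k)); left; apply/eqP => zl.
  have := cz l; rewrite mesh_pt_thin // sub0r normrN.
  by rewrite ler_pdivlMr // ger_pMr ?normr_gt0 // leNgt ltr1n.
(* Of the gap 4 e, one e is spent on the variation of phi, one on the convergence at x and one on
   the variation of [vk]; the last one keeps the discrete inequality strict. *)
pose e := (v x - phi x) / 4.
have e0 : 0 < e by rewrite divr_gt0 // subr_gt0.
have [r1 r10 H1] : exists2 r : R, 0 < r & forall y : 'rV[R]_d,
    (forall i, `|y ord0 i - x ord0 i| <= r) -> phi y <= phi x + e.
  have /(@cvgrPdist_le _ _ _ (nbhs x) _)/(_ e e0) := @phi_cont x.
  move=> /nbhs_cubeP[r r0 H]; exists (r / 2); first by rewrite divr_gt0.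
  move=> y yx; have : `|phi x - phi y| <= e.
    apply: H => i.
    by apply: (le_lt_trans (yx i)); rewrite ltr_pdivrMr // ltr_pMr // ltr1n.
  by rewrite ler_norml => /andP[+ _]; lra.
have D0 : 0 < sol_lip * d%:R + 1 by rewrite ltr_wpDl // mulr_ge0 // sol_lip_ge0.
pose t := e / (sol_lip * d%:R + 1).
have t0 : 0 < t by rewrite divr_gt0.
exists (Order.min r1 (t / 2)); first by rewrite lt_min r10 divr_gt0.
near=> k => z cz; split; first exact: vkB.
apply: (least_supersol_harm M0 (@phikM k)); right.
have kt : (mesh k : R) <= t / 2 by near: k; apply: mesh_near => //; rewrite divr_gt0.
have vx : v x - e <= vk k (mesh_floor k x).
  have : `|v x - vk k (mesh_floor k x)| <= e.
    by near: k; have /cvgrPdist_le/(_ e e0) := @limit_sol_cvg x.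
  by rewrite ler_norml => /andP[_]; lra.
have p1 : phi (mesh_pt k z) <= phi x + e.
  by apply: H1 => i; apply: (le_trans (cz i)); rewrite ge_min lexx.
have l1 : `|vk k (mesh_floor k x) - vk k z| <= e.
  apply: (le_trans (discrete_sol_mesh_lip _ _ _)).
  apply: (@le_trans _ _ (sol_lip * \sum_(i < d) t)).
    rewrite ler_wpM2l ?sol_lip_ge0 //; apply: ler_sum => i _.
    apply: (dist_trans_le (mesh_floor_close k x i) (f := t / 2)); last by lra.
    by rewrite distrC; apply: (le_trans (cz i)); rewrite ge_min lexx orbT.
  rewrite sumr_const card_ord -[t *+ d]mulr_natl mulrA.
  apply: (@le_trans _ _ ((sol_lip * d%:R + 1) * t)); first by rewrite ler_wpM2r ?(ltW t0) // lerDl.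
  by rewrite /t mulrC mulfVK // gt_eqF.
have e4 : v x = phi x + 4 * e by rewrite /e; lra.
rewrite -/(vk k z); move: l1; rewrite ler_norml => /andP[_]; lra.
Unshelve. all: by end_near. Qed.

End LimitSolution.

(** * Second derivatives of ultralimits, and superharmonicity in the viscosity sense *)

Section UltraDerivatives.
Context {R : realType} {d : nat}.
Variable U : set_system nat.
Hypothesis FU : UltraFilter U.
Hypothesis HU : \oo `<=` U.
Let PU : ProperFilter U := ultra_proper.
#[local] Existing Instance PU.
Variable F : nat -> 'rV[int]_d -> R.

Definition ugrad i : 'rV[R]_d -> R := ulift U (fun k z => fdiff i (F k) z / mesh k).
Definition uhess i j : 'rV[R]_d -> R :=
  ulift U (fun k z => fdiff j (fun z => fdiff i (F k) z / mesh k) z / mesh k).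

Lemma fdiff_div i (w : 'rV[int]_d -> R) c :
  fdiff i (fun z => w z / c) = (fun z => fdiff i w z / c).
Proof. by apply/funext => z; rewrite /fdiff mulrBl. Qed.

Lemma mesh_div_le (a C : R) k n : `|a| <= C * mesh k ^+ n.+1 -> `|a / mesh k| <= C * mesh k ^+ n.
Proof.
move=> h; rewrite normrM normfV (gtr0_norm (mesh_gt0 k)) ler_pdivrMr ?mesh_gt0 //.
by rewrite -mulrA -exprSr.
Qed.

(** Derivability at each order consumes bounds on two further differences, and continuity on one, so
    that three orders of bounds give exactly C^2. *)
Lemma ulift_harmonic (x : 'rV[R]_d) M r : 0 <= M -> 0 < r ->
  (\forall k \near U, forall z, cube k x r z -> `|F k z| <= M /\ dlap (F k) z = 0) ->
  (forall i j, [/\ is_derive x (delta_mx ord0 i) (ulift U F) (ugrad i x),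
     {for x, continuous (ugrad i)},
     is_derive x (delta_mx ord0 j) (ugrad i) (uhess i j x) &
     {for x, continuous (uhess i j)}]) /\
  \sum_i uhess i i x = 0.
Proof.
move=> M0 r0 Hh.
have [C [r' [C0 r'0 H]]] := interior_bounds FU HU M0 r0 Hh.
have mpos k : 0 < mesh k :> R by exact: mesh_gt0.
split.
  move=> i j; split.
  - apply: (ulift_is_derive FU HU (C := C) r'0).
    + by apply: filterS H => k hk z cz; have [] := hk z cz i i i.
    + by apply: filterS H => k hk z cz j'; have [] := hk z cz j' i i.
    + by apply: filterS H => k hk z cz; have [] := hk z cz i i i.
  - apply: (ulift_continuous FU HU C0 r'0).
    + apply: filterS H => k hk z cz; rewrite -[leRHS]mulr1 -[1](expr0 (mesh k)).
      by apply: mesh_div_le; have [] := hk z cz i i i.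
    + apply: filterS H => k hk z cz j'; rewrite fdiff_div -[mesh k in leRHS]expr1.
      by apply: mesh_div_le; have [] := hk z cz i j' i.
  - apply: (ulift_is_derive FU HU (C := C) r'0).
    + apply: filterS H => k hk z cz; rewrite -[leRHS]mulr1 -[1](expr0 (mesh k)).
      by apply: mesh_div_le; have [] := hk z cz i i i.
    + apply: filterS H => k hk z cz j'; rewrite fdiff_div -[mesh k in leRHS]expr1.
      by apply: mesh_div_le; have [] := hk z cz i j' i.
    + apply: filterS H => k hk z cz; rewrite !fdiff_div.
      by apply: mesh_div_le; have [] := hk z cz i j j.
  - apply: (ulift_continuous FU HU C0 r'0).
    + apply: filterS H => k hk z cz; rewrite fdiff_div -[leRHS]mulr1 -[1](expr0 (mesh k)).
      by do 2! apply: mesh_div_le; have [] := hk z cz i j j.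
    + apply: filterS H => k hk z cz j'; rewrite !fdiff_div -[mesh k in leRHS]expr1.
      by do 2! apply: mesh_div_le; have [] := hk z cz i j j'.
have cH i : fdiff i (fun z => fdiff i (F k) z / mesh k) (mesh_floor k x) / mesh k @[k --> U] --> uhess i i x.
  apply: (@ulim_cvg _ _ FU _ C); near=> k.
  rewrite fdiff_div -[leRHS]mulr1 -[1](expr0 (mesh k)).
  do 2! apply: mesh_div_le.
  have cz : cube k x r' (mesh_floor k x).
    by apply: mesh_floor_cube => [|j]; [near: k; apply: mesh_near => //; rewrite divr_gt0|
      rewrite subrr normr0 divr_ge0 // ltW].
  have hk : forall z, cube k x r' z -> `|fdiff i (fdiff i (F k)) z| <= C * mesh k ^+ 2.
    by near: k; apply: filterS H => k hk z cz; have [] := hk z cz i i i.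
  exact: hk.
have cS : \sum_i fdiff i (fun z => fdiff i (F k) z / mesh k) (mesh_floor k x) / mesh k @[k --> U] -->
     \sum_i uhess i i x.
  by apply: cvg_big => //; exact: add_continuous.
apply/eqP; rewrite -normr_le0.
have c2 : d%:R * C * mesh k @[k --> U] --> d%:R * C * 0.
  by apply: cvgMr; exact: mesh_ucvg0.
rewrite mulr0 in c2; apply: (ler_cvg_to (cvg_norm cS) c2); near=> k.
have hk : forall z, cube k x r' z -> forall i, `|fdiff i (fdiff i (fdiff i (F k))) z| <= C * mesh k ^+ 3.
  by near: k; apply: filterS H => k hk z cz i; have [] := hk z cz i i i.
have hl : forall z, cube k x r z -> dlap (F k) z = 0.
  by near: k; apply: filterS Hh => k hk z cz; have [] := hk z cz.
have kr : mesh k <= r / 2 by near: k; apply: mesh_near => //; rewrite divr_gt0.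
have kr' : mesh k <= r' / 2 by near: k; apply: mesh_near => //; rewrite divr_gt0.
have kx (t : R) : mesh k <= t / 2 -> 0 < t -> cube k x t (mesh_floor k x).
  by move=> kt t0; apply: mesh_floor_cube => // j; rewrite subrr normr0 divr_ge0 // ltW.
set z := mesh_floor k x.
have cub i : cube k x r' (z - unit_vec i).
  move=> j; have := mesh_floor_close k x j; rewrite -/z -(scaleN1r (unit_vec i)) mesh_ptD.
  rewrite [in X in _ -> X]mxE intrN mulr1z mulrN1 => zx.
  apply: (dist_trans_le _ zx (e := mesh k)); last by lra.
  rewrite addrAC subrr add0r !mxE eqxx /= normrM normrN (gtr0_norm (mpos k)).
  by rewrite ler_piMr ?(ltW (mpos k)) // normr_nat; case: (j == i).
(* The forward second difference is the centred one plus a third difference. The centred ones sum to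
   zero, and a third difference over the squared mesh is of the order of the mesh. *)
have E i : fdiff i (fun z => fdiff i (F k) z / mesh k) z / mesh k =
   (fdiff i (fdiff i (fdiff i (F k))) (z - unit_vec i) + diff2 i (F k) z) / mesh k / mesh k.
  rewrite fdiff_div; congr (_ / _ / _).
  by rewrite /fdiff /diff2 !subrK; ring.
rewrite (eq_bigr _ (fun i _ => E i)) -!mulr_suml big_split /= -/(dlap (F k) z).
rewrite (hl z) ?addr0; last exact: kx.
rewrite -[mesh k in leRHS]expr1.
do 2! apply: mesh_div_le.
apply: (le_trans (ler_norm_sum _ _ _)).
have -> : d%:R * C * mesh k ^+ 3 = \sum_(i < d) (C * mesh k ^+ 3).
  by rewrite sumr_const card_ord -mulrA mulr_natl.
by apply: ler_sum => i _; apply: hk.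
Unshelve. all: by end_near. Qed.

Section Touching.
Variable B : R.
Hypothesis B0 : 0 <= B.
Hypothesis FB : forall k z, `|F k z| <= B.
Hypothesis FL : forall k z z',
  `|F k z - F k z'| <= B * \sum_i `|(mesh_pt k z : 'rV[R]_d) ord0 i - mesh_pt k z' ord0 i|.
Hypothesis Fsuper : forall k z, dlap (F k) z <= 0.
Hypothesis vL : forall x y : 'rV[R]_d,
  `|ulift U F x - ulift U F y| <= B * \sum_i `|x ord0 i - y ord0 i|.

(* A subsolution cannot touch the limit of discrete supersolutions strictly
   from below: a minimum point of the discrete difference converges to [x]
   along the ultrafilter. *)
Lemma no_strict_touching (x : 'rV[R]_d) (f : 'rV[R]_d -> R) r eta : 0 < r -> 0 < eta ->
  f x = ulift U F x -> {for x, continuous f} ->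
  (forall y : 'rV[R]_d, (forall i, `|y ord0 i - x ord0 i| <= r) ->
     f y + eta * \sum_i (y ord0 i - x ord0 i) ^+ 2 <= ulift U F y) ->
  (forall (y : 'rV[R]_d) h, (forall i, `|y ord0 i - x ord0 i| <= r / 2) -> 0 < h <= r / 2 ->
     0 < \sum_i (f (y + h *: delta_mx ord0 i) + f (y - h *: delta_mx ord0 i) - 2 * f y)) ->
  False.
Proof.
move=> r0 eta0 fx fc fle fsub.
have mpos k : 0 < mesh k :> R by exact: mesh_gt0.
(* The smallness of the mesh is a premise inside the existential, so that [choice] yields a total
   sequence of minimum points. *)
have zsP k : exists z, mesh k <= r / 2 :> R -> cube k x r z /\
   forall z', cube k x r z' -> F k z - f (mesh_pt k z) <= F k z' - f (mesh_pt k z').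
  have [kr|kr] := leP (mesh k) (r / 2); last by exists 0.
  have cx : cube k x r (mesh_floor k x).
    by apply: mesh_floor_cube => // j; rewrite subrr normr0 divr_ge0 // ltW.
  have [|z cz zmin] := @box_argmax _ _ [set z | cube k x r z] (mesh_floor k x)
      (absz (Num.floor (2 * r * k.+1%:R))) (fun z => - (F k z - f (mesh_pt k z))) (ex_intro _ _ cx).
    move=> z cz i; rewrite gez0_abs; last by rewrite floor_ge0 !mulr_ge0 // ltW.
    rewrite floor_ge_int intr_norm -(ler_pM2l (mpos k)) mulrCA meshV mulr1.
    rewrite -{1}(gtr0_norm (mpos k)) -normrM intrB mulrBr.
    have := cz i; have := mesh_floor_close k x i; rewrite distrC.
    rewrite !mxE => h1 h2.
    by apply: (dist_trans_le h2 h1); have := kr; have := r0; lra.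
  exists z => _; split=> // z' cz'; have := zmin z' cz'; rewrite lerN2; exact.
have [zs zsE] := choice zsP.
pose y : 'rV[R]_d := \row_i ulim U (fun k => (mesh_pt k (zs k) : 'rV[R]_d) ord0 i).
have nr : \forall k \near U, mesh k <= r / 2 :> R by apply: mesh_near => //; rewrite divr_gt0.
have cy i : (mesh_pt k (zs k) : 'rV[R]_d) ord0 i @[k --> U] --> y ord0 i.
  rewrite [X in _ --> X]mxE; apply: (@ulim_cvg _ _ FU _ (r + `|x ord0 i|)); near=> k.
  have [cz _] : cube k x r (zs k) /\ forall z', cube k x r z' -> F k (zs k) - f (mesh_pt k (zs k)) <= F k z' - f (mesh_pt k z').
    by apply: zsE; near: k.
  rewrite -[X in `|X|](subrK (x ord0 i)); apply: (le_trans (ler_normD _ _)).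
  by rewrite lerD2r; exact: cz.
have cx i : (mesh_pt k (mesh_floor k x) : 'rV[R]_d) ord0 i @[k --> U] --> x ord0 i.
  apply/cvgrPdist_le => e e0; near=> k; rewrite distrC.
  by apply: (le_trans (mesh_floor_close k x i)); near: k; exact: mesh_near.
have cxx : f (mesh_pt k (mesh_floor k x)) @[k --> U] --> f x.
  have h : (f \o (fun k => mesh_pt k (mesh_floor k x))) @ U --> f x.
    apply: cvg_comp; last exact: fc.
    move=> A /nbhs_cubeP[e e0 H].
    suff N : \forall k \near U, A (mesh_pt k (mesh_floor k x)) by exact: N.
    near=> k; apply: H => i.
    have ke : (mesh k : R) <= e / 2 by near: k; apply: mesh_near => //; rewrite divr_gt0.
    by apply: (le_lt_trans (mesh_floor_close k x i)); apply: (le_lt_trans ke); rewrite ltr_pdivrMr // ltr_pMr // ltr1n.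
  exact: h.
have cvx (t : 'rV[R]_d) : F k (mesh_floor k t) @[k --> U] --> ulift U F t.
  by apply: (@ulim_cvg _ _ FU _ B); near=> k; exact: FB.
have cry i : (mesh_pt k (mesh_floor k y) : 'rV[R]_d) ord0 i @[k --> U] --> y ord0 i.
  apply/cvgrPdist_le => e e0; near=> k; rewrite distrC.
  by apply: (le_trans (mesh_floor_close k y i)); near: k; exact: mesh_near.
(* By minimality against the rounding of x, the quantity eta |zs k - x|^2 is at most the value of F
   k - f at that rounding, up to vanishing errors; that value tends to zero since f touches the
   limit at x. *)
have yx : y = x.
  have lhs : eta * \sum_i ((mesh_pt k (zs k) : 'rV[R]_d) ord0 i - x ord0 i) ^+ 2 @[k --> U] -->
     eta * \sum_i (y ord0 i - x ord0 i) ^+ 2.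
    apply: cvgMr; apply: cvg_big => //; first exact: add_continuous.
    move=> i _; rewrite expr2; under eq_fun do rewrite expr2.
    by apply: cvgM; (apply: cvgB; [exact: cy|exact: cvg_cst]).
  have rhs : F k (mesh_floor k x) - f (mesh_pt k (mesh_floor k x)) +
     (B * \sum_i `|(mesh_pt k (zs k) : 'rV[R]_d) ord0 i - mesh_pt k (mesh_floor k y) ord0 i| +
      `|F k (mesh_floor k y) - ulift U F y| + B * \sum_i `|y ord0 i - (mesh_pt k (zs k) : 'rV[R]_d) ord0 i|) @[k --> U] -->
     ulift U F x - f x + (B * \sum_i `|y ord0 i - y ord0 i| + `|ulift U F y - ulift U F y| +
       B * \sum_i `|y ord0 i - y ord0 i|).
    apply: cvgD; first by apply: cvgB => //; exact: cvx.
    apply: cvgD; [apply: cvgD|].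
    - apply: cvgMr; apply: cvg_big => //; first exact: add_continuous.
      by move=> i _; apply: cvg_norm; apply: cvgB.
    - by apply: cvg_norm; apply: cvgB; [exact: cvx|exact: cvg_cst].
    - apply: cvgMr; apply: cvg_big => //; first exact: add_continuous.
      by move=> i _; apply: cvg_norm; apply: cvgB; [exact: cvg_cst|exact: cy].
  have s0 : \sum_i `|y ord0 i - y ord0 i| = 0 by apply: big1 => i _; rewrite subrr normr0.
  rewrite s0 !subrr normr0 mulr0 !addr0 fx subrr in rhs.
  have le0 : eta * \sum_i (y ord0 i - x ord0 i) ^+ 2 <= 0.
    apply: (ler_cvg_to lhs rhs); near=> k.
    have kr : mesh k <= r / 2 by near: k.
    have [cz zmin] := zsE k kr.
    have cxk : cube k x r (mesh_floor k x).
      by apply: mesh_floor_cube => // j; rewrite subrr normr0 divr_ge0 // ltW.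
    have m1 := zmin _ cxk; have m2 := fle _ cz.
    have l1 := FL k (zs k) (mesh_floor k y); have l2 := vL y (mesh_pt k (zs k)).
    have l3 : ulift U F y - F k (mesh_floor k y) <= `|F k (mesh_floor k y) - ulift U F y|.
      by rewrite distrC ler_norm.
    move: l1 l2; rewrite !ler_norml => /andP[l1 _] /andP[l2 _]; lra.
  have sum0 : \sum_i (y ord0 i - x ord0 i) ^+ 2 = 0.
    apply/eqP; rewrite eq_le -(pmulr_rle0 _ eta0) le0 /=.
    by apply: sumr_ge0 => i _; exact: sqr_ge0.
  apply/rowP => i; apply/eqP; rewrite -subr_eq0 -sqrf_eq0.
  move/eqP: sum0; rewrite psumr_eq0 => [/allP/(_ i)|j _]; last exact: sqr_ge0.
  by rewrite mem_index_enum => /(_ isT) /implyP/(_ isT).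
have near2 : \forall k \near U, forall i, `|(mesh_pt k (zs k) : 'rV[R]_d) ord0 i - x ord0 i| <= r / 2.
  apply: filter_forall => i; have /cvgrPdist_le := cy i; rewrite yx.
  by move=> /(_ (r / 2)); rewrite divr_gt0 // => /(_ isT); apply: filterS => k; rewrite distrC.
(* The minimum point is now in the inner half cube, so all its neighbours compete: the discrete
   Laplacian of F k is there at least the positive sum of second differences of f. *)
suff : \forall k \near U, False by move=> /filter_ex [].
near=> k.
have kr : mesh k <= r / 2 by near: k.
have zx : forall i, `|(mesh_pt k (zs k) : 'rV[R]_d) ord0 i - x ord0 i| <= r / 2 by near: k.
have [cz zmin] := zsE k kr.
have := fsub (mesh_pt k (zs k)) (mesh k) zx; rewrite mpos kr => /(_ isT).
apply/negP; rewrite -leNgt; apply: le_trans (Fsuper k (zs k)).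
apply: ler_sum => i _.
have nb (s : int) : `|s%:~R| <= 1 :> R -> cube k x r (zs k + s *: unit_vec i).
  move=> s1 j; have := zx j; rewrite mesh_ptD [in X in _ -> X]mxE => zj.
  apply: (dist_trans_le _ zj (e := mesh k)); last by lra.
  rewrite addrAC subrr add0r !mxE eqxx /= !normrM (gtr0_norm (mpos k)) -mulrA.
  by rewrite ler_piMr ?(ltW (mpos k)) // mulr_ile1 ?normr_nat //; case: (j == i).
have := zmin _ (nb 1 _); have := zmin _ (nb (-1) _).
rewrite intrN mulr1z normrN normr1 => /(_ (lexx _)) h1 /(_ (lexx _)).
move: h1; rewrite !mesh_ptD intrN mulr1z mulr1 mulrN1 !scaleNr !scale1r /diff2.
lra.
Unshelve. all: by end_near. Qed.

End Touching.
End UltraDerivatives.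

(** * Polynomial functions and harmonic extensions *)

Section PolyFun.
Context {R : realType} {d : nat}.
Local Notation V := 'rV[R]_d.
Implicit Types (f g : V -> R) (x y : V).

(** A predicate on functions: derivatives, continuity, growth and local expansions are each obtained
    by induction on it. *)
Inductive polyfun : (V -> R) -> Prop :=
| polyfun_cst c : polyfun (fun=> c)
| polyfun_coord i : polyfun (fun x => x ord0 i)
| polyfunD f g : polyfun f -> polyfun g -> polyfun (fun x => f x + g x)
| polyfunM f g : polyfun f -> polyfun g -> polyfun (fun x => f x * g x).

Lemma is_derive_coord x (v : V) i : is_derive x v (fun x => x ord0 i) (v ord0 i).
Proof.
apply: (@is_derive_quadratic _ _ _ _ _ _ 0 1) => // s _.
by rewrite mul0r !mxE addrK subrr normr0.
Qed.

Lemma is_derive_add x (v : V) f g df dg : is_derive x v f df -> is_derive x v g dg ->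
  is_derive x v (fun x => f x + g x) (df + dg).
Proof. exact: is_deriveD. Qed.

Lemma is_derive_mul x (v : V) f g df dg : is_derive x v f df -> is_derive x v g dg ->
  is_derive x v (fun x => f x * g x) (f x * dg + g x * df).
Proof. exact: is_deriveM. Qed.

Lemma polyfun_is_derive f : polyfun f -> forall i,
  exists2 g, polyfun g & forall x, is_derive x (delta_mx ord0 i) f (g x).
Proof.
elim=> [c|j|{}f g pf IHf pg IHg|{}f g pf IHf pg IHg] i.
- exists (fun=> 0); first exact: polyfun_cst.
  by move=> x; exact: is_derive_cst.
- exists (fun=> (j == i)%:R); first exact: polyfun_cst.
  by move=> x; have := is_derive_coord x (delta_mx ord0 i) j; rewrite mxE eqxx.
- have [f' pf' ff'] := IHf i; have [g' pg' gg'] := IHg i.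
  exists (fun x => f' x + g' x); first exact: polyfunD.
  by move=> x; exact: is_derive_add.
- have [f' pf' ff'] := IHf i; have [g' pg' gg'] := IHg i.
  exists (fun x => f x * g' x + g x * f' x); first by apply: polyfunD; exact: polyfunM.
  by move=> x; exact: is_derive_mul.
Qed.

Lemma rV_coord_continuous (i : 'I_d) : continuous (fun x : V => x ord0 i).
Proof. exact: coord_continuous. Qed.

Lemma polyfun_continuous f : polyfun f -> continuous f.
Proof.
elim=> [c|j|{}f g pf IHf pg IHg|{}f g pf IHf pg IHg] x.
- exact: cst_continuous.
- exact: rV_coord_continuous.
- exact: (cvgD (IHf x) (IHg x)).
- exact: (cvgM (IHf x) (IHg x)).
Qed.

Lemma partial_eq f g i : (forall x, is_derive x (delta_mx ord0 i) f (g x)) -> partial i f = g.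
Proof. by move=> h; apply/funext => x; rewrite /partial derive_val. Qed.

Lemma polyfun_C2 f : polyfun f -> C2_on setT f.
Proof.
move=> pf x _ i j.
have [g pg fg] := polyfun_is_derive pf i; have [h ph gh] := polyfun_is_derive pg j.
have Ei := partial_eq fg; have Ej := partial_eq gh; rewrite Ei Ej; split.
- exact: (@ex_derive _ _ _ _ _ _ _ (fg x)).
- by have := polyfun_continuous pg; apply.
- exact: (@ex_derive _ _ _ _ _ _ _ (gh x)).
- by have := polyfun_continuous ph; apply.
Qed.

Lemma polyfunX f m : polyfun f -> polyfun (fun x => f x ^+ m).
Proof.
move=> pf; elim: m => [|m IH]; first exact: (polyfun_cst 1).
rewrite (_ : (fun _ => _) = (fun x => f x * f x ^+ m)); first exact: polyfunM.
by apply/funext => x; rewrite exprS.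
Qed.

Lemma polyfun_sum (I : Type) (r : seq I) (P : pred I) (F : I -> V -> R) :
  (forall i, P i -> polyfun (F i)) -> polyfun (fun x => \sum_(i <- r | P i) F i x).
Proof.
move=> H; elim: r => [|i r IH].
  rewrite (_ : (fun _ => _) = (fun=> 0)); first exact: polyfun_cst.
  by apply/funext => x; rewrite big_nil.
have [Pi|nPi] := boolP (P i).
  rewrite (_ : (fun _ => _) = (fun x => F i x + \sum_(i <- r | P i) F i x)).
    by apply: polyfunD => //; exact: H.
  by apply/funext => x; rewrite big_cons Pi.
rewrite (_ : (fun _ => _) = (fun x => \sum_(i <- r | P i) F i x)) //.
by apply/funext => x; rewrite big_cons (negbTE nPi).
Qed.

Lemma polyfun_horner (p : {poly R}) f : polyfun f -> polyfun (fun x => p.[f x]).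
Proof.
move=> pf; rewrite (_ : (fun _ => _) = (fun x => \sum_(i < size p) p`_i * f x ^+ i)).
  apply: polyfun_sum => i _; apply: polyfunM; first exact: polyfun_cst.
  exact: polyfunX.
by apply/funext => x; rewrite horner_coef.
Qed.

Lemma polyfun_thin_sqdist l y : polyfun (fun x => thin_sqdist l x y).
Proof.
apply: polyfun_sum => i _; apply: polyfunX; apply: polyfunD; first exact: polyfun_coord.
exact: polyfun_cst.
Qed.

Lemma coord_le_enorm x i : `|x ord0 i| <= enorm x.
Proof.
rewrite -sqrtr_sqr /enorm ler_sqrt; last by apply: sumr_ge0 => j _; exact: sqr_ge0.
by rewrite (bigD1 i) //= lerDl; apply: sumr_ge0 => j _; exact: sqr_ge0.
Qed.

Lemma polyfun_growth f : polyfun f ->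
  exists m C, 0 <= C /\ forall x, `|f x| <= C * (1 + enorm x) ^+ m.
Proof.
have e0 x : 0 <= enorm x by exact: sqrtr_ge0.
have e1 x m : 1 <= (1 + enorm x) ^+ m by rewrite exprn_ege1 // lerDl.
elim=> [c|j|{}f g pf [m [C [C0 IHf]]] pg [k [D [D0 IHg]]]|{}f g pf [m [C [C0 IHf]]] pg [k [D [D0 IHg]]]].
- by exists 0%N, `|c|; split=> // x; rewrite expr0 mulr1.
- exists 1%N, 1; split=> // x; rewrite expr1 mul1r.
  by apply: (le_trans (coord_le_enorm x j)); rewrite lerDr.
- exists (m + k)%N, (C + D); split; first exact: addr_ge0.
  move=> x; apply: (le_trans (ler_normD _ _)); rewrite mulrDl; apply: lerD.
    by apply: (le_trans (IHf x)); rewrite ler_wpM2l // exprD ler_peMr // exprn_ge0 ?addr_ge0.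
  by apply: (le_trans (IHg x)); rewrite ler_wpM2l // exprD ler_peMl // exprn_ge0 ?addr_ge0.
- exists (m + k)%N, (C * D); split; first exact: mulr_ge0.
  by move=> x; rewrite normrM exprD mulrACA; exact: ler_pM.
Qed.

Lemma polyfun_growth_poly f g (M : R) : polyfun f -> (forall x, `|g x| <= M) ->
  polynomial_growth (fun x => f x + g x).
Proof.
move=> pf gM; have [m [C [C0 H]]] := polyfun_growth pf.
exists m; apply: (@le_lt_trans _ _ ((C * 2 ^+ m + `|M|)%:E)); last by rewrite ltry.
apply: ub_ereal_sup => _ [x _ <-]; rewrite lee_fin.
have e0 : 0 <= enorm x by exact: sqrtr_ge0.
have em : 0 <= enorm x ^+ m by rewrite exprn_ge0.
have p : 0 < 1 + enorm x ^+ m by rewrite ltr_pwDl.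
rewrite normrM normfV (gtr0_norm p) ler_pdivrMr //.
apply: (le_trans (ler_normD _ _)); rewrite mulrDl; apply: lerD.
  apply: (le_trans (H x)); rewrite -mulrA ler_wpM2l //.
  have [e1|e1] := leP (enorm x) 1.
    apply: (@le_trans _ _ (2 ^+ m)); first by rewrite lerXn2r ?nnegrE ?addr_ge0 //; lra.
    by rewrite ler_peMr ?exprn_ge0 // lerDl.
  apply: (@le_trans _ _ ((2 * enorm x) ^+ m)).
    by rewrite lerXn2r ?nnegrE ?addr_ge0 ?mulr_ge0 //; lra.
  by rewrite exprMn ler_wpM2l ?exprn_ge0 // lerDr.
apply: (le_trans (gM x)); apply: (le_trans (ler_norm _)).
by rewrite ler_peMr // lerDl.
Qed.

(** A second order expansion with constants uniform on a cube. Applied to phi on the cube that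
    contains the thin points where phi >= 0, it yields the Lipschitz and semiconvexity bounds. The
    values are bounded along with the coefficients so that the induction passes through products. *)
Lemma polyfun_local f : polyfun f -> forall B : R, exists C, 0 <= C /\
  forall x i, (forall j, `|x ord0 j| <= B) -> `|f x| <= C /\ exists a, `|a| <= C /\
  forall s, `|s| <= 1 ->
  exists b, [/\ f (x + s *: delta_mx ord0 i) = f x + s * a + s ^+ 2 * b & `|b| <= C].
Proof.
elim=> [c|j|{}f g pf IHf pg IHg|{}f g pf IHf pg IHg] B.
- exists `|c|; split=> // x i _; split=> //; exists 0; rewrite normr0; split=> // s _.
  by exists 0; rewrite normr0 !mulr0 !addr0.
- exists (`|B| + 1); split; first by rewrite addr_ge0.
  move=> x i xB; split.
    by apply: (le_trans (xB j)); apply: (le_trans (ler_norm _)); rewrite lerDl.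
  exists (j == i)%:R; split.
    by rewrite normr_nat; apply: (@le_trans _ _ 1); [case: (j == i)|rewrite lerDr].
  by move=> s _; exists 0; rewrite normr0 addr_ge0 // !mxE eqxx mulr0 addr0.
- have [C [C0 H1]] := IHf B; have [D [D0 H2]] := IHg B; exists (C + D); split; first exact: addr_ge0.
  move=> x i xB; have [f0 [a [a0 fa]]] := H1 x i xB; have [g0 [a' [a'0 ga]]] := H2 x i xB.
  split; first by apply: (le_trans (ler_normD _ _)); exact: lerD.
  exists (a + a'); split; first by apply: (le_trans (ler_normD _ _)); exact: lerD.
  move=> s s1; have [b [fb b0]] := fa s s1; have [b' [gb b'0]] := ga s s1.
  exists (b + b'); split; first by rewrite fb gb; ring.
  by apply: (le_trans (ler_normD _ _)); exact: lerD.
- have [C [C0 H1]] := IHf B; have [D [D0 H2]] := IHg B; exists (9 * (C * D)).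
  have CD : 0 <= C * D by exact: mulr_ge0.
  split; first by rewrite mulr_ge0.
  move=> x i xB; have [f0 [a [a0 fa]]] := H1 x i xB; have [g0 [a' [a'0 ga]]] := H2 x i xB.
  have pr (u w : R) : `|u| <= C -> `|w| <= D -> `|u * w| <= C * D.
    by move=> h1 h2; rewrite normrM; exact: ler_pM.
  split; first by apply: (le_trans (pr _ _ f0 g0)); lra.
  exists (a * g x + f x * a'); split.
    by apply: (le_trans (ler_normD _ _)); have := pr _ _ a0 g0; have := pr _ _ f0 a'0; lra.
  move=> s s1; have [b [fb b0]] := fa s s1; have [b' [gb b'0]] := ga s s1.
  exists (f x * b' + b * g x + a * a' + s * (a * b' + b * a') + s ^+ 2 * (b * b')).
  split; first by rewrite fb gb; ring.
  have ss : `|s ^+ 2| <= 1 by rewrite normrX expr_le1.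
  have sm (t u : R) : `|t| <= 1 -> `|t * u| <= `|u|.
    by move=> t1; rewrite normrM ler_piMl.
  have q1 := pr _ _ f0 b'0; have q2 := pr _ _ b0 g0; have q3 := pr _ _ a0 a'0.
  have q4 := pr _ _ a0 b'0; have q5 := pr _ _ b0 a'0; have q6 := pr _ _ b0 b'0.
  have r1 := le_trans (sm _ _ s1) (le_trans (ler_normD _ _) (lerD q4 q5)).
  have r2 := le_trans (sm _ _ ss) q6.
  apply: (le_trans (ler_normD _ _)).
  have := le_trans (ler_normD _ _) (lerD (le_trans (ler_normD _ _) (lerD (le_trans (ler_normD _ _) (lerD q1 q2)) q3)) r1).
  move=> r3; apply: (le_trans (lerD r3 r2)); lra.
Qed.

End PolyFun.

(** * Even harmonic extension of a polynomial in the squared distance to a thin point *)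

Section HarmonicExtension.
Context {R : realType} {d : nat}.
Variable l : 'I_d.
Local Notation V := 'rV[R]_d.
Implicit Types (f g : V -> R) (x y : V) (p q : {poly R}) (i : 'I_d).

Lemma is_derive_bigsum (n : nat) (h : 'I_n -> V -> R) (dh : 'I_n -> R) x (v : V) :
  (forall j, is_derive x v (h j) (dh j)) ->
  is_derive x v (fun x => \sum_(j < n) h j x) (\sum_(j < n) dh j).
Proof.
move=> H; rewrite (_ : (fun x => _) = \sum_(j < n) h j); first exact: is_derive_sum.
by apply/funext => y; rewrite fct_sumE.
Qed.

Lemma is_derive_bigseq (I : Type) (r : seq I) (h : I -> V -> R) (dh : I -> R) x (v : V) :
  (forall j, is_derive x v (h j) (dh j)) ->
  is_derive x v (fun x => \sum_(j <- r) h j x) (\sum_(j <- r) dh j).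
Proof.
move=> H; elim: r => [|j r IH].
  rewrite big_nil (_ : (fun x => _) = (fun=> 0)); first exact: is_derive_cst.
  by apply/funext => y; rewrite big_nil.
rewrite big_cons (_ : (fun x => _) = (fun x => h j x + \sum_(j <- r) h j x)).
  exact: is_derive_add.
by apply/funext => y; rewrite big_cons.
Qed.

Lemma is_derive_scale x (v : V) (c : R) f df : is_derive x v f df ->
  is_derive x v (fun x => c * f x) (c * df).
Proof.
move=> H; have := is_derive_mul (is_derive_cst c x v) H.
by rewrite mulr0 addr0.
Qed.

Lemma is_derive_sqdist x y i :
  is_derive x (delta_mx ord0 i) (fun x => thin_sqdist l x y)
    (if i == l then 0 else 2 * (x ord0 i - y ord0 i)).
Proof.
apply: (@is_derive_quadratic _ _ _ _ _ _ 1 1) => // s _; rewrite mul1r /thin_sqdist.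
case: (eqVneq i l) => [il|il].
  rewrite mulr0 subr0 (eq_bigr (fun j => (x ord0 j - y ord0 j) ^+ 2)).
    by rewrite subrr normr0 sqr_ge0.
  by move=> j jl; rewrite !mxE eqxx /= il (negbTE jl) mulr0 add0r.
rewrite (bigD1 i) //= [X in _ - X - _](bigD1 i) //= !mxE !eqxx mulr1.
rewrite (eq_bigr (fun j => (x ord0 j - y ord0 j) ^+ 2)).
  set S := \sum_(_ | _) _; rewrite le_eqVlt; apply/orP; left; apply/eqP.
  rewrite -[RHS]ger0_norm ?sqr_ge0 //; congr (`|_|); ring.
by move=> j /andP[_ ji]; rewrite !mxE (negbTE ji) andbF mulr0 add0r.
Qed.

Lemma is_derive_horner_comp p f x (v : V) df : is_derive x v f df ->
  is_derive x v (fun x => p.[f x]) (p^`().[f x] * df).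
Proof.
move=> H; elim/poly_ind: p => [|p c IH].
  rewrite deriv0 horner0 mul0r (_ : (fun x => _) = (fun=> 0)); first exact: is_derive_cst.
  by apply/funext => y; rewrite horner0.
rewrite (_ : (fun x => _) = (fun x => p.[f x] * f x + c)); last first.
  by apply/funext => y; rewrite hornerMXaddC.
have := is_derive_add (is_derive_mul IH H) (is_derive_cst c x v).
suff -> : (p * 'X + c%:P)^`().[f x] * df = p.[f x] * df + f x * (p^`().[f x] * df) + 0 by [].
rewrite derivD derivC addr0 derivM derivX mulr1 hornerD hornerM hornerX; ring.
Qed.

Lemma is_derive_coordX x i j (m : nat) :
  is_derive x (delta_mx ord0 i) (fun x => x ord0 j ^+ m)
    (if j == i then m%:R * x ord0 j ^+ m.-1 else 0).
Proof.
have := is_derive_horner_comp 'X^m (is_derive_coord x (delta_mx ord0 i) j).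
rewrite mxE eqxx /= derivXn hornerMn hornerXn.
have -> : (fun x : V => 'X^m.[x ord0 j]) = (fun x => x ord0 j ^+ m).
  by apply/funext => y; rewrite hornerXn.
by case: eqP => _; rewrite ?mulr1 ?mulr0 // mulr_natl.
Qed.

(* The Laplacian in the d - 1 thin variables of a polynomial in |x'|^2. *)
Definition radlap q : {poly R} := 4%:P * 'X * q^`()^`() + (2 * d.-1%:R)%:P * q^`().

Lemma size_radlap q : (size (radlap q) <= (size q).-1)%N.
Proof.
have s1 := lt_size_deriv.
have h1 : (size q^`() <= (size q).-1)%N.
  case: (eqVneq q 0) => [->|q0]; first by rewrite deriv0 size_poly0.
  by have := lt_size_deriv q0; case: (size q).
apply: (leq_trans (size_polyD _ _)); rewrite geq_max; apply/andP; split; last first.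
  by rewrite mul_polyC; apply: (leq_trans (size_scale_leq _ _)).
rewrite -mulrA mul_polyC; apply: (leq_trans (size_scale_leq _ _)).
case: (eqVneq q^`()^`() 0) => [->|q2]; first by rewrite mulr0 size_poly0.
rewrite mulrC size_mulX //.
case: (eqVneq q^`() 0) => [q1|q1]; first by rewrite q1 deriv0 eqxx in q2.
by apply: leq_trans h1; exact: lt_size_deriv.
Qed.

Lemma iter_radlap0 q : iter (size q) radlap q = 0.
Proof.
have H m : (size (iter m radlap q) <= size q - m)%N.
  elim: m => [|m IH]; first by rewrite subn0.
  rewrite iterS; apply: (leq_trans (size_radlap _)); rewrite subnS.
  by move: IH; case: (size (iter m radlap q)) => // k; case: (size q - m)%N.
by apply/eqP; rewrite -size_poly_eq0 -leqn0; apply: (leq_trans (H _)); rewrite subnn.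
Qed.

Definition ext_coef (j : nat) : R := (-1) ^+ j / (2 * j)`!%:R.

(** The series of cos (t sqrt D) q, with t = x_l and D the thin Laplacian: the even solution of the
    Cauchy problem for the Laplace equation with data q at t = 0. The sum is finite because [radlap]
    lowers the degree. *)
Definition radext q y x : R := \sum_(j < size q)
  ext_coef j * (x ord0 l ^+ (2 * j) * (iter j radlap q).[thin_sqdist l x y]).

(** At j = 0 the predecessor in the exponent is truncated, but the factor [(2 * j)%:R] vanishes; the
    same holds for the second derivatives. *)
Definition radext1 q y i x : R := \sum_(j < size q) ext_coef j *
  (if i == l then (2 * j)%:R * x ord0 l ^+ (2 * j).-1 * (iter j radlap q).[thin_sqdist l x y]
   else x ord0 l ^+ (2 * j) * ((iter j radlap q)^`().[thin_sqdist l x y] * (2 * (x ord0 i - y ord0 i)))).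

Definition radext2 q y i x : R := \sum_(j < size q) ext_coef j *
  (if i == l then (2 * j)%:R * ((2 * j).-1%:R * x ord0 l ^+ (2 * j).-2) * (iter j radlap q).[thin_sqdist l x y]
   else x ord0 l ^+ (2 * j) *
     ((iter j radlap q)^`()^`().[thin_sqdist l x y] * (4 * (x ord0 i - y ord0 i) ^+ 2)
      + 2 * (iter j radlap q)^`().[thin_sqdist l x y])).

Lemma polyfun_radext q y : polyfun (radext q y).
Proof.
apply: polyfun_sum => j _; apply: polyfunM; first exact: polyfun_cst.
apply: polyfunM; first by apply: polyfunX; exact: polyfun_coord.
by apply: polyfun_horner; exact: polyfun_thin_sqdist.
Qed.

Lemma radext_thin q y x : x ord0 l = 0 -> radext q y x = q.[thin_sqdist l x y].
Proof.
move=> xl; rewrite /radext; case E : (size q) => [|m].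
  by rewrite big_ord0; move/eqP: E; rewrite size_poly_eq0 => /eqP ->; rewrite horner0.
rewrite big_ord_recl big1 => [|j _]; last first.
  by rewrite xl lift0 mulnS exprD expr2 !mul0r mulr0.
by rewrite /ext_coef muln0 fact0 !expr0 !(mul1r, divr1, invr1) addr0.
Qed.

Lemma radext_even q y x x' : x' ord0 l = - x ord0 l ->
  (forall i, i != l -> x' ord0 i = x ord0 i) -> radext q y x' = radext q y x.
Proof.
move=> xl xi; apply: eq_bigr => j _; rewrite xl exprM sqrrN -exprM; congr (_ * (_ * _.[_])).
by apply: eq_bigr => i il; rewrite xi.
Qed.

Lemma radext_is_derive q y i x : is_derive x (delta_mx ord0 i) (radext q y) (radext1 q y i x).
Proof.
apply: is_derive_bigsum => j; apply: is_derive_scale.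
have h1 := is_derive_coordX x i l (2 * j).
have h2 := is_derive_horner_comp (iter j radlap q) (is_derive_sqdist x y i).
have := is_derive_mul h1 h2; rewrite [l == i]eq_sym.
by case: (eqVneq i l) => _; rewrite ?mulr0 ?add0r ?addr0 // mulrC.
Qed.

Lemma radext1_is_derive q y i x :
  is_derive x (delta_mx ord0 i) (radext1 q y i) (radext2 q y i x).
Proof.
apply: is_derive_bigsum => j; apply: is_derive_scale.
have h2 := is_derive_horner_comp (iter j radlap q) (is_derive_sqdist x y i).
have h3 := is_derive_horner_comp (iter j radlap q)^`() (is_derive_sqdist x y i).
case: (eqVneq i l) h2 h3 => [il|il] h2 h3.
  have h1 := is_derive_scale (2 * j)%:R (is_derive_coordX x i l (2 * j).-1).
  have := is_derive_mul h1 h2; rewrite il eqxx mulr0 mulr0 add0r.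
  by rewrite mulrC.
have h1 := is_derive_coordX x i l (2 * j); rewrite eq_sym (negbTE il) in h1.
have h4 : is_derive x (delta_mx ord0 i) (fun x => 2 * (x ord0 i - y ord0 i)) 2.
  have := is_derive_scale 2 (is_derive_add (is_derive_coord x (delta_mx ord0 i) i) (is_derive_cst (- y ord0 i) x _)).
  by rewrite mxE !eqxx addr0 mulr1.
by apply: (is_derive_eq (is_derive_mul h1 (is_derive_mul h3 h4))); ring.
Qed.

(** The vertical second derivative of term j cancels the thin Laplacian of term j - 1. What remains
    is the thin Laplacian of the last term, zero by [iter_radlap0]. *)
Lemma radext_harmonic q y x : \sum_i radext2 q y i x = 0.
Proof.
rewrite /radext2 exchange_big /=.
pose T j : R := (-1) ^+ j / (2 * j)`!%:R * x ord0 l ^+ (2 * j) * (iter j.+1 radlap q).[thin_sqdist l x y].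
have E (j : 'I_(size q)) : \sum_(i < d) ext_coef j *
  (if i == l then (2 * j)%:R * ((2 * j).-1%:R * x ord0 l ^+ (2 * j).-2) * (iter j radlap q).[thin_sqdist l x y]
   else x ord0 l ^+ (2 * j) *
     ((iter j radlap q)^`()^`().[thin_sqdist l x y] * (4 * (x ord0 i - y ord0 i) ^+ 2)
      + 2 * (iter j radlap q)^`().[thin_sqdist l x y])) =
   (if j == 0%N :> nat then 0 else - T j.-1) + T j.
  rewrite -mulr_sumr (bigD1 l) //= eqxx mulrDr; congr (_ + _).
    case: (nat_of_ord j) => [|m]; first by rewrite !mul0r mulr0.
    have e1 : (2 * m.+1)%N = (2 * m).+2 by rewrite mulnS.
    rewrite /T /ext_coef e1 succnK exprS; move: (2 * m)%N (iter m.+1 radlap q) => N p.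
    rewrite !factS !natrM [N.+2.-2]/=.
    have f0 : N`!%:R != 0 :> R by rewrite pnatr_eq0 -lt0n fact_gt0.
    have n1 : N.+1%:R != 0 :> R by rewrite pnatr_eq0.
    have n2 : N.+2%:R != 0 :> R by rewrite pnatr_eq0.
    move: n1 n2 f0; move: (N.+1%:R : R) (N.+2%:R : R) (N`!%:R : R) => a b c a0 b0 c0.
    by field; rewrite a0 b0 c0.
  rewrite /T /ext_coef -!mulrA; congr (_ * (_ * _)).
  rewrite (eq_bigr (fun i => x ord0 l ^+ (2 * j) *
     ((iter j radlap q)^`()^`().[thin_sqdist l x y] * (4 * (x ord0 i - y ord0 i) ^+ 2)
      + 2 * (iter j radlap q)^`().[thin_sqdist l x y]))); last first.
    by move=> i il; rewrite (negbTE il).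
  rewrite -mulr_sumr big_split /= -!mulr_sumr sumr_const cardC1 card_ord.
  congr (_ * _); move: (iter j radlap q) => p; rewrite /radlap.
  rewrite hornerD !hornerM hornerX !hornerC -/(thin_sqdist l x y) -[_ *+ d.-1]mulr_natr. ring.
rewrite (eq_bigr _ (fun j _ => E j)).
have tel N : \sum_(j < N) ((if j == 0%N :> nat then 0 else - T j.-1) + T j) =
    if N is m.+1 then T m else 0.
  elim: N => [|N IH]; first by rewrite big_ord0.
  rewrite big_ord_recr /= IH; case: N {IH} => [|m]; first by rewrite !add0r.
  by rewrite /= addrA subrr add0r.
rewrite tel; case Es : (size q) => [|m] //.
by rewrite /T -Es iter_radlap0 horner0 mulr0.
Qed.

End HarmonicExtension.

(** * A polynomial obstacle adapted to a compact set *)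

Section Obstacle.
Context {R : realType} {d : nat}.
Variable l : 'I_d.
Local Notation V := 'rV[R]_d.

Definition radsum (L : seq ({poly R} * V)) (x : V) : R :=
  \sum_(c <- L) c.1.[thin_sqdist l x c.2].

Lemma bernoulli (x : R) (n : nat) : -1 <= x -> 1 + n%:R * x <= (1 + x) ^+ n.
Proof.
move=> x1; elim: n => [|n IH]; first by rewrite mul0r addr0 expr0.
have x2 : 0 <= 1 + x by lra.
rewrite exprS; apply: le_trans (ler_wpM2l x2 IH).
by have := sqr_ge0 x; have n0 := ler0n R n; rewrite -natr1 expr2; nra.
Qed.

(** With t = u / w, Bernoulli applied to t^2 - 1 >= -1, followed by t^2 - 1 >= 2 (t - 1), gives the
    tangent inequality for u of either sign. *)
Lemma even_power_tangent (u w : R) (n : nat) : 0 < w -> (0 < n)%N ->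
  w ^+ (2 * n) + (2 * n)%:R * w ^+ (2 * n).-1 * (u - w) <= u ^+ (2 * n).
Proof.
move=> w0 n0; have wn0 : w != 0 by rewrite gt_eqF.
pose t := u / w; have uE : u = t * w by rewrite /t mulfVK.
have h1 : 1 + n%:R * (t ^+ 2 - 1) <= t ^+ (2 * n).
  by rewrite exprM; have := @bernoulli (t ^+ 2 - 1) n; rewrite [1 + (_ - 1)]addrC subrK; apply; have := sqr_ge0 t; lra.
have h2 : 1 + (2 * n)%:R * (t - 1) <= t ^+ (2 * n).
  apply: le_trans h1; rewrite lerD2l natrM mulrAC mulrC ler_wpM2l //.
  by have := sqr_ge0 (t - 1); rewrite !expr2; lra.
have -> : u ^+ (2 * n) = w ^+ (2 * n) * t ^+ (2 * n) by rewrite uE exprMn mulrC.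
apply: le_trans (ler_wpM2l (exprn_ge0 (2 * n) (ltW w0)) h2).
have wn : w ^+ (2 * n) = w ^+ (2 * n).-1 * w by rewrite -exprSr prednK // muln_gt0.
rewrite [leRHS]mulrDr mulr1 lerD2l le_eqVlt; apply/orP; left; apply/eqP.
by rewrite wn uE; ring.
Qed.

(** By Bernoulli q^(-2N) >= (N a)^2 with a = 1 / q - 1, and this square beats the factor 2 N; the
    threshold B also makes 1 + 2 N b exceed c. *)
Lemma power_choice (q E b c : R) : 0 < q -> q < 1 -> 0 <= E -> 0 < b ->
  exists N : nat, [/\ (0 < N)%N, (2 * N)%:R * q ^+ (2 * N).-1 * E <= 1,
    q ^+ (2 * N) * E <= 1 & c < (1 + b) ^+ (2 * N)].
Proof.
move=> q0 q1 E0 b0.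
pose a := q^-1 - 1.
have a0 : 0 < a by rewrite subr_gt0 invf_gt1.
have aq : 1 + a = q^-1 by rewrite /a addrC subrK.
pose B := 2 * E / (q * a ^+ 2) + `|c| / b + 1.
have B1 : 0 <= 2 * E / (q * a ^+ 2) by rewrite divr_ge0 ?mulr_ge0 ?sqr_ge0 // ltW.
have B2 : 0 <= `|c| / b by rewrite divr_ge0 // ltW.
have B0 : 0 <= B by rewrite /B; lra.
pose N := (Num.truncn B).+1.
have NB : B < N%:R by exact: truncnS_gt.
have Nr : 0 < N%:R :> R by rewrite ltr0n.
have main : (2 * N)%:R * q ^+ (2 * N).-1 * E <= 1.
  have h : (N%:R * a) ^+ 2 <= (q^-1) ^+ (2 * N).
    have p0 : 0 <= 1 + a by lra.
    rewrite mulnC exprM -aq lerXn2r ?nnegrE ?mulr_ge0 ?exprn_ge0 ?(ltW a0) //.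
    by have := @bernoulli a N; have := ltW a0; move=> a0' /(_ _); lra.
  have qn : q ^+ (2 * N) = q * q ^+ (2 * N).-1 by rewrite -exprS prednK.
  have h2 : (N%:R * a) ^+ 2 * (q * q ^+ (2 * N).-1) <= 1.
    by rewrite -qn -ler_pdivlMr ?exprn_gt0 // mul1r -exprVn.
  have h3 : 2 * E <= N%:R * (q * a ^+ 2).
    rewrite -ler_pdivrMr ?mulr_gt0 ?exprn_gt0 //; apply: ltW; apply: le_lt_trans NB.
    by rewrite /B; lra.
  have Q0 : 0 <= q ^+ (2 * N).-1 by rewrite exprn_ge0 // ltW.
  apply: le_trans h2; rewrite natrM.
  have -> : 2 * N%:R * q ^+ (2 * N).-1 * E = (N%:R * q ^+ (2 * N).-1) * (2 * E) by ring.
  have -> : (N%:R * a) ^+ 2 * (q * q ^+ (2 * N).-1) = (N%:R * q ^+ (2 * N).-1) * (N%:R * (q * a ^+ 2)) by ring.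
  by rewrite ler_wpM2l // mulr_ge0 // ltW.
exists N; split=> //.
- apply: le_trans main; rewrite ler_wpM2r //.
  have -> : q ^+ (2 * N) = q * q ^+ (2 * N).-1 by rewrite -exprS prednK.
  by rewrite ler_wpM2r ?exprn_ge0 ?(ltW q0) // (le_trans (ltW q1)) // ler1n muln_gt0.
- have h : 1 + (2 * N)%:R * b <= (1 + b) ^+ (2 * N) by apply: bernoulli; lra.
  apply: (lt_le_trans _ h); apply: (le_lt_trans (ler_norm c)).
  have : `|c| < N%:R * b by rewrite -ltr_pdivrMr //; apply: le_lt_trans NB; rewrite /B; lra.
  by have : 0 < N%:R * b; [rewrite mulr_gt0|rewrite natrM; lra].
Qed.

Lemma finite_net (r g : R) : 0 < g -> exists s : seq V,
  forall x : V, x ord0 l = 0 -> (forall i, `|x ord0 i| <= r) ->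
  exists2 y, y \in s & y ord0 l = 0 /\ forall i, `|x ord0 i - y ord0 i| <= g.
Proof.
move=> g0.
have [k kg] : exists k, (mesh k : R) <= g.
  have /cvgrPdist_le/(_ g g0)[k _ /(_ k (leqnn k))] := @mesh_cvg0 R.
  by rewrite sub0r normrN (gtr0_norm (mesh_gt0 k)); exists k.
pose N := absz (Num.floor ((`|r| + 1) * k.+1%:R)).
pose tau (t : {ffun 'I_d -> 'I_(2 * N).+1}) : 'rV[int]_d := \row_i (- N%:Z + (t i)%:Z).
exists [seq mesh_pt k (tau t) | t <- enum {ffun 'I_d -> 'I_(2 * N).+1}] => x xl xr.
exists (mesh_pt k (mesh_floor k x)); last first.
  split; first by rewrite !mxE xl mul0r floor0 mulr0z mulr0.
  by move=> i; rewrite distrC; apply: (le_trans (mesh_floor_close k x i)).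
apply/mapP.
have t0 : 0 <= (`|r| + 1) * k.+1%:R by rewrite mulr_ge0 // addr_ge0.
have NE : N%:Z = Num.floor ((`|r| + 1) * k.+1%:R) by rewrite /N gez0_abs // floor_ge0.
have zb i : - N%:Z <= mesh_floor k x ord0 i <= N%:Z.
  have := xr i; rewrite ler_norml => /andP[x1 x2]; rewrite NE mxE.
  have k0 : 0 < k.+1%:R :> R by rewrite ltr0n.
  have := ler_norm r => rr.
  apply/andP; split; last by apply: le_floor; rewrite ler_pM2r //; lra.
  rewrite floor_ge_int intrN.
  have /andP[_] := floor_itv ((`|r| + 1) * k.+1%:R); rewrite intrD mulr1z => f2.
  have k1 : 1 <= k.+1%:R :> R by rewrite ler1n.
  have : - (`|r| * k.+1%:R) <= x ord0 i * k.+1%:R by rewrite -mulNr ler_pM2r //; lra.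
  by move: f2; rewrite mulrDl mul1r; lra.
exists [ffun i => inord (absz (mesh_floor k x ord0 i + N%:Z))]; first by rewrite mem_enum.
congr (mesh_pt k _); apply/rowP => i; rewrite [RHS]mxE ffunE.
have := zb i => /andP[z1 z2].
rewrite inordK; last by lia.
by rewrite gez0_abs; [ring|lia].
Qed.

End Obstacle.

(** * Choice of the wells, touching paraboloids at the points of K *)

Section ObstacleExists.
Context {R : realType} {d : nat}.
Variable l : 'I_d.
Local Notation V := 'rV[R]_d.
Local Notation sqd := (thin_sqdist l).

Lemma thin_sqdist_coord (x y : V) i : i != l -> (x ord0 i - y ord0 i) ^+ 2 <= sqd x y.
Proof.
by move=> il; rewrite /thin_sqdist (bigD1 i) //= lerDl; apply: sumr_ge0 => j _; exact: sqr_ge0.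
Qed.

Lemma abs_le_of_sqr (u D : R) : u ^+ 2 <= D -> `|u| <= 1 + D.
Proof.
rewrite -[u ^+ 2]real_normK ?num_real //; have := normr_ge0 u; move: `|u| => t t0 h.
have := sqr_ge0 (t - 1); rewrite leNgt => h2; rewrite leNgt; apply/negP => h3.
by move: h2 h h3; rewrite -leNgt !expr2; nra.
Qed.

Lemma thin_sqdist_le2 (x y : V) : sqd x y <= 2 * sqd x 0 + 2 * sqd y 0.
Proof.
rewrite /thin_sqdist !mulr_sumr -big_split /=; apply: ler_sum => i _.
by rewrite !mxE !subr0; have := sqr_ge0 (x ord0 i + y ord0 i); rewrite !expr2; lra.
Qed.

Lemma sum_seq_le (s : seq V) (F : V -> R) (B : R) :
  (forall y, y \in s -> F y <= B) -> \sum_(y <- s) F y <= (size s)%:R * B.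
Proof.
move=> H; rewrite big_seq; apply: (@le_trans _ _ (\sum_(y <- s | y \in s) B)).
  by apply: ler_sum => y ys; exact: H.
by rewrite -big_seq big_const_seq count_predT iter_addr_0 mulr_natl.
Qed.

Section Polynomial.
Variables (s : seq V) (tau eta c0 : R) (N : nat).

Definition well_poly (y : V) : {poly R} := ((1 + tau * eta / 2)%:P - tau *: 'X) ^+ (2 * N).

Definition obstacle_data : seq ({poly R} * V) :=
  ('X - c0%:P, 0) :: [seq (well_poly y, y) | y <- s].

Let p (x y : V) := 1 + tau * eta / 2 - tau * sqd x y.

Lemma radsum_obstacle x : radsum l obstacle_data x =
  sqd x 0 - c0 + \sum_(y <- s) p x y ^+ (2 * N).
Proof.
rewrite /radsum big_cons big_map !hornerE; congr (_ + _); apply: eq_bigr => y _.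
by rewrite /well_poly horner_exp !hornerE.
Qed.

(* Each power (1 + ... - tau t)^(2N) lies above its tangent in t, hence above a
   concave paraboloid; completing the square in the sum gives the center [x1]. *)
Lemma obstacle_touching (x0 : V) (sigma Dm : R) : (0 < N)%N -> 0 <= tau ->
  x0 ord0 l = 0 -> sqd x0 0 <= sigma ->
  (forall y, y \in s -> [/\ y ord0 l = 0, 0 < p x0 y, sqd x0 y <= Dm & 0 <= Dm]) ->
  let mu y := (2 * N)%:R * p x0 y ^+ (2 * N).-1 * tau in
  \sum_(y <- s) mu y <= 2^-1 -> \sum_(y <- s) mu y * (1 + Dm) <= 1 ->
  exists A s0 x1, [/\ 0 <= A <= 1, s0 = sqd x0 x1 + 1, s0 <= 1 + 8 * sigma + 8 * d%:R &
    forall x : V, x ord0 l = 0 ->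
      - radsum l obstacle_data x <= - radsum l obstacle_data x0 - A * (sqd x x1 + 1 - s0)].
Proof.
move=> N0 tau0 x0l x0s Hy mu mu1 mu2.
pose m := \sum_(y <- s) mu y.
have mu_ge0 y : y \in s -> 0 <= mu y.
  by move=> /Hy [_ p0 _ _]; rewrite /mu !mulr_ge0 // exprn_ge0 // ltW.
have m0 : 0 <= m by rewrite /m big_seq; apply: sumr_ge0 => y ys; exact: mu_ge0.
(* Up to a constant, the tangent bound is - |x'|^2 + sum of mu_y |x' - y|^2: its leading coefficient
   is -(1 - m), and its center is - (sum of mu_y y) / (1 - m). *)
pose A := 1 - m.
have A2 : 2^-1 <= A by rewrite /A /m; lra.
have An0 : A != 0 by rewrite gt_eqF //; lra.
pose x1 : V := - A^-1 *: \sum_(y <- s) mu y *: y.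
have x1E i : A * x1 ord0 i = - \sum_(y <- s) mu y * y ord0 i.
  rewrite /x1 !mxE mulNr mulrN mulVKf // summxE; congr (- _).
  by apply: eq_bigr => y _; rewrite mxE.
exists A, (sqd x0 x1 + 1), x1; split=> //.
- by apply/andP; split; [|rewrite /A; lra]; lra.
(* Each coordinate satisfies |x0_i - x1_i| <= 2 (|x0_i| + 1), whose square is at most 8 x0_i^2 + 8.
   The bound is free of tau, N and the net, so c0 may be chosen from it. *)
- suff : sqd x0 x1 <= 8 * sigma + 8 * d%:R by lra.
  apply: (@le_trans _ _ (8 * sqd x0 0 + 8 * d%:R)); last by lra.
  have -> : 8 * sqd x0 0 + 8 * d%:R = \sum_(i < d | i != l) 8 * x0 ord0 i ^+ 2 + 8 * d%:R.
    by congr (_ + _); rewrite /thin_sqdist mulr_sumr; apply: eq_bigr => i _; rewrite mxE subr0.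
  apply: (@le_trans _ _ (\sum_(i < d | i != l) (8 * x0 ord0 i ^+ 2 + 8))); last first.
    rewrite big_split /= lerD2l sumr_const cardC1 card_ord -[_ *+ _]mulr_natr.
    by rewrite ler_wpM2l // ler_nat leq_pred.
  apply: ler_sum => i il.
  have h : `|A * (x0 ord0 i - x1 ord0 i)| <= `|x0 ord0 i| + 1.
    have -> : A * (x0 ord0 i - x1 ord0 i) = x0 ord0 i - \sum_(y <- s) mu y * (x0 ord0 i - y ord0 i).
      rewrite mulrBr x1E opprK /A mulrBl mul1r /m mulr_suml -addrA; congr (_ + _).
      rewrite addrC -sumrB -sumrN; apply: eq_bigr => y _; ring.
    apply: (le_trans (ler_normB _ _)); rewrite lerD2l.
    apply: (le_trans (ler_norm_sum _ _ _)); apply: le_trans mu2.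
    rewrite big_seq [leRHS]big_seq; apply: ler_sum => y ys.
    rewrite normrM ger0_norm ?mu_ge0 // ler_wpM2l ?mu_ge0 //.
    by have [_ _ h _] := Hy y ys; apply: abs_le_of_sqr; apply: le_trans h; exact: thin_sqdist_coord.
  have h2 : `|x0 ord0 i - x1 ord0 i| <= 2 * (`|x0 ord0 i| + 1).
    move: h; rewrite normrM (ger0_norm (_ : 0 <= A)); last by lra.
    move=> h; have := ler_wpM2r (normr_ge0 (x0 ord0 i - x1 ord0 i)) A2; lra.
  rewrite -[X in X <= _]real_normK ?num_real // -[x0 ord0 i ^+ 2]real_normK ?num_real //.
  have := normr_ge0 (x0 ord0 i - x1 ord0 i); move: h2.
  move: `|x0 ord0 i - x1 ord0 i| `|x0 ord0 i| => a b h2 a0.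
  have b0 : 0 <= 2 * (b + 1) by apply: le_trans h2.
  have : a ^+ 2 <= (2 * (b + 1)) ^+ 2 by rewrite lerXn2r ?nnegrE.
  by have := sqr_ge0 (b - 1); rewrite !expr2; lra.
- move=> x xl; rewrite !radsum_obstacle.
  have tang : \sum_(y <- s) (p x0 y ^+ (2 * N) - mu y * (sqd x y - sqd x0 y)) <=
     \sum_(y <- s) p x y ^+ (2 * N).
    rewrite big_seq [leRHS]big_seq; apply: ler_sum => y ys.
    have [_ p0 _ _] := Hy y ys; have := even_power_tangent (p x y) p0 N0.
    apply: le_trans; rewrite lerD2l le_eqVlt; apply/orP; left; apply/eqP.
    by rewrite /mu /p; ring.
  rewrite sumrB in tang.
  have id : A * (sqd x x1 + 1 - (sqd x0 x1 + 1)) = sqd x 0 - sqd x0 0 - \sum_(y <- s) mu y * (sqd x y - sqd x0 y).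
    have -> : A * (sqd x x1 + 1 - (sqd x0 x1 + 1)) = \sum_(i < d | i != l)
       (x ord0 i - x0 ord0 i) * (A * (x ord0 i + x0 ord0 i) - 2 * (A * x1 ord0 i)).
      have -> : A * (sqd x x1 + 1 - (sqd x0 x1 + 1)) = A * (sqd x x1 - sqd x0 x1) by ring.
      by rewrite -sumrB mulr_sumr; apply: eq_bigr => i _; ring.
    have -> : \sum_(y <- s) mu y * (sqd x y - sqd x0 y) = \sum_(i < d | i != l)
       \sum_(y <- s) mu y * ((x ord0 i - y ord0 i) ^+ 2 - (x0 ord0 i - y ord0 i) ^+ 2).
      rewrite exchange_big /=; apply: eq_bigr => y _.
      by rewrite -sumrB mulr_sumr.
    rewrite /thin_sqdist -!sumrB; apply: eq_bigr => i _.
    have AE t : A * t = t - \sum_(y <- s) mu y * t by rewrite /A mulrBl mul1r /m mulr_suml.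
    rewrite x1E AE !mxE !subr0.
    have -> : \sum_(y <- s) mu y * ((x ord0 i - y ord0 i) ^+ 2 - (x0 ord0 i - y ord0 i) ^+ 2) =
      (x ord0 i - x0 ord0 i) * (\sum_(y <- s) mu y * (x ord0 i + x0 ord0 i) - 2 * \sum_(y <- s) mu y * y ord0 i).
      by rewrite mulr_sumr -sumrB mulr_sumr; apply: eq_bigr => y _; ring.
    ring.
  by rewrite id; move: tang; lra.
Qed.

End Polynomial.

(** The order of choice is what matters: c0 from sigma and d, then a net at a scale set by delta in
    the cube outside which - |x'|^2 makes phi negative, then tau from the size of the net, and the
    exponent N last. *)
Lemma obstacle_exists (K : set V) (sigma delta : R) : 0 <= sigma -> 0 < delta ->
  (forall x, K x -> x ord0 l = 0 /\ sqd x 0 <= sigma) ->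
  exists L c0, [/\ 0 <= c0, (forall x : V, - radsum l L x <= c0),
    (forall x : V, x ord0 l = 0 -> 0 <= - radsum l L x ->
      (forall i, `|x ord0 i| <= 1 + c0) /\ exists2 k, K k & forall i, `|x ord0 i - k ord0 i| <= delta) &
    forall x0, K x0 -> exists A s0 x1, [/\ 0 <= A, 4 * A * s0 <= - radsum l L x0,
       s0 = sqd x0 x1 + 1 &
       forall x : V, x ord0 l = 0 ->
        - radsum l L x <= - radsum l L x0 - A * (sqd x x1 + 1 - s0)]].
Proof.
move=> sigma0 delta0 HK.
have d0 : (0 < d)%N by case: (l) => m; case: d.
have d1 : 1 <= d%:R :> R by rewrite ler1n.
(* At a point of K, sigma pays for |x0|^2, 1 for the sum of the wells, and the rest is at least 4 A
   s0 since A <= 1. *)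
pose c0 := sigma + 1 + 4 * (1 + 8 * sigma + 8 * d%:R).
have c00 : 0 <= c0 by rewrite /c0; lra.
(* A thin point x further than delta from K in the sup norm has a net point y with |x - y|^2 <= d
   g^2 <= eta / 4, and y is still at squared distance at least (delta / 2)^2 = eta from K. *)
pose g := delta / (4 * d%:R).
have g0 : 0 < g by rewrite divr_gt0 // mulr_gt0 //; lra.
have [s1 s1P] := finite_net l (1 + c0) g0.
pose eta := delta ^+ 2 / 4.
have eta0 : 0 < eta by rewrite divr_gt0 // exprn_gt0.
pose far (y : V) := y ord0 l = 0 /\ forall k, K k -> eta <= sqd k y.
pose s := [seq y <- s1 | `[< far y >]].
have sfar y : y \in s -> far y by rewrite mem_filter => /andP[/asboolP].
pose Dm := \sum_(y <- s) (2 * sigma + 2 * sqd y 0) + eta.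
have sq0 (x y : V) : 0 <= sqd x y by exact: thin_sqdist_ge0.
have Dsum : 0 <= \sum_(y <- s) (2 * sigma + 2 * sqd y 0).
  by apply: sumr_ge0 => y _; have := sq0 y 0; lra.
have Dm0 : 0 < Dm by rewrite /Dm; lra.
have DmP k y : K k -> y \in s -> sqd k y <= Dm.
  move=> Kk ys; apply: (le_trans (thin_sqdist_le2 k y)).
  have [_ kS] := HK k Kk; rewrite /Dm (big_rem y ys) /=.
  have : 0 <= \sum_(y <- rem y s) (2 * sigma + 2 * sqd y 0).
    by apply: sumr_ge0 => z _; have := sq0 z 0; lra.
  by lra.
(* Squared distances from K to the net are at most Dm, so the bases of the wells stay above 1 / 2 on
   K; [even_power_tangent] needs them positive. *)
pose tau := (2 * Dm)^-1.
have tau0 : 0 < tau by rewrite invr_gt0 mulr_gt0.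
have tauD : tau * Dm = 2^-1 by rewrite /tau; field; rewrite gt_eqF.
have taueta : tau * eta <= 2^-1.
  by rewrite -tauD ler_wpM2l ?(ltW tau0) // /Dm lerDr.
have te0 : 0 < tau * eta by exact: mulr_gt0.
(* On K the base of a well is at most 1 + tau eta / 2 - tau eta = q, while within squared distance
   eta / 4 of its center it is at least 1 + tau eta / 4. *)
pose q := 1 - tau * eta / 2.
pose J : R := (size s)%:R.
have J0 : 0 <= J by rewrite ler0n.
have e0 : 0 <= 2 * tau * (1 + Dm) by rewrite !mulr_ge0 //; lra.
pose E := J * (1 + 2 * tau * (1 + Dm)).
have E0 : 0 <= E by rewrite mulr_ge0 //; lra.
have [|||N [N0 N1 N2 N3]] := @power_choice R q E (tau * eta / 4) c0 _ _ E0.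
- by rewrite /q; lra.
- by rewrite /q; lra.
- by rewrite divr_gt0.
pose L := obstacle_data s tau eta c0 N.
have psum_ge0 x : 0 <= \sum_(y <- s) (1 + tau * eta / 2 - tau * sqd x y) ^+ (2 * N).
  by apply: sumr_ge0 => y _; rewrite exprM exprn_ge0 // sqr_ge0.
exists L, c0; split=> //.
- by move=> x; rewrite radsum_obstacle; have := psum_ge0 x; have := sq0 x 0; lra.
- move=> x xl; rewrite radsum_obstacle => phi0.
  have xc : sqd x 0 <= c0 by have := psum_ge0 x; lra.
  have xb i : `|x ord0 i| <= 1 + c0.
    case: (eqVneq i l) => [->|il]; first by rewrite xl normr0; lra.
    apply: abs_le_of_sqr; apply: le_trans xc; apply: le_trans (thin_sqdist_coord x 0 il).
    by rewrite mxE subr0.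
  split=> //; apply: contrapT => nk.
  have [y ys [yl xy]] := s1P x xl xb.
  have gd : g <= delta / 4.
    by rewrite /g ler_wpM2l ?(ltW delta0) // lef_pV2 ?posrE ?mulr_gt0 //; lra.
  have yfar : far y.
    split=> // k Kk; have [kl _] := HK k Kk.
    have [i] : exists i, delta < `|x ord0 i - k ord0 i|.
      apply: contrapT => H; apply: nk; exists k => // i.
      by rewrite leNgt; apply/negP => h; apply: H; exists i.
    case: (eqVneq i l) => [->|il]; first by rewrite xl kl subrr normr0; lra.
    move=> xk; have yk : delta / 2 <= `|k ord0 i - y ord0 i|.
      have := ler_distD (y ord0 i) (x ord0 i) (k ord0 i); have := xy i.
      by rewrite [`|y ord0 i - _|]distrC; lra.
    apply: le_trans (thin_sqdist_coord k y il).
    rewrite -[X in _ <= X]real_normK ?num_real //.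
    have -> : eta = (delta / 2) ^+ 2 by rewrite /eta; field.
    by rewrite lerXn2r ?nnegrE //; lra.
  have ys' : y \in s by rewrite mem_filter ys andbT; apply/asboolP.
  have xy2 : sqd x y <= eta / 4.
    apply: (@le_trans _ _ (\sum_(i < d) g ^+ 2)).
      rewrite [leRHS](bigD1 l) //=; apply: (@le_trans _ _ (\sum_(i < d | i != l) g ^+ 2)).
        apply: ler_sum => i _; rewrite -[X in X <= _]real_normK ?num_real //.
        by rewrite lerXn2r ?nnegrE ?(ltW g0).
      by rewrite lerDr sqr_ge0.
    rewrite sumr_const card_ord -[_ *+ d]mulr_natl.
    have -> : d%:R * g ^+ 2 = g * (delta / 4) by rewrite /g; field; rewrite gt_eqF //; lra.
    have -> : eta / 4 = delta / 4 * (delta / 4) by rewrite /eta; field.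
    by rewrite ler_wpM2r //; lra.
  have big : (1 + tau * eta / 4) ^+ (2 * N) <= (1 + tau * eta / 2 - tau * sqd x y) ^+ (2 * N).
    have : tau * sqd x y <= tau * (eta / 4) by rewrite ler_wpM2l // ltW.
    by move=> h; rewrite lerXn2r ?nnegrE //; lra.
  have : (1 + tau * eta / 2 - tau * sqd x y) ^+ (2 * N) <=
     \sum_(y <- s) (1 + tau * eta / 2 - tau * sqd x y) ^+ (2 * N).
    rewrite (big_rem y ys') /= lerDl; apply: sumr_ge0 => z _.
    by rewrite exprM exprn_ge0 // sqr_ge0.
  by have := sq0 x 0; move: phi0 big N3; rewrite mulrA; lra.
- move=> x0 Kx0; have [x0l x0s] := HK x0 Kx0.
  have pb y : y \in s -> 0 < 1 + tau * eta / 2 - tau * sqd x0 y <= q.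
    move=> ys; have [yl yf] := sfar y ys.
    have : tau * sqd x0 y <= tau * Dm by rewrite ler_wpM2l ?(ltW tau0) //; exact: DmP.
    have : tau * eta <= tau * sqd x0 y by rewrite ler_wpM2l ?(ltW tau0) //; exact: yf.
    by rewrite /q tauD => h1 h2; apply/andP; split; lra.
  have q0 : 0 <= q by rewrite /q; lra.
  have Q0 : 0 <= q ^+ (2 * N).-1 by rewrite exprn_ge0.
  have mub y : y \in s -> (2 * N)%:R * (1 + tau * eta / 2 - tau * sqd x0 y) ^+ (2 * N).-1 * tau <=
     (2 * N)%:R * q ^+ (2 * N).-1 * tau.
    move=> /pb/andP[p0 pq]; rewrite ler_wpM2r ?(ltW tau0) // ler_wpM2l //.
    by rewrite lerXn2r ?nnegrE // ltW.
  have W : J * ((2 * N)%:R * q ^+ (2 * N).-1 * tau * (1 + Dm)) <= 2^-1.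
    have h : (2 * N)%:R * q ^+ (2 * N).-1 * (J * (2 * tau * (1 + Dm))) <= 1.
      apply: le_trans N1; rewrite ler_wpM2l ?mulr_ge0 // /E ler_wpM2l //; lra.
    by move: h; set u := _ * q ^+ _; lra.
  have Pp : 0 <= J * ((2 * N)%:R * q ^+ (2 * N).-1 * tau) by rewrite !mulr_ge0 // ltW.
  have [|||A [t0 [x1 [/andP[A0 A1] s0E s0b touch]]]] :=
      @obstacle_touching s tau eta c0 N x0 sigma Dm N0 (ltW tau0) x0l x0s.
  - move=> y ys; have [yl _] := sfar y ys; have /andP[p0 _] := pb y ys.
    by split=> //; [exact: DmP|exact: ltW].
  - apply: (le_trans (sum_seq_le mub)); apply: le_trans W; rewrite -/J.
    rewrite [leRHS]mulrA; rewrite ler_peMr // lerDl; exact: ltW.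
  - apply: (@le_trans _ _ (J * ((2 * N)%:R * q ^+ (2 * N).-1 * tau * (1 + Dm)))).
      apply: sum_seq_le => y ys; rewrite ler_wpM2r ?mub //; lra.
    by apply: (le_trans W); lra.
  exists A, t0, x1; split=> //.
  have ps : \sum_(y <- s) (1 + tau * eta / 2 - tau * sqd x0 y) ^+ (2 * N) <= 1.
    apply: (@le_trans _ _ (J * q ^+ (2 * N))).
      apply: sum_seq_le => y /pb /andP[p0 pq].
      by rewrite lerXn2r ?nnegrE // ltW.
    apply: le_trans N2; rewrite mulrC ler_wpM2l ?exprn_ge0 // /E ler_peMr //; lra.
  rewrite radsum_obstacle.
  have t00 : 0 <= t0 by rewrite s0E addr_ge0.
  have : A * t0 <= 1 * t0 by rewrite ler_wpM2r.
  by rewrite /c0 -mulrA; lra.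
Qed.

End ObstacleExists.

(** * Functions of class C^2 *)

Section RealSecondDiff.
Context {R : realType}.

Lemma real_MVT_ge (F F1 : R -> R) (a b m : R) : a <= b ->
  (forall s : R, a <= s <= b -> is_derive s 1 F (F1 s)) ->
  (forall s : R, a <= s <= b -> m <= F1 s) -> m * (b - a) <= F b - F a.
Proof.
rewrite le_eqVlt => /orP[/eqP ->|ab] dF mF; first by rewrite !subrr mulr0.
have dF' s : s \in `]a, b[ -> is_derive s 1 F (F1 s).
  by move=> sab; apply: dF; move: sab; rewrite in_itv /= => /andP[/ltW -> /ltW ->].
have cF : {within `[a, b], continuous F}.
  apply: derivable_within_continuous => s; rewrite in_itv /= => sab.
  by have := dF s sab; case.
have [c cab ->] := MVT ab dF' cF.
rewrite ler_wpM2r ?subr_ge0 ?(ltW ab) // mF //.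
by move: cab; rewrite in_itv /= => /andP[/ltW -> /ltW ->].
Qed.

Lemma real_lip (F F1 : R -> R) (a b B : R) : a <= b ->
  (forall s : R, a <= s <= b -> is_derive s 1 F (F1 s)) ->
  (forall s : R, a <= s <= b -> `|F1 s| <= B) -> `|F b - F a| <= B * (b - a).
Proof.
move=> ab dF BF; rewrite ler_norml; apply/andP; split.
  rewrite -mulNr; apply: (real_MVT_ge ab dF) => s /BF.
  by rewrite ler_norml => /andP[].
rewrite -lerN2 opprB -mulNr.
have -> : F a - F b = (\- F) b - (\- F) a by rewrite /= opprK addrC.
apply: (@real_MVT_ge (\- F) (\- F1) _ _ _ ab) => s sab.
  by have := dF s sab => h; exact: is_deriveN.
by have := BF s sab; rewrite ler_norml /= lerN2 => /andP[].
Qed.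

(** The function F s + F (- s) - m s^2 has nonnegative derivative on [0, h], by the mean value
    inequality for F1 on [- s, s]. *)
Lemma real_second_diff (F F1 F2 : R -> R) (h m : R) : 0 <= h ->
  (forall s : R, `|s| <= h -> is_derive s 1 F (F1 s)) ->
  (forall s : R, `|s| <= h -> is_derive s 1 F1 (F2 s)) ->
  (forall s : R, `|s| <= h -> m <= F2 s) ->
  m * h ^+ 2 <= F h + F (- h) - 2 * F 0.
Proof.
move=> h0 d1 d2 mF.
have key (t : R) : 0 <= t <= h -> 2 * m * t <= F1 t - F1 (- t).
  move=> /andP[t0 th]; have := @real_MVT_ge F1 F2 (- t) t m; rewrite opprK => H.
  have -> : 2 * m * t = m * (t + t) by ring.
  by apply: H => [|s /andP[s1 s2]|s /andP[s1 s2]]; [lra|apply: d2|apply: mF]; rewrite ler_norml; apply/andP; split; lra.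
pose G s : R := F s + F (- s) - m * s ^+ 2.
suff : 0 * (h - 0) <= G h - G 0 by rewrite /G mul0r oppr0 expr0n /= mulr0; lra.
apply: (@real_MVT_ge G (fun s => F1 s - F1 (- s) - 2 * m * s) 0 h 0 h0) => s sh; last by have := key s sh; lra.
have s1 : `|s| <= h by move: sh => /andP[s1 s2]; rewrite ler_norml; apply/andP; split; lra.
have dN : is_derive s 1 (fun s => F (- s)) (- F1 (- s)).
  have dn : is_derive s 1 (fun s : R => - s) (- 1) by exact: is_deriveN.
  have dFn : is_derive (- s) 1 F (F1 (- s)) by apply: d1; rewrite normrN.
  have := @is_derive1_comp R F (fun s => - s) s (F1 (- s)) (- 1) dFn dn.
  by rewrite mulrN1.
have dX : is_derive s 1 (fun s : R => m * s ^+ 2) (2 * m * s).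
  apply: (@is_derive_quadratic _ _ _ _ _ _ `|m| 1) => // t _.
  rewrite /GRing.scale /= mulr1.
  have -> : m * (t + s) ^+ 2 - m * s ^+ 2 - t * (2 * m * s) = m * t ^+ 2 by ring.
  by rewrite normrM (ger0_norm (sqr_ge0 t)).
exact: is_deriveB (is_deriveD (d1 s s1) dN) dX.
Qed.

End RealSecondDiff.

Section C2.
Context {R : realType} {d : nat}.
Local Notation V := 'rV[R]_d.
Implicit Types (x y : V) (f : V -> R).

Lemma is_derive_line f y (v : V) (s df : R) :
  is_derive (y + s *: v) v f df -> is_derive s 1 (fun t => f (y + t *: v)) df.
Proof.
move=> [ex ev].
have E : (fun h : R => h^-1 *: ((f \o shift (y + s *: v)) (h *: v) - f (y + s *: v))) =
  (fun h : R => h^-1 *: (((fun t => f (y + t *: v)) \o shift s) (h *: (1 : R)) - f (y + s *: v))).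
  apply/funext => h /=; congr (_ *: (f _ - _)).
  by rewrite [h *: 1]mulr1 scalerDl addrCA.
split; first by move: ex; rewrite /derivable E.
by move: ev; rewrite /derive E.
Qed.

Lemma C2_is_derive (U : set V) f x i : C2_on U f -> U x ->
  is_derive x (delta_mx ord0 i) f (partial i f x) /\
  is_derive x (delta_mx ord0 i) (partial i f) (partial i (partial i f) x).
Proof.
by move=> H Ux; have [h1 _ h2 _] := H x Ux i i; split; split.
Qed.

Lemma open_cube (U : set V) x : open U -> U x ->
  exists2 r : R, 0 < r & forall y : V, (forall i, `|y ord0 i - x ord0 i| <= r) -> U y.
Proof.
move=> oU Ux; have /nbhs_cubeP[r r0 H] := open_nbhs_nbhs (conj oU Ux).
exists (r / 2); first by rewrite divr_gt0.
by move=> y yx; apply: H => i; apply: (le_lt_trans (yx i)); rewrite ltr_pdivrMr // ltr_pMr // ltr1n.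
Qed.

Lemma continuous_cube f x (e : R) : {for x, continuous f} -> 0 < e ->
  exists2 r : R, 0 < r & forall y : V, (forall i, `|y ord0 i - x ord0 i| <= r) -> `|f y - f x| <= e.
Proof.
move=> fc e0; have /(@cvgrPdist_le _ _ _ (nbhs x) _)/(_ e e0) := fc.
move=> /nbhs_cubeP[r r0 H]; exists (r / 2); first by rewrite divr_gt0.
move=> y yx; rewrite distrC; apply: H => i.
by apply: (le_lt_trans (yx i)); rewrite ltr_pdivrMr // ltr_pMr // ltr1n.
Qed.

(** The bound must hold around every base point y near x, because discrete minimum points only
    converge to x; continuity of the second derivative gives this uniformity. *)
Lemma second_diff_ge (U : set V) f x i (e : R) : open U -> U x -> C2_on U f -> 0 < e ->
  exists2 r : R, 0 < r & forall y h, (forall j, `|y ord0 j - x ord0 j| <= r) -> 0 < h <= r ->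
   (partial i (partial i f) x - e) * h ^+ 2 <=
     f (y + h *: delta_mx ord0 i) + f (y - h *: delta_mx ord0 i) - 2 * f y.
Proof.
move=> oU Ux C2 e0.
have [r1 r10 H1] := open_cube oU Ux.
have [_ _ _ c2] := C2 x Ux i i.
have [r2 r20 H2] := continuous_cube c2 e0.
pose r := Order.min r1 r2 / 2.
have m0 : 0 < Order.min r1 r2 by rewrite lt_min r10.
exists r; first by rewrite divr_gt0.
move=> y h yx /andP[h0 hr].
have cub s : `|s| <= h -> forall j, `|(y + s *: delta_mx ord0 i) ord0 j - x ord0 j| <= Order.min r1 r2.
  move=> sh j; have : `|s * (j == i)%:R| <= r.
    by rewrite normrM normr_nat; apply: le_trans hr; apply: le_trans sh; rewrite ler_piMr //; case: (j == i).
  rewrite !mxE eqxx /= addrAC => h1; apply: (le_trans (ler_normD _ _)).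
  by have := yx j; rewrite /r in h1 *; lra.
have inU s : `|s| <= h -> U (y + s *: delta_mx ord0 i).
  by move=> /cub c; apply: H1 => j; apply: (le_trans (c j)); rewrite ge_min lexx.
have := @real_second_diff R (fun s => f (y + s *: delta_mx ord0 i)) (fun s => partial i f (y + s *: delta_mx ord0 i))
   (fun s => partial i (partial i f) (y + s *: delta_mx ord0 i)) h (partial i (partial i f) x - e) (ltW h0).
rewrite scaleNr scale0r addr0; apply => s sh.
- by apply: is_derive_line; exact: (C2_is_derive i C2 (inU s sh)).1.
- by apply: is_derive_line; exact: (C2_is_derive i C2 (inU s sh)).2.
- have : forall j, `|(y + s *: delta_mx ord0 i) ord0 j - x ord0 j| <= r2.
    by move=> j; apply: (le_trans (cub s sh j)); rewrite ge_min lexx orbT.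
  by move=> /H2; rewrite ler_norml => /andP[+ _]; rewrite lerBrDr addrC.
Qed.

(** [C2_on] speaks of derivatives along coordinate directions only. These are bounded near x, and
    moving one coordinate at a time along [path] gives a Lipschitz bound at x. *)
Lemma C2_continuous (U : set V) f x : open U -> U x -> C2_on U f -> {for x, continuous f}.
Proof.
move=> oU Ux C2.
have [r1 r10 H1] := open_cube oU Ux.
have [r2 r20 H2] : exists2 r : R, 0 < r & forall y, (forall i, `|y ord0 i - x ord0 i| <= r) ->
    forall i, `|partial i f y| <= \sum_j `|partial j f x| + 1.
  have N : \forall y \near x, forall i, `|partial i f y| <= \sum_j `|partial j f x| + 1.
    apply: (@filter_forall _ _ (fun i y => `|partial i f y| <= \sum_j `|partial j f x| + 1) (nbhs x)) => i; have [_ c1 _ _] := C2 x Ux i i.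
    have [r r0 H] := continuous_cube c1 ltr01.
    apply/nbhs_cubeP; exists r => // y yx; have := H y (fun j => ltW (yx j)).
    move=> h; rewrite -[partial i f y](subrK (partial i f x)); apply: (le_trans (ler_normD _ _)).
    rewrite addrC lerD // (bigD1 i) //= lerDl; exact: sumr_ge0.
  have /nbhs_cubeP[r r0 H] := N; exists (r / 2); first by rewrite divr_gt0.
  by move=> y yx; apply: H => i; apply: (le_lt_trans (yx i)); rewrite ltr_pdivrMr // ltr_pMr // ltr1n.
set B := \sum_j `|partial j f x| + 1 in H2.
have B0 : 0 <= B by rewrite addr_ge0 // sumr_ge0.
pose r := Order.min r1 r2.
have r0 : 0 < r by rewrite lt_min r10.
pose path y (m : nat) : V := \row_j (if (j < m)%N then y ord0 j else x ord0 j).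
have key (t : R) y : 0 <= t <= r -> (forall i, `|y ord0 i - x ord0 i| <= t) -> forall m : nat,
    `|f (path y m) - f x| <= m%:R * (B * t).
  move=> /andP[t0 tr] yx; elim=> [|m IH].
    rewrite mul0r (_ : path y 0%N = x) ?subrr ?normr0 //.
    by apply/rowP => j; rewrite mxE ltn0.
  have Bt : 0 <= B * t by exact: mulr_ge0.
  have [dm|md] := leqP d m.
    have -> : path y m.+1 = path y m.
      apply/rowP => j; have jm := leq_trans (ltn_ord j) dm.
      by rewrite !mxE jm (leq_trans jm).
    by apply: (le_trans IH); rewrite ler_wpM2r // ler_nat.
  pose i := Ordinal md; pose c := y ord0 i - x ord0 i.
  have pE : path y m.+1 = path y m + c *: delta_mx ord0 i.
    apply/rowP => j; rewrite !mxE eqxx /= ltnS leq_eqVlt -[j == m :> nat]/(j == i).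
    case: (eqVneq j i) => [->|ji] /=; last by rewrite mulr0 addr0.
    by rewrite ltnn mulr1 /c addrC subrK.
  have ct : `|c| <= t by exact: yx.
  have near_x s : `|s| <= `|c| -> forall j, `|(path y m + s *: delta_mx ord0 i) ord0 j - x ord0 j| <= r.
    move=> sc j; apply: le_trans tr; rewrite !mxE eqxx /=.
    case: (eqVneq j i) => [->|ji]; rewrite ?mulr1 ?mulr0 ?addr0.
      by rewrite ltnn addrAC subrr add0r; apply: (le_trans sc).
    by case: ifP => _; rewrite ?subrr ?normr0.
  have step (a b : R) : a <= b -> (forall s, a <= s <= b -> `|s| <= `|c|) ->
      `|f (path y m + b *: delta_mx ord0 i) - f (path y m + a *: delta_mx ord0 i)| <= B * (b - a).
    move=> ab hs; apply: (@real_lip R (fun s => f (path y m + s *: delta_mx ord0 i))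
      (fun s => partial i f (path y m + s *: delta_mx ord0 i))) => // s /hs sc.
      apply: is_derive_line; apply: (C2_is_derive i C2 _).1.
      by apply: H1 => j; apply: (le_trans (near_x s sc j)); rewrite ge_min lexx.
    by apply: H2 => j; apply: (le_trans (near_x s sc j)); rewrite ge_min lexx orbT.
  have step0 : `|f (path y m.+1) - f (path y m)| <= B * `|c|.
    rewrite pE; have [c0|c0] := leP 0 c.
      have st := @step 0 c c0; rewrite scale0r addr0 subr0 in st.
      rewrite (ger0_norm c0); apply: st => s /andP[s0 sc].
      by rewrite (ger0_norm s0) (ger0_norm c0).
    have st := @step c 0 (ltW c0); rewrite scale0r addr0 sub0r in st.
    rewrite (ltr0_norm c0) distrC; apply: st => s /andP[s0 sc].
    by rewrite (ler0_norm sc) (ltr0_norm c0) lerN2.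
  have -> : f (path y m.+1) - f x = (f (path y m) - f x) + (f (path y m.+1) - f (path y m)) by ring.
  rewrite -natr1 mulrDl mul1r; apply: (le_trans (ler_normD _ _)); apply: lerD => //.
  by apply: (le_trans step0); rewrite ler_wpM2l.
suff H : f y @[y --> x] --> f x by exact: H.
apply/(@cvgrPdist_le _ _ _ (nbhs x) _) => e e0.
have D0 : 0 < d%:R * B + 1 by rewrite ltr_wpDl // mulr_ge0.
pose t := Order.min r (e / (d%:R * B + 1)).
have t0 : 0 < t by rewrite lt_min r0 divr_gt0.
apply/nbhs_cubeP; exists t => // y yx; rewrite distrC.
have := @key t y; rewrite (ltW t0) ge_min lexx /= => /(_ isT (fun i => ltW (yx i)) d).
have -> : path y d = y by apply/rowP => j; rewrite mxE ltn_ord.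
move=> /le_trans; apply; rewrite mulrA; apply: (@le_trans _ _ ((d%:R * B + 1) * t)).
  by rewrite ler_wpM2r ?(ltW t0) // lerDl.
by rewrite mulrC -ler_pdivlMr // ge_min lexx orbT.
Qed.

(** The candidates g and h agree with the derivatives only on U; as U is open, derivability and
    continuity are transferred by equality near each point. *)
Lemma harmonic_on_intro (U : set V) f (g : 'I_d -> V -> R) (h : 'I_d -> 'I_d -> V -> R) :
  open U ->
  (forall x, U x -> forall i j, [/\ is_derive x (delta_mx ord0 i) f (g i x),
     {for x, continuous (g i)}, is_derive x (delta_mx ord0 j) (g i) (h i j x) &
     {for x, continuous (h i j)}]) ->
  (forall x, U x -> \sum_i h i i x = 0) -> harmonic_on U f.
Proof.
move=> oU H S.
have E1 x i : U x -> partial i f x = g i x.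
  by move=> Ux; have [h1 _ _ _] := H x Ux i i; rewrite /partial derive_val.
have nU x : U x -> \forall y \near x, U y by move=> Ux; exact: open_nbhs_nbhs.
have N1 x i : U x -> \forall y \near x, g i y = partial i f y.
  by move=> Ux; apply: filterS (nU x Ux) => y Uy; rewrite E1.
have D2 x i j : U x -> is_derive x (delta_mx ord0 j) (partial i f) (h i j x).
  move=> Ux; have [_ _ h3 _] := H x Ux i j.
  exact: near_eq_is_derive (N1 x i Ux) h3.
have E2 x i j : U x -> partial j (partial i f) x = h i j x.
  by move=> Ux; have := D2 x i j Ux => dd; rewrite /partial derive_val.
have nc (g1 g2 : V -> R) x : (\forall y \near x, g1 y = g2 y) -> {for x, continuous g1} -> {for x, continuous g2}.
  move=> N c; have e : g1 x = g2 x by exact: (@nbhs_singleton _ x [set y | g1 y = g2 y] N).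
  have h1 : (g2 y @[y --> x] `=>` g1 y @[y --> x]) by exact: (@near_eq_cvg _ _ (nbhs x) _ g1 g2 N).
  have : g2 @ x --> g1 x by exact: (cvg_trans h1 c).
  by rewrite e; exact.
split=> x Ux.
  move=> i j; have [h1 h2 h3 h4] := H x Ux i j; split.
  - by case: h1.
  - exact: nc (N1 x i Ux) h2.
  - by have := D2 x i j Ux; case.
  - apply: nc h4; apply: filterS (nU x Ux) => y Uy; by rewrite E2.
rewrite /laplacian (eq_bigr (fun i => h i i x)); first exact: S.
by move=> i _; exact: E2.
Qed.

End C2.

(** * Global solutions *)

Lemma polyfun_cvg (R : realType) (d : nat) (f : 'rV[R]_d -> R) x :
  polyfun f -> f y @[y --> x] --> f x.
Proof. by move=> pf; have := polyfun_continuous pf; apply. Qed.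

Lemma continuous_add_at (R : realType) (d : nat) (f g : 'rV[R]_d -> R) x :
  {for x, continuous f} -> {for x, continuous g} -> {for x, continuous (fun y => f y + g y)}.
Proof.
move=> cf cg; exact: (@cvgD _ _ _ (nbhs x) _ f g _ _ cf cg).
Qed.

Lemma all_second_diff_ge (R : realType) (d : nat) (U : set 'rV[R]_d) (f : 'rV[R]_d -> R) x (e : R) :
  open U -> U x -> C2_on U f -> 0 < e ->
  exists2 r : R, 0 < r & forall i (y : 'rV[R]_d) h, (forall j, `|y ord0 j - x ord0 j| <= r) -> 0 < h <= r ->
   (partial i (partial i f) x - e) * h ^+ 2 <=
     f (y + h *: delta_mx ord0 i) + f (y - h *: delta_mx ord0 i) - 2 * f y.
Proof.
move=> oU Ux C2 e0.
have /choice[rr H] i : exists r : R, 0 < r /\ forall (y : 'rV[R]_d) h, (forall j, `|y ord0 j - x ord0 j| <= r) ->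
   0 < h <= r -> (partial i (partial i f) x - e) * h ^+ 2 <=
     f (y + h *: delta_mx ord0 i) + f (y - h *: delta_mx ord0 i) - 2 * f y.
  by have [r r0 H] := second_diff_ge i oU Ux C2 e0; exists r.
exists (\big[Order.min/1]_i rr i).
  by apply: lt_bigmin => // i _; have [] := H i.
move=> i y h yx /andP[h0 hr]; have le : \big[Order.min/1]_i rr i <= rr i by exact: bigmin_le.
have [_ Hi] := H i; apply: Hi => [j|]; first exact: le_trans (yx j) le.
by rewrite h0 (le_trans hr).
Qed.

Lemma sum_second_diff (R : comPzRingType) (d : nat) (a b : 'I_d -> R) (e h : R) :
  \sum_i ((a i - e) * h + (- b i - e) * h - e * (2 * h)) =
  (\sum_i a i - \sum_i b i - 4 * (d%:R * e)) * h.
Proof.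
have -> : 4 * (d%:R * e) = \sum_(i < d) (4 * e).
  by rewrite sumr_const card_ord -[RHS]mulr_natl; ring.
by rewrite -!sumrB mulr_suml; apply: eq_bigr => i _; ring.
Qed.

Section Assembly.
Context {R : realType} {d : nat}.
Variable l : 'I_d.
Hypothesis d3 : (3 <= d)%N.
Local Notation V := 'rV[R]_d.
Variables (L : seq ({poly R} * V)) (c0 : R).
Hypothesis c00 : 0 <= c0.

Let phi (x : V) : R := - radsum l L x.

Hypothesis phi_le : forall x, phi x <= c0.
Hypothesis phi_bdd : forall x : V, x ord0 l = 0 -> 0 <= phi x -> forall i, `|x ord0 i| <= 1 + c0.

Definition radsum_ext (x : V) : R := \sum_(c <- L) radext l c.1 c.2 x.

Lemma polyfun_radsum_ext : polyfun radsum_ext.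
Proof. by apply: polyfun_sum => c _; exact: polyfun_radext. Qed.

Lemma radsum_ext_thin (x : V) : x ord0 l = 0 -> radsum_ext x = - phi x.
Proof. by move=> xl; rewrite opprK; apply: eq_bigr => c _; exact: radext_thin. Qed.

Lemma polyfun_radsum : polyfun phi.
Proof.
rewrite (_ : phi = (fun x => -1 * radsum l L x)); last by apply/funext => x; rewrite mulN1r.
apply: polyfunM; first exact: polyfun_cst.
by apply: polyfun_sum => c _; apply: polyfun_horner; exact: polyfun_thin_sqdist.
Qed.

Lemma radsum_ext_harmonic x : \sum_i partial i (partial i radsum_ext) x = 0.
Proof.
have E1 i : partial i radsum_ext = fun x => \sum_(c <- L) radext1 l c.1 c.2 i x.
  by apply: partial_eq => y; apply: is_derive_bigseq => c; exact: radext_is_derive.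
have E2 i : partial i (partial i radsum_ext) = fun x => \sum_(c <- L) radext2 l c.1 c.2 i x.
  by rewrite E1; apply: partial_eq => y; apply: is_derive_bigseq => c; exact: radext1_is_derive.
under eq_bigr do rewrite E2.
by rewrite exchange_big big1 // => c _; exact: radext_harmonic.
Qed.

Lemma polyfun_partial (f : V -> R) i : polyfun f ->
  polyfun (partial i f) /\ forall x, is_derive x (delta_mx ord0 i) f (partial i f x).
Proof.
by move=> pf; have [g pg fg] := polyfun_is_derive pf i; rewrite (partial_eq fg).
Qed.

(** On the thin space u = v - phi, so the sign condition reads v >= phi and zeros of u are contact
    points, where phi = v >= 0. Adding the harmonic polynomial affects neither harmonicity nor
    superharmonicity. *)
Lemma obstacle_solution : exists u : V -> R,
  [/\ continuous u, forall x : V, x ord0 l = 0 -> 0 <= u x,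
      forall x y : V, (forall i, y ord0 i = if i == l then - x ord0 i else x ord0 i) -> u y = u x,
      harmonic_on (~` ([set x : V | x ord0 l = 0] `&` [set x | u x = 0])) u &
   [/\ viscosity_superharmonic u, polynomial_growth u,
      forall x : V, x ord0 l = 0 -> u x = 0 -> 0 <= phi x &
      forall (x0 : V) A s0 x1, x0 ord0 l = 0 -> 0 <= A -> 4 * A * s0 <= phi x0 ->
        s0 = thin_sqdist l x0 x1 + 1 ->
        (forall x : V, x ord0 l = 0 -> phi x <= phi x0 - A * (thin_sqdist l x x1 + 1 - s0)) ->
        u x0 = 0]].
Proof.
have [U [FU HU]] := ultraFilterLemma (F := \oo) _.
have pphi := polyfun_radsum; have pext := polyfun_radsum_ext.
have [C [C0 HC]] := polyfun_local pphi (1 + c0).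
have phi_cont := polyfun_continuous pphi.
have phiM : forall x : V, x ord0 l = 0 -> phi x <= c0 by move=> x _.
have C20 : 0 <= 2 * C by lra.
(* In the expansion phi x + s a + s^2 b with coefficients bounded by C, the loss is at most C |s| +
   C s^2 <= 2 C |s|; the second difference below keeps only the two s^2 terms. *)
have phi_lip (x : V) i (s : R) : x ord0 l = 0 -> 0 < phi x -> `|s| <= 1 ->
    phi x - 2 * C * `|s| <= phi (x + s *: delta_mx ord0 i).
  move=> xl p0 s1; have [_ [a [aC Ha]]] := HC x i (phi_bdd xl (ltW p0)).
  have [b [-> bC]] := Ha s s1.
  have h1 : `|s * a| <= C * `|s| by rewrite normrM mulrC ler_wpM2r.
  have h2 : `|s ^+ 2 * b| <= C * `|s|.
    rewrite normrM mulrC ler_pM // normrX expr2 ler_piMl //.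
  by move: h1 h2; rewrite !ler_norml => /andP[h1 _] /andP[h2 _]; lra.
have phi_semi (x : V) i (s : R) : x ord0 l = 0 -> 0 < phi x -> `|s| <= 1 ->
    - (2 * C * s ^+ 2) <= phi (x + s *: delta_mx ord0 i) + phi (x - s *: delta_mx ord0 i) - 2 * phi x.
  move=> xl p0 s1; have [_ [a [aC Ha]]] := HC x i (phi_bdd xl (ltW p0)).
  have [b [-> bC]] := Ha s s1.
  have [|b' [eb' bC']] := Ha (- s); first by rewrite normrN.
  rewrite scaleNr in eb'; rewrite eb' sqrrN.
  have s2 := sqr_ge0 s.
  have h b0 : `|b0| <= C -> - (C * s ^+ 2) <= s ^+ 2 * b0.
    by rewrite ler_norml => /andP[h _]; have := ler_wpM2l s2 h; lra.
  by have := h _ bC; have := h _ bC'; lra.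
pose v := ulift U (discrete_sol l phi).
have v_cont : continuous v := limit_sol_continuous FU HU c00 C20 phiM phi_lip phi_semi.
have v_bound := limit_sol_bound FU c00 phiM.
have v_ge := @limit_sol_ge _ _ l U FU HU phi c0 c00 phi_cont phiM.
have v_lip := limit_sol_lip FU HU c00 C20 phiM phi_lip phi_semi.
have v_even := @limit_sol_even _ _ l U FU HU phi c0 (2 * C) c00 C20 phiM phi_lip phi_semi.
have v_near := @limit_sol_harm_near _ _ l U FU HU phi c0 (2 * C) c00 C20 phi_cont phiM phi_lip phi_semi.
have LB0 : 0 <= sol_lip (d := d) c0 (2 * C) by rewrite /sol_lip !addr_ge0 ?mulr_ge0.
pose u x := radsum_ext x + v x.
have u_cont : continuous u.
  move=> x; have cv : v y @[y --> x] --> v x by have := v_cont; apply.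
  have h := @continuous_add_at R d radsum_ext v x (@polyfun_cvg R d _ x pext) cv.
  exact: h.
have u_thin (x : V) : x ord0 l = 0 -> u x = v x - phi x.
  by move=> xl; rewrite /u radsum_ext_thin // addrC.
exists u; split; [exact: u_cont| | | |].
- by move=> x xl; rewrite u_thin // subr_ge0; exact: v_ge.
- move=> x y yx; rewrite /u /v (v_even x y yx); congr (_ + _).
  apply: eq_bigr => c _; apply: radext_even; first by rewrite yx eqxx.
  by move=> i il; rewrite yx (negbTE il).
- have oU : open (~` ([set x : V | x ord0 l = 0] `&` [set x | u x = 0])).
    apply: closed_openC; apply: closedI.
      have /continuous_closedP/(_ [set t | t = 0]) := @rV_coord_continuous R d l.
      by apply; exact: closed_eq.
    have /continuous_closedP/(_ [set t | t = 0]) := u_cont.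
    by apply; exact: closed_eq.
  have data x : (~` ([set x : V | x ord0 l = 0] `&` [set x | u x = 0])) x ->
      (forall i j, [/\ is_derive x (delta_mx ord0 i) v (ugrad U (discrete_sol l phi) i x),
     {for x, continuous (ugrad U (discrete_sol l phi) i)},
     is_derive x (delta_mx ord0 j) (ugrad U (discrete_sol l phi) i) (uhess U (discrete_sol l phi) i j x) &
     {for x, continuous (uhess U (discrete_sol l phi) i j)}]) /\
     \sum_i uhess U (discrete_sol l phi) i i x = 0.
    move=> nx.
    have [r r0 hr] : exists2 r : R, 0 < r & \forall k \near U, forall z, cube k x r z ->
      `|discrete_sol l phi k z| <= c0 + sol_lip (d := d) c0 (2 * C) /\ dlap (discrete_sol l phi k) z = 0.
      apply: v_near; case: (eqVneq (x ord0 l) 0) => [xl|]; [right|by left].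
      rewrite -subr_gt0 -/(v x) -(u_thin x xl) lt0r; apply/andP; split.
        by apply/eqP => ux; apply: nx.
      by rewrite u_thin // subr_ge0; exact: v_ge.
    by apply: (ulift_harmonic FU HU _ r0 hr); rewrite addr_ge0.
  apply: (@harmonic_on_intro _ _ _ _
    (fun i x => partial i radsum_ext x + ugrad U (discrete_sol l phi) i x)
    (fun i j x => partial j (partial i radsum_ext) x + uhess U (discrete_sol l phi) i j x)) => // x nx.
    move=> i j; have [h1 h2 h3 h4] := (data x nx).1 i j.
    have [p1 q1] := polyfun_partial i pext; have [p2 q2] := polyfun_partial j p1.
    split.
    + exact: is_derive_add.
    + exact: (continuous_add_at (@polyfun_cvg R d _ x p1) h2).
    + exact: is_derive_add.
    + exact: (continuous_add_at (@polyfun_cvg R d _ x p2) h4).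
  by rewrite big_split /= radsum_ext_harmonic (data x nx).2 addr0.
split.
(* If the test function had positive Laplacian, then g = f - P - eta |y - x|^2 would touch v
   strictly from below with positive second difference sums at all small scales, against
   [no_strict_touching]. *)
- move=> x W f oW Wx C2f fx fle; rewrite leNgt; apply/negP => lap0.
  set lam := laplacian f x in lap0.
  have d0 : 0 < d%:R :> R by rewrite ltr0n; case: (d) d3.
  (* Per direction, eta is lost for f, eta for P and 2 eta for the quadratic term: in all 4 d eta =
     lam / 2. *)
  pose eta := lam / (8 * d%:R).
  have eta0 : 0 < eta by rewrite divr_gt0 // mulr_gt0.
  have eta8 : d%:R * eta = lam / 8 by rewrite /eta; field; rewrite gt_eqF.
  have Next : C2_on setT (fun x => - 1 * radsum_ext x).
    by apply: polyfun_C2; apply: polyfunM => //; exact: polyfun_cst.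
  have lapN i : partial i (partial i (fun x => - 1 * radsum_ext x)) x = - partial i (partial i radsum_ext) x.
    have [p1 q1] := polyfun_partial i pext; have [p2 q2] := polyfun_partial i p1.
    rewrite (_ : partial i (fun x => - 1 * radsum_ext x) = (fun x => - 1 * partial i radsum_ext x)).
      rewrite (_ : partial i (fun x => - 1 * partial i radsum_ext x) = (fun x => - 1 * partial i (partial i radsum_ext) x)) ?mulN1r //.
      by apply: partial_eq => y; exact: is_derive_scale.
    by apply: partial_eq => y; exact: is_derive_scale.
  have [r1 r10 H1] : exists2 r : R, 0 < r & forall i (y : V) h, (forall j, `|y ord0 j - x ord0 j| <= r) -> 0 < h <= r ->
      (partial i (partial i f) x - eta) * h ^+ 2 <= f (y + h *: delta_mx ord0 i) + f (y - h *: delta_mx ord0 i) - 2 * f y.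
    exact: (all_second_diff_ge oW Wx C2f eta0).
  have [r2 r20 H2] : exists2 r : R, 0 < r & forall i (y : V) h, (forall j, `|y ord0 j - x ord0 j| <= r) -> 0 < h <= r ->
      (- partial i (partial i radsum_ext) x - eta) * h ^+ 2 <=
       - 1 * radsum_ext (y + h *: delta_mx ord0 i) + - 1 * radsum_ext (y - h *: delta_mx ord0 i) - 2 * (- 1 * radsum_ext y).
    have [r r0 H] := all_second_diff_ge openT (I : [set: V] x) Next eta0.
    by exists r => // i y h yx hr; have := H i y h yx hr; rewrite lapN.
  have [r3 r30 H3] := open_cube oW Wx.
  pose r := Order.min r1 (Order.min r2 r3).
  have r0 : 0 < r by rewrite !lt_min r10 r20.
  have rr1 : r <= r1 by rewrite ge_min lexx.
  have rr2 : r <= r2 by rewrite !ge_min lexx orbT.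
  have rr3 : r <= r3 by rewrite !ge_min lexx !orbT.
  pose Q (y : V) : R := \sum_i (y ord0 i - x ord0 i) ^+ 2.
  have pQ : polyfun Q.
    apply: polyfun_sum => i _; apply: polyfunX; apply: polyfunD; first exact: polyfun_coord.
    exact: polyfun_cst.
  pose g (y : V) : R := f y + - 1 * radsum_ext y + - eta * Q y.
  have Qx : Q x = 0 by apply: big1 => i _; rewrite subrr expr2 mulr0.
  have LB1 : sol_lip (d := d) c0 (2 * C) <= c0 + sol_lip (d := d) c0 (2 * C) by rewrite lerDr.
  apply: (@no_strict_touching R d U FU HU (discrete_sol l phi) (c0 + sol_lip (d := d) c0 (2 * C)) _ _ _ v_lip x g r eta) => //.
  - move=> k z; have /andP[h1 h2] := discrete_sol_bound c00 phiM k z.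
    by rewrite ger0_norm // (le_trans h2) // lerDl.
  - move=> k z z'; apply: (le_trans (discrete_sol_mesh_lip c00 C20 phiM phi_lip phi_semi k z z')).
    by rewrite ler_wpM2r // sumr_ge0.
  - by move=> k z; have [_ + _] := discrete_sol_super c00 phiM k; apply.
  - by rewrite /g Qx fx /u mulr0 addr0 mulN1r addrAC subrr add0r.
  - have c1 := C2_continuous oW Wx C2f.
    have c2 := @polyfun_cvg R d _ x (polyfunM (polyfun_cst (- 1)) pext).
    have c3 := @polyfun_cvg R d _ x (polyfunM (polyfun_cst (- eta)) pQ).
    exact: (continuous_add_at (continuous_add_at c1 c2) c3).
  - move=> y yx; have := fle y (H3 y (fun i => le_trans (yx i) rr3)).
    by rewrite /g /u -/(Q y) -/(v y); lra.
  - move=> y h yx /andP[h0 hr].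
    have rhalf : r / 2 <= r by rewrite ler_pdivrMr // ler_peMr ?ler1n // ltW.
    have hh : 0 < h ^+ 2 by rewrite exprn_gt0.
    have y1 j : `|y ord0 j - x ord0 j| <= r1 by rewrite (le_trans (yx j)) // (le_trans rhalf).
    have y2 j : `|y ord0 j - x ord0 j| <= r2 by rewrite (le_trans (yx j)) // (le_trans rhalf).
    have hr1 : 0 < h <= r1 by rewrite h0 (le_trans hr) // (le_trans rhalf).
    have hr2 : 0 < h <= r2 by rewrite h0 (le_trans hr) // (le_trans rhalf).
    have Q2 i : Q (y + h *: delta_mx ord0 i) + Q (y - h *: delta_mx ord0 i) - 2 * Q y = 2 * h ^+ 2.
      rewrite /Q !(bigD1 i isT) /= !mxE !eqxx /= mulr1.
      have E s : \sum_(j < d | j != i) ((y + s *: delta_mx ord0 i) ord0 j - x ord0 j) ^+ 2 =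
         \sum_(j < d | j != i) (y ord0 j - x ord0 j) ^+ 2.
        by apply: eq_bigr => j ji; rewrite !mxE (negbTE ji) andbF mulr0 addr0.
      by rewrite -scaleNr !E; ring.
    have [a aE] : exists a : 'I_d -> R, forall i, partial i (partial i f) x = a i.
      by exists (fun i => partial i (partial i f) x).
    have [b bE] : exists b : 'I_d -> R, forall i, partial i (partial i radsum_ext) x = b i.
      by exists (fun i => partial i (partial i radsum_ext) x).
    have aS : \sum_i a i = lam by apply: eq_bigr => i _; rewrite aE.
    have bS : \sum_i b i = 0.
      by have := radsum_ext_harmonic x; under eq_bigr do rewrite bE.
    apply: (@lt_le_trans _ _ (\sum_(i < d) ((a i - eta) * h ^+ 2 +
        (- b i - eta) * h ^+ 2 - eta * (2 * h ^+ 2)))).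
      rewrite sum_second_diff aS bS subr0 eta8; apply: mulr_gt0 => //.
      by move: (lam) lap0 => t t0; lra.
    apply: ler_sum => i _; rewrite -(Q2 i).
    have := H1 i y h y1 hr1; have := H2 i y h y2 hr2; rewrite aE bE /g.
    move: (f _) (f _) (f _) (Q _) (Q _) (Q _) (radsum_ext _) (radsum_ext _) (radsum_ext _).
    by move=> x1' x2' x3' x4' x5' x6' x7' x8' x9'; lra.
- apply: (@polyfun_growth_poly _ _ radsum_ext v c0 pext) => x.
  by have /andP[h1 h2] := v_bound x; rewrite ger0_norm.
- move=> x xl; rewrite u_thin // => /eqP; rewrite subr_eq0 => /eqP <-.
  by have /andP[] := v_bound x.
- move=> x0 A s0 x1 x0l A0 As0 s0E touch; apply/eqP; rewrite u_thin // subr_eq0 eq_le v_ge // andbT.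
  exact: (ulift_le_touching d3 FU HU c00 phiM A0 As0 x0l s0E touch).
Qed.

End Assembly.

(** * Boundaries and Hausdorff distance *)

Section Boundary.
Context {R : realType} {n : nat}.
Local Notation W := 'rV[R]_n.
Implicit Types (A B K : set W) (x y : W).

Lemma closure_cubeP A x : closure A x <->
  forall e : R, 0 < e -> exists2 y, A y & forall i, `|y ord0 i - x ord0 i| < e.
Proof.
split=> [cA e e0|H B /nbhs_cubeP[e e0 HB]].
  have [|y [Ay yx]] := cA [set y : W | forall i, `|y ord0 i - x ord0 i| < e].
    by apply/nbhs_cubeP; exists e.
  by exists y.
by have [y Ay yx] := H e e0; exists y; split=> //; exact: HB.
Qed.

Lemma interior_cubeP A x : interior A x <->
  exists2 e : R, 0 < e & forall y, (forall i, `|y ord0 i - x ord0 i| < e) -> A y.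
Proof. exact: nbhs_cubeP. Qed.

Lemma boundaryP A x : boundary A x <-> closure A x /\ closure (~` A) x.
Proof.
split=> [[cA nI]|[cA cC]]; split=> //.
  apply/closure_cubeP => e e0; apply: contrapT => H; apply: nI.
  apply/interior_cubeP; exists e => // y yx; apply: contrapT => nA; apply: H.
  by exists y.
move=> /interior_cubeP[e e0 H]; have /closure_cubeP/(_ e e0)[y nA yx] := cC.
by apply: nA; exact: H.
Qed.

Lemma boundaryC A : boundary (~` A) = boundary A.
Proof.
apply/seteqP; split=> x /boundaryP [h1 h2]; apply/boundaryP; split=> //.
  by rewrite setCK in h2.
by rewrite setCK.
Qed.

Lemma closed_boundary A : closed (boundary A).
Proof.
rewrite /boundary setDE; apply: closedI; first exact: closed_closure.
by apply: open_closedC; exact: open_interior.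
Qed.

(** The boundary point is the one at the supremum of the parameters in [0, 1] whose point lies in A;
    being on the segment, it is no further from either end than the ends are from each other. *)
Lemma boundary_segment A x y : A x -> ~ A y -> exists2 p, boundary A p &
  forall i, `|p ord0 i - x ord0 i| <= `|y ord0 i - x ord0 i| /\
            `|p ord0 i - y ord0 i| <= `|y ord0 i - x ord0 i|.
Proof.
move=> Ax nAy.
pose g (s : R) : W := x + s *: (y - x).
have gE s i : g s ord0 i = x ord0 i + s * (y ord0 i - x ord0 i) by rewrite !mxE.
pose S := [set s : R | 0 <= s <= 1 /\ A (g s)].
have S0 : S 0 by split; [rewrite lexx ler01|rewrite /g scale0r addr0].
have ubS : ubound S 1 by move=> s [/andP[]].
have hS : has_sup S by split; [exists 0|exists 1].
pose t := sup S.
have t0 : 0 <= t by apply: ub_le_sup => //; exists 1.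
have t1 : t <= 1 by apply: ge_sup => //; exists 0.
pose b : R := 1 + \sum_i `|y ord0 i - x ord0 i|.
have b0 : 0 < b by rewrite ltr_pwDl // sumr_ge0.
have gb s s' i : `|g s ord0 i - g s' ord0 i| <= `|s - s'| * b.
  rewrite !gE.
  have -> : x ord0 i + s * (y ord0 i - x ord0 i) - (x ord0 i + s' * (y ord0 i - x ord0 i)) =
    (s - s') * (y ord0 i - x ord0 i) by ring.
  rewrite normrM ler_wpM2l // /b (bigD1 i) //= addrCA lerDl.
  by rewrite addr_ge0 // sumr_ge0.
exists (g t).
  apply/boundaryP; split; apply/closure_cubeP => e e0.
    have eb : 0 < e / b by rewrite divr_gt0.
    have [s Ss ts] := sup_adherent eb hS.
    have st : s <= t by apply: ub_le_sup => //; exists 1.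
    exists (g s); first by case: Ss.
    move=> i; apply: (le_lt_trans (gb s t i)); rewrite -ltr_pdivlMr //.
    by rewrite -/t in ts; rewrite distrC ger0_norm ?subr_ge0 //; lra.
  have [t1'|t1'] := eqVneq t 1.
    exists y; first exact: nAy.
    by move=> i; rewrite t1' gE mul1r [x ord0 i + _]addrC subrK subrr normr0.
  have tl : t < 1 by rewrite lt_neqAle t1' t1.
  pose s := Order.min 1 (t + e / b / 2).
  have eb : 0 < e / b / 2 by rewrite !divr_gt0.
  have ts : t < s by rewrite lt_min tl ltrDl.
  have s1 : s <= 1 by rewrite ge_min lexx.
  have st : s <= t + e / b / 2 by rewrite ge_min lexx orbT.
  exists (g s).
    move=> Ag; have : s <= t by apply: ub_le_sup; [exists 1|split=> //; lra].
    by lra.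
  move=> i; apply: (le_lt_trans (gb s t i)); rewrite -ltr_pdivlMr //.
  by rewrite gtr0_norm ?subr_gt0 //; lra.
move=> i; rewrite gE; split.
  have -> : x ord0 i + t * (y ord0 i - x ord0 i) - x ord0 i = t * (y ord0 i - x ord0 i) by ring.
  by rewrite normrM ger0_norm // ler_piMl.
have -> : x ord0 i + t * (y ord0 i - x ord0 i) - y ord0 i = (t - 1) * (y ord0 i - x ord0 i) by ring.
rewrite normrM ler_piMl // ler_norml; apply/andP; split; lra.
Qed.

(** Next to each boundary point there is a point at positive distance from the closed set K, and
    compactness of the boundary makes this distance uniform. A contact set within delta of K then
    cannot fill the holes of K at scale e. *)
Lemma boundary_outer_points K (e : R) : compact K -> 0 < e ->
  exists2 delta : R, 0 < delta & forall x : W, boundary K x ->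
    exists2 y : W, forall i, `|y ord0 i - x ord0 i| <= e &
      forall k : W, K k -> exists i, delta < `|y ord0 i - k ord0 i|.
Proof.
move=> cK e0.
have clK : closed K by apply: compact_closed => //; exact: norm_hausdorff.
have cB : compact (boundary K).
  by apply: (subclosed_compact (@closed_boundary K) cK) => x [/clK].
pose P (delta : R) (x : W) := exists2 y : W, forall i, `|y ord0 i - x ord0 i| <= e &
      forall k : W, K k -> exists i, delta < `|y ord0 i - k ord0 i|.
have H : forall x, boundary K x -> \forall x' \near x & delta \near 0^'+, P delta x'.
  move=> x /boundaryP[_ /closure_cubeP cC].
  have [|y nKy yx] := cC (e / 2); first by rewrite divr_gt0.
  have oK : open (~` K) by exact: closed_openC.
  have /nbhs_cubeP[r r0 Hr] := open_nbhs_nbhs (conj oK nKy).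
  exists ([set x' : W | forall i, `|x' ord0 i - x ord0 i| < e / 2], [set s : R | s < r]).
    split; last exact: nbhs_right_lt.
    by apply/nbhs_cubeP; exists (e / 2) => //; rewrite divr_gt0.
  move=> [x' s] /= [x'x sr]; exists y.
    move=> i; have := yx i; have := x'x i; rewrite distrC => h1 h2.
    by apply: (dist_trans_le (ltW h2) (ltW h1)); lra.
  move=> k Kk; apply: contrapT => nk; apply: (Hr k) => // i.
  rewrite distrC; apply: le_lt_trans sr; rewrite leNgt; apply/negP => h.
  by apply: nk; exists i.
have cov := (@compact_near_coveringP _ (boundary K)).1 cB R (0^'+) P _ H.
have : \forall delta \near 0^'+, 0 < delta /\ boundary K `<=` P delta.
  by near=> s; split; near: s; [exact: nbhs_right_gt|exact: cov].
by move=> /filter_ex[s [s0 Hs]]; exists s.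
Unshelve. all: by end_near. Qed.

End Boundary.

(** Closeness e / (d + 1) in each coordinate is enough for the Euclidean norm, since d (e / (d +
    1))^2 <= e^2. *)
Lemma hausdorff_dist_le (R : realType) (d : nat) (A B : set 'rV[R]_d) (e : R) : 0 <= e ->
  (forall x, A x -> exists2 y, B y & forall i, `|x ord0 i - y ord0 i| <= e / d.+1%:R) ->
  (forall y, B y -> exists2 x, A x & forall i, `|y ord0 i - x ord0 i| <= e / d.+1%:R) ->
  (hausdorff_dist A B <= e%:E)%E.
Proof.
move=> e0 HA HB.
have en (x y : 'rV[R]_d) : (forall i, `|x ord0 i - y ord0 i| <= e / d.+1%:R) -> enorm (x - y) <= e.
  move=> xy; rewrite /enorm -[leRHS]ger0_norm // -sqrtr_sqr ler_sqrt ?sqr_ge0 //.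
  have t0 : 0 <= e / d.+1%:R by rewrite divr_ge0.
  apply: (@le_trans _ _ (\sum_(i < d) (e / d.+1%:R) ^+ 2)).
    apply: ler_sum => i _; rewrite !mxE -[X in X <= _]real_normK ?num_real //.
    by rewrite lerXn2r ?nnegrE.
  rewrite sumr_const card_ord -[_ *+ d]mulr_natl expr2 mulrA.
  have de : d%:R * (e / d.+1%:R) <= e.
    by rewrite mulrCA ler_piMr // ler_pdivrMr ?ltr0n // mul1r ler_nat.
  apply: (@le_trans _ _ (e * (e / d.+1%:R))); first by rewrite ler_wpM2r.
  by rewrite expr2 ler_wpM2l // ler_pdivrMr ?ltr0n // ler_peMr // ler1n.
have half (A' B' : set 'rV[R]_d) :
    (forall x, A' x -> exists2 y, B' y & forall i, `|x ord0 i - y ord0 i| <= e / d.+1%:R) ->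
    (ereal_sup [set edist_set x B' | x in A'] <= e%:E)%E.
  move=> H; apply: ge_ereal_sup => _ [x Ax <-]; have [y By xy] := H x Ax.
  apply: (@le_trans _ _ (enorm (x - y))%:E); last by rewrite lee_fin en.
  by apply: ereal_inf_lbound; exists y.
by rewrite /hausdorff_dist !ge_max lee_fin e0 (half _ _ HA) (half _ _ HB).
Qed.

Section ThinSpace.
Context {R : realType} {n : nat}.
Local Notation last := (rshift n (ord0 : 'I_1)).

Lemma thin_spaceE : (@thin_space R n) = [set x | x ord0 last = 0].
Proof. by apply/funext => x; rewrite /thin_space /= mxE. Qed.

Lemma join_point_last (x' : 'rV[R]_n) t : join_point x' t ord0 last = t.
Proof. by rewrite /join_point row_mxEr mxE. Qed.

Lemma join_point_lshift (x' : 'rV[R]_n) t i : join_point x' t ord0 (lshift 1 i) = x' ord0 i.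
Proof. by rewrite /join_point row_mxEl. Qed.

Lemma thin_embed_thin (x' : 'rV[R]_n) : thin_embed x' ord0 last = 0.
Proof. exact: join_point_last. Qed.

Lemma thin_embedK (x : 'rV[R]_(n + 1)) : x ord0 last = 0 -> thin_embed (lsubmx x) = x.
Proof.
move=> xl; apply/rowP => i; rewrite -[i]fintype.splitK; case: (fintype.split i) => j /=.
  by rewrite join_point_lshift mxE.
by rewrite (ord1 j) join_point_last xl.
Qed.

Lemma thin_embed_close (x y : 'rV[R]_n) (e : R) : 0 <= e ->
  (forall i, `|x ord0 i - y ord0 i| <= e) ->
  forall i, `|thin_embed x ord0 i - thin_embed y ord0 i| <= e.
Proof.
move=> e0 xy i; rewrite -[i]fintype.splitK; case: (fintype.split i) => j /=.
  by rewrite !join_point_lshift.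
by rewrite (ord1 j) !join_point_last subrr normr0.
Qed.

Lemma lsubmx_continuous : continuous (@lsubmx R 1 n 1).
Proof.
move=> x A /nbhs_cubeP[e e0 H]; apply/nbhs_cubeP; exists e => // y yx.
by apply: H => i; rewrite !mxE; exact: yx.
Qed.

Lemma thin_preimage_compact (K : set 'rV[R]_(n + 1)) : K `<=` thin_space -> compact K ->
  compact (thin_embed @^-1` K).
Proof.
move=> Kthin cK.
have -> : thin_embed @^-1` K = [set lsubmx x | x in K].
  apply/seteqP; split=> [x' Kx|_ [x Kx <-]].
    by exists (thin_embed x') => //; rewrite /thin_embed /join_point row_mxKl.
  by rewrite /= thin_embedK //; have := Kthin x Kx; rewrite thin_spaceE.
apply: continuous_compact cK; apply: continuous_subspaceT; exact: lsubmx_continuous.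
Qed.

End ThinSpace.

Theorem theorem1p5 (R : realType) (n : nat) (hn : (2 <= n)%N)
    (K : set 'rV[R]_(n + 1)) (hK_thin : K `<=` thin_space)
    (hK : compact K) (eps : R) (heps : 0 < eps) :
  exists u : 'rV[R]_(n + 1) -> R,
    [/\ global_solution u,
        polynomial_growth u,
        K `<=` contact_set u,
        (hausdorff_dist (contact_set u) K <= eps%:E)%E &
        (hausdorff_dist (free_boundary u) (thin_boundary K) <= eps%:E)%E].
Proof.
pose l : 'I_(n + 1) := rshift n ord0.
have d3 : (3 <= n + 1)%N by rewrite addn1.
have thinE (x : 'rV[R]_(n + 1)) : K x -> x ord0 l = 0.
  by move=> /hK_thin; rewrite thin_spaceE.
have [sigma sigma0 Ksigma] : exists2 sigma : R, 0 <= sigma &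
    forall x, K x -> thin_sqdist l x 0 <= sigma.
  have cc : compact [set thin_sqdist l x 0 | x in K].
    apply: continuous_compact hK; apply: continuous_subspaceT.
    by apply: polyfun_continuous; exact: polyfun_thin_sqdist.
  have [M [_ HM]] := compact_bounded cc.
  exists (`|M| + 1) => [|x Kx]; first by rewrite addr_ge0.
  have : M < `|M| + 1 by rewrite (le_lt_trans (ler_norm M)) // ltrDl.
  by move=> /HM/(_ _ (ex_intro2 _ _ x Kx erefl)); exact: le_trans (ler_norm _).
pose K' := thin_embed @^-1` K.
have cK' : compact K' by exact: thin_preimage_compact.
have clK' : closed K' by apply: compact_closed => //; exact: norm_hausdorff.
pose e : R := eps / (n + 1).+1%:R.
have e0 : 0 < e by rewrite divr_gt0.
have [delta delta0 outer] := boundary_outer_points cK' e0.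
(* The bound by delta keeps the outer points off the contact set; the bound by e / 2 leaves e / 2
   for replacing a free boundary point by a nearby contact point. *)
pose dl := Order.min delta (e / 2).
have dl0 : 0 < dl by rewrite lt_min delta0 divr_gt0.
have dld : dl <= delta by rewrite ge_min lexx.
have dle : dl <= e / 2 by rewrite ge_min lexx orbT.
have [L [c0 [c00 phi_le phi_bdd touch]]] :=
  @obstacle_exists R (n + 1) l K sigma dl sigma0 dl0 (fun x Kx => conj (thinE x Kx) (Ksigma x Kx)).
have [u [u_cont u_ge0 u_even u_harm [u_super u_growth u_zero u_touch]]] :=
  @obstacle_solution R (n + 1) l d3 L c0 c00 phi_le (fun x xl px => (phi_bdd x xl px).1).
have uK x : K x -> u x = 0.
  move=> Kx; have [A [s0 [x1 [A0 As0 s0E Htouch]]]] := touch x Kx.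
  by apply: (u_touch x A s0 x1) => //; exact: thinE.
have u_near (x : 'rV[R]_(n + 1)) : x ord0 l = 0 -> u x = 0 -> exists2 k, K k & forall i, `|x ord0 i - k ord0 i| <= dl.
  by move=> xl ux; have [] := phi_bdd x xl (u_zero x xl ux).
have Ku : K `<=` contact_set u.
  move=> x Kx; exists (lsubmx x); last by apply: thin_embedK; exact: thinE.
  by rewrite /= thin_embedK ?uK //; exact: thinE.
pose Z := [set x' : 'rV[R]_n | u (thin_embed x') = 0].
have posE : [set x' : 'rV[R]_n | 0 < u (thin_embed x')] = ~` Z.
  apply/funext => x'; apply/propext; split=> /= [h h0|h]; first by move: h; rewrite h0 ltxx.
  by rewrite lt0r u_ge0 ?andbT; [apply/eqP|exact: thin_embed_thin].
have K'Z : K' `<=` Z by move=> x' /uK.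
have Znear x' : Z x' -> exists2 k, K' k & forall i, `|x' ord0 i - k ord0 i| <= dl.
  move=> /(u_near _ (thin_embed_thin x'))[k Kk xk]; exists (lsubmx k).
    by rewrite /K' /= thin_embedK //; exact: thinE.
  by move=> i; have := xk (lshift 1 i); rewrite join_point_lshift !mxE.
exists u; split=> //.
- split=> //.
  + by move=> x'; apply: u_ge0; exact: thin_embed_thin.
  + by rewrite thin_spaceE.
  + move=> x' t; apply: u_even => i; rewrite -[i]fintype.splitK; case: (fintype.split i) => j /=.
      rewrite !join_point_lshift; case: eqP => // h; exfalso.
      by have := congr1 val h => /=; have := ltn_ord j; lia.
    by rewrite (ord1 j) !join_point_last eqxx opprK.
- apply: hausdorff_dist_le (ltW heps) _ _.
  + move=> _ [x' ux <-]; have [k Kk xk] := u_near _ (thin_embed_thin x') ux.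
    by exists k => // i; apply: (le_trans (xk i)); rewrite -/e; lra.
  + by move=> k Kk; exists k; [exact: Ku|move=> i; rewrite subrr normr0 divr_ge0 // ltW].
- rewrite /free_boundary posE boundaryC; apply: hausdorff_dist_le (ltW heps) _ _; rewrite -/e.
  (* Near a free boundary point x' there is a contact point, hence some k in K' within e. If x' lies
     in K', it is a boundary point of K' since points outside Z, which contains K', approach it;
     otherwise the segment from k to x' meets the boundary of K'. *)
  + move=> _ [x' /boundaryP[/closure_cubeP cZ cnZ] <-].
    have [z Zz zx] := cZ (e / 2) (divr_gt0 e0 (ltr0n R 2)).
    have [k Kk zk] := Znear z Zz.
    have xk i : `|x' ord0 i - k ord0 i| <= e.
      by apply: (dist_trans_le _ (zk i) (e := e / 2)); [rewrite distrC ltW|lra].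
    have [Kx|nKx] := pselect (K' x').
      exists (thin_embed x'); last by move=> i; rewrite subrr normr0 ltW.
      exists x' => //; apply/boundaryP; split; first by apply: subset_closure.
      by apply: (closure_subset _ cnZ); exact: subsetC.
    have [p bp px] := boundary_segment Kk nKx.
    exists (thin_embed p); first by exists p.
    apply: thin_embed_close (ltW e0) _ => i; rewrite distrC.
    exact: le_trans (px i).2 (xk i).
  (* A boundary point x' of K' is in Z, and the outer point y within e of it is not, so the segment
     between them meets the free boundary. *)
  + move=> _ [x' bx <-].
    have [y yx ynear] := outer x' bx.
    have Zx : Z x' by apply: K'Z; apply: clK'; case: bx.
    have nZy : ~ Z y.
      move=> /Znear[k Kk yk]; have [i] := ynear k Kk.
      by rewrite ltNge (le_trans (yk i)).
    have [p bp px] := boundary_segment Zx nZy.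
    exists (thin_embed p); first by exists p.
    apply: thin_embed_close (ltW e0) _ => i; rewrite distrC.
    exact: le_trans (px i).1 (yx i).
Qed.
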